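(* The Min Tree Length problem is NP-hard for the class of multi-graphs: given a finite multi-graph $G$, finding a tree layout $(T,\varphi)$ of $G$ minimizing $L(T,\varphi,G)$ is NP-hard.
   Context: A multi-graph is a finite undirected graph possibly with parallel edges but without loops. A tree layout of $G$ is a pair $(T,\varphi)$ where $T$ is a tree all of whose nodes have degree $1$ or $3$ and $\varphi:V(G)\to V_L(T)$ is a bijection onto the set of leaves of $T$. Its length is $L(T,\varphi,G)=\sum_{\{u,v\}\in E(G)} d_T(\varphi(u),\varphi(v))$, the sum taken over all edges of $G$ counted with multiplicity, where $d_T$ is the path distance in $T$. The Min Tree Length problem asks, given $G$, for a tree layout of minimum length. *)

(* Defs.v *)
From mathcomp Require Import all_boot all_algebra.

Set Implicit Arguments.
Unset Strict Implicit.
Unset Printing Implicit Defensive.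

Import GRing.Theory.

Definition word := seq bool.

(** Work symbols are the two input bits, the symbols of an auxiliary finite
    alphabet, and the blank [None]. *)
Definition cell (aux : finType) : finType := option (bool + aux)%type.

Inductive move := Lft | Stay | Rgt.

(** The number of tapes is [extra.+1].  The transition table is a function on
    finite types, so it carries only a finite amount of information. *)
Record machine := Machine {
  extra : nat;
  state : finType;
  aux   : finType;
  start : state;
  final : pred state;
  trans : state -> {ffun 'I_extra.+1 -> cell aux} ->
          state * {ffun 'I_extra.+1 -> cell aux * move}
}.

(** A two-way infinite tape: the cells strictly left of the head (nearest
    first), and those from the scanned cell on; all cells not listed are
    blank. *)
Record tape (aux : finType) := Tape {
  before : seq (cell aux);
  after  : seq (cell aux)
}.

Section Semantics.

Variable M : machine.

Definition scanned (t : tape (aux M)) : cell (aux M) := head None (after t).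

Definition act (a : cell (aux M) * move) (t : tape (aux M)) : tape (aux M) :=
  let: (c, m) := a in
  let r := behead (after t) in
  match m with
  | Lft  => Tape (behead (before t)) (head None (before t) :: c :: r)
  | Stay => Tape (before t) (c :: r)
  | Rgt  => Tape (c :: before t) r
  end.

Definition config : Type := state M * ('I_(extra M).+1 -> tape (aux M)).

(** Final configurations are fixed points of [step], so that "halts within t
    steps" is "is final after t iterations". *)
Definition step (c : config) : config :=
  let: (q, ts) := c in
  if final q then c else
  let: (q', a) := trans q [ffun i => scanned (ts i)] in
  (q', fun i => act (a i) (ts i)).

Definition init (x : word) : config :=
  (start M, fun i => Tape [::]
     (if i == ord0 then [seq Some (inl b) | b <- x] else [::])).

Fixpoint leading_bits (s : seq (cell (aux M))) : word :=
  match s with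
  | Some (inl b) :: s' => b :: leading_bits s'
  | _ => [::]
  end.

(** The output is the block of bits on the first tape that starts at the
    head. *)
Definition output (c : config) : word := leading_bits (after (c.2 ord0)).

Definition computes_within (time : nat -> nat) (f : word -> word) : Prop :=
  forall x, let c := iter (time (size x)) step (init x) in
    final c.1 /\ output c = f x.

End Semantics.

Definition polytime (f : word -> word) : Prop :=
  exists (M : machine) (p : {poly nat}),
    computes_within M (fun n => p.[n]%R) f.

(** Self-delimiting pairing: each bit of [x] is preceded by [true], and a
    single [false] marks the end of [x]. *)
Definition pair_word (x y : word) : word :=
  flatten [seq [:: true; b] | b <- x] ++ false :: y.

Definition language := word -> Prop.

Definition NP (A : language) : Prop :=
  exists (V : word -> word) (p : {poly nat}), polytime V /\
    forall x, A x <->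
      exists c, size c <= p.[size x]%R /\ V (pair_word x c) = [:: true].

Definition many_one_reducible (A B : language) : Prop :=
  exists f, polytime f /\ forall x, A x <-> B (f x).

Definition NP_hard (B : language) : Prop :=
  forall A, NP A -> many_one_reducible A B.

(** A search problem relates an instance to its correct solutions. *)
Definition search_problem := word -> word -> Prop.

(** [A] is decided in polynomial time from an arbitrary correct solution of a
    single instance [f x] of [R].  The instance must be solvable, as otherwise
    the condition on solutions would be vacuous. *)
Definition reducible_to_search (A : language) (R : search_problem) : Prop :=
  exists f g, [/\ polytime f, polytime g &
    forall x, (exists y, R (f x) y) /\
      forall y, R (f x) y -> (A x <-> g (pair_word x y) = [:: true])].

Definition NP_hard_search (R : search_problem) : Prop :=
  forall A, NP A -> reducible_to_search A R.

(** An edge is listed once, in one of its two orientations; parallel edges are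
    repetitions, up to orientation, in the list. *)
Record multigraph := Multigraph {
  nverts : nat;
  edges : seq ('I_nverts * 'I_nverts);
  loopless : all (fun e => e.1 != e.2) edges
}.

Section Trees.

Variables (T : finType) (adj : rel T).

Definition degree (u : T) : nat := #|[set v | adj u v]|.

Definition leaves : {set T} := [set u | degree u == 1].

(** In a simple graph, [:: u; v] is a [ucycle] whenever [u] and [v] are
    adjacent; genuine cycles are those with at least 3 vertices. *)
Definition is_tree : Prop :=
  [/\ symmetric adj, irreflexive adj, 0 < #|T|,
      forall u v, connect adj u v
    & forall c : seq T, ucycle adj c -> size c <= 2].

(** The least number of edges of a walk from [u] to [v], and [#|T|] if there
    is none. *)
Definition dist (u v : T) : nat :=
  find (fun n => [exists p : n.-tuple T, path adj u p && (last u p == v)])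
       (iota 0 #|T|).

End Trees.

Record layout (n : nat) := Layout {
  nodes : nat;
  adj   : rel 'I_nodes;
  phi   : 'I_n -> 'I_nodes
}.

Definition tree_layout (G : multigraph) (l : layout (nverts G)) : Prop :=
  [/\ is_tree (@adj _ l),
      forall t, degree (@adj _ l) t = 1 \/ degree (@adj _ l) t = 3,
      injective (@phi _ l)
    & [set phi l v | v : 'I_(nverts G)] = leaves (@adj _ l)].

Definition layout_length (G : multigraph) (l : layout (nverts G)) : nat :=
  \sum_(e <- edges G) dist (@adj _ l) (phi l e.1) (phi l e.2).

Definition optimal_layout (G : multigraph) (l : layout (nverts G)) : Prop :=
  tree_layout l /\
  forall l' : layout (nverts G), tree_layout l' ->
    layout_length l <= layout_length l'.

(** Numbers are written in unary.  For vertices and nodes this is polynomially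
    equivalent to binary, since their number is a lower bound on the size of
    the object; for the threshold it can only make hardness stronger. *)
Definition encode_nats (s : seq nat) : word :=
  flatten [seq rcons (nseq n true) false | n <- s].

Definition multigraph_nats (G : multigraph) : seq nat :=
  nverts G :: flatten [seq [:: val e.1; val e.2] | e <- edges G].

Definition encode_multigraph (G : multigraph) : word :=
  encode_nats (multigraph_nats G).

Definition encode_instance (G : multigraph) (k : nat) : word :=
  encode_nats (k :: multigraph_nats G).

(** Number of vertices of the graph, number of nodes of the tree, the images
    of the vertices in order, then the edges of the tree, each once. *)
Definition encode_layout (n : nat) (l : layout n) : word :=
  encode_nats (n :: nodes l ::
    [seq val (phi l v) | v <- enum 'I_n] ++
    flatten [seq [:: val e.1; val e.2] |
               e : 'I_(nodes l) * 'I_(nodes l) <- enum {: 'I_(nodes l) * 'I_(nodes l)}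
               & (e.1 < e.2) && adj e.1 e.2]).

Definition min_tree_length : search_problem := fun w y =>
  exists (G : multigraph) (l : layout (nverts G)),
    [/\ w = encode_multigraph G, optimal_layout l & y = encode_layout l].

Definition min_tree_length_decision : language := fun w =>
  exists (G : multigraph) (k : nat), w = encode_instance G k /\
    exists l : layout (nverts G), tree_layout l /\ layout_length l <= k.

(* Main.v *)
From mathcomp Require Import all_boot all_algebra.
From mathcomp Require Import zify.
From Stdlib Require Import Classical_Prop.
Require Import Defs.

(** The source problem is a 2-colouring problem, NAE-3SAT in disguise: given
    disjoint triangles and further pairs [E] of vertices, colour the vertices so
    that no triangle is monochromatic and every pair of [E] is bichromatic. Pad
    the vertices to [N = 2 ^ K] many and join a hub to each of them by very many
    parallel edges; by convexity of n log n these force the tree to be perfect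
    when it is rooted at the hub, and then the sum of all distances between the
    [N] vertices is a constant. If all pairs except those of the triangles and of
    [E] are joined by one edge, minimal length thus means that the excepted pairs
    are as far apart as possible. A pair is at the maximal distance [2 * K] iff the
    two subtrees below the root separate it; some pair of each triangle is not
    separated, so the triangles lose at least [2] each, and the loss is no larger
    for some tree iff a colouring exists: the two subtrees are the colour classes,
    and the padding leaves enough room to separate the remaining pair of each
    triangle one level below. The colouring can be read off an optimal layout,
    whence the hardness of the search problem.

    NAE-3SAT is NP-hard by the Cook-Levin tableau. All the functions involved are
    computed by programs for four stacks of bits, which are Turing machine tapes;
    a program acts on the encoding of a value on top of a stack and preserves
    what lies below, so that programs compose. *)

Set Implicit Arguments.
Unset Strict Implicit.
Unset Printing Implicit Defensive.

(** * Stack programs and their compilation to Turing machines *)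

(** Numbers are written in unary and parallel edges one by one, so the number [N] of padded vertices
    and the multiplicity of the hub edges must both be polynomial in the input: [N] is at most
    linear in the number of constrained vertices, and the multiplicity only just exceeds the sum of
    all other terms. Constraints are missing edges, because a missing pair saves the more the
    farther it is apart. All constrained vertices have indices below [N / 4]. Hence each class of
    indices modulo [N / 4], a column, holds at most one of them, and rotating the columns
    independently moves every constrained vertex to a prescribed quarter of the leaves while the
    whole map remains a permutation. Four quarters are enough, since a triangle that carries both
    colours has a single monochromatic pair. In a perfect layout the leaves on the side of vertex
    [0] are those at less than the maximal distance from it, so the colouring is read off distances
    alone and no length has to be evaluated on a solution. *)

Inductive reg := R0 | R1 | R2 | R3.

Record stacks := St { s0 : word; s1 : word; s2 : word; s3 : word }.

Definition get (r : reg) (s : stacks) : word :=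
  match r with R0 => s0 s | R1 => s1 s | R2 => s2 s | R3 => s3 s end.

Definition upd (r : reg) (w : word) (s : stacks) : stacks :=
  let: St a b c d := s in
  match r with
  | R0 => St w b c d | R1 => St a w c d | R2 => St a b w d | R3 => St a b c w
  end.

Definition eqr (r r' : reg) : bool :=
  match r, r' with
  | R0, R0 | R1, R1 | R2, R2 | R3, R3 => true
  | _, _ => false
  end.

Lemma get_upd r r' w s : get r (upd r' w s) = if eqr r r' then w else get r s.
Proof. by case: s => a b c d; case: r; case: r'. Qed.

Inductive prog :=
| Push of reg & bool
| Pop of reg
| Then of prog & prog
| If of reg & pred (option bool) & prog & prog
| While of reg & pred (option bool) & prog.

Definition top (r : reg) (s : stacks) : option bool := ohead (get r s).

(** The costs are those of the compiled code: a push moves left and then writes, a branch spends one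
    step on its test and at most one on a jump, and so does each round of a loop. [exec_weaken]
    makes the last argument an upper bound, so that estimates can be rounded at every stage. *)
Inductive exec : prog -> stacks -> stacks -> nat -> Prop :=
| exec_push r b s : exec (Push r b) s (upd r (b :: get r s) s) 2
| exec_pop r s : exec (Pop r) s (upd r (behead (get r s)) s) 1
| exec_then p q s s' s'' t t' :
    exec p s s' t -> exec q s' s'' t' -> exec (Then p q) s s'' (t + t')
| exec_if_true r (g : pred (option bool)) p q s s' t :
    g (top r s) -> exec p s s' t -> exec (If r g p q) s s' t.+2
| exec_if_false r (g : pred (option bool)) p q s s' t :
    ~~ g (top r s) -> exec q s s' t -> exec (If r g p q) s s' t.+2
| exec_while_stop r (g : pred (option bool)) p s :
    ~~ g (top r s) -> exec (While r g p) s s 1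
| exec_while_loop r (g : pred (option bool)) p s s' s'' t t' :
    g (top r s) -> exec p s s' t -> exec (While r g p) s' s'' t' ->
    exec (While r g p) s s'' (t + t').+2
| exec_weaken p s s' t t' : exec p s s' t -> t <= t' -> exec p s s' t'.

(** A unit of time adds at most one bit to a stack. A bound on the running time thus bounds the size
    of the result as well, on which the composition of polynomial-time programs rests. *)
Lemma exec_size p s s' t : exec p s s' t ->
  forall r, size (get r s') <= size (get r s) + t.
Proof.
elim=> {p s s' t} //=.
- by move=> r b [? ? ? ?] r'; case: r; case: r' => /=; lia.
- by move=> r [? ? ? ?] r'; case: r; case: r' => /=; rewrite ?size_behead; lia.
- by move=> p q s s' s'' t t' _ H1 _ H2 r; move: (H1 r) (H2 r); lia.
- by move=> r g p q s s' t _ _ H r'; move: (H r'); lia.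
- by move=> r g p q s s' t _ _ H r'; move: (H r'); lia.
- by move=> r g p s _ r'; lia.
- by move=> r g p s s' s'' t t' _ _ H1 _ H2 r'; move: (H1 r') (H2 r'); lia.
- by move=> p s s' t t' _ H1 H2 r; move: (H1 r); lia.
Qed.

(** * Machine code and the compilation of programs *)

Record instr := Instr {
  ireg : reg;
  iact : option bool -> option bool * move;
  inext : option bool -> nat
}.

Definition idx (r : reg) : 'I_4 :=
  match r with
  | R0 => inord 0 | R1 => inord 1 | R2 => inord 2 | R3 => inord 3
  end.

Definition reg_of (i : nat) : reg :=
  match i with 0 => R0 | 1 => R1 | 2 => R2 | _ => R3 end.

Lemma idxK r : reg_of (idx r) = r.
Proof. by case: r; rewrite /= inordK. Qed.

Lemma reg_ofK (i : 'I_4) : idx (reg_of i) = i.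
Proof. by apply/val_inj; case: i => -[|[|[|[|]]]] //= _; rewrite inordK. Qed.

Lemma eqrP r r' : reflect (r = r') (eqr r r').
Proof. by case: r; case: r'; constructor. Qed.

Definition bit_of (c : cell void) : option bool :=
  if c is Some (inl b) then Some b else None.

Definition cell_of (o : option bool) : cell void :=
  if o is Some b then Some (inl b) else None.

Lemma bit_ofK : cancel bit_of cell_of. Proof. by case=> [[]|]. Qed.

Definition noop : instr := Instr R0 (fun v => (v, Stay)) (fun _ => 0).

(** States are addresses, and the address just past the code is the final one: a program halts by
    falling off its end. The blank marks the bottom of a stack, so the auxiliary alphabet is
    empty. *)
Definition machine_of (cs : seq instr) : machine :=
  @Machine 3 'I_(size cs).+1 void ord0 (fun q => q == size cs :> nat)
    (fun q a =>
       let I := nth noop cs q in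
       let v := bit_of (a (idx (ireg I))) in
       (inord (inext I v),
        [ffun i : 'I_4 => if eqr (reg_of i) (ireg I)
                   then (cell_of (iact I v).1, (iact I v).2) else (a i, Stay)])).

(** The two runs of blanks have unspecified length: a pop leaves an erased cell to the left of the
    head, and rewriting the scanned cell of an empty stack may append an explicit blank. *)
Definition stack_tape (t : tape void) (w : word) : Prop :=
  exists m n, before t = nseq m None /\
    after t = [seq Some (inl b) | b <- w] ++ nseq n None.

Section Simulation.

Variable cs : seq instr.
Let M := machine_of cs.

Definition at_stacks (pc : nat) (s : stacks) (c : config M) : Prop :=
  c.1 = pc :> nat /\ forall i, stack_tape (c.2 i) (get (reg_of i) s).

Lemma bit_scanned (t : tape void) w :
  stack_tape t w -> bit_of (@scanned M t) = ohead w.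
Proof.
case: t => bf af [m] [n] /= [_]; rewrite /scanned /= => ->.
by case: w => //=; case: n.
Qed.

Lemma stack_tape_stay (t : tape void) w :
  stack_tape t w -> stack_tape (@act M (@scanned M t, Stay) t) w.
Proof.
case: t => bf af [m] [n] /= [-> ->]; exists m.
case: w => [|b w]; last by exists n.
by exists n.-1.+1; case: n.
Qed.

Lemma stack_tape_pop (t : tape void) w :
  stack_tape t w -> stack_tape (@act M (None, Rgt) t) (behead w).
Proof.
case: t => bf af [m] [n] /= [-> ->]; exists m.+1.
case: w => [|b w]; last by exists n.
by exists n.-1; case: n.
Qed.

Lemma stack_tape_push b (t : tape void) w :
  stack_tape t w ->
  stack_tape (@act M (Some (inl b), Stay) (@act M (@scanned M t, Lft) t)) (b :: w).
Proof.
case: t => bf af [m] [n] /= [-> ->]; exists m.-1.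
case: w => [|a w]; last by exists n; case: m.
by exists n.-1.+1; case: m; case: n.
Qed.

Lemma step_machine (c : config M) : c.1 < size cs ->
  let I := nth noop cs c.1 in
  let v := bit_of (@scanned M (c.2 (idx (ireg I)))) in
  (inext I v <= size cs -> (step c).1 = inext I v :> nat) /\
  forall i, (step c).2 i =
    if eqr (reg_of i) (ireg I)
    then @act M (cell_of (iact I v).1, (iact I v).2) (c.2 i)
    else @act M (scanned (c.2 i), Stay) (c.2 i).
Proof.
case: c => q ts /= Hq.
rewrite /step /= ltn_eqF //= ffunE; split.
  by move=> H; rewrite inordK.
by move=> i; rewrite ffunE; case: ifP => //; rewrite ffunE.
Qed.

End Simulation.

Definition goto (l : nat) : instr := Instr R0 (fun v => (v, Stay)) (fun _ => l).

Definition test (r : reg) (g : pred (option bool)) (l1 l2 : nat) : instr :=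
  Instr r (fun v => (v, Stay)) (fun v => if g v then l1 else l2).

Fixpoint compile (p : prog) (pc : nat) : seq instr :=
  match p with
  | Push r b => [:: Instr r (fun v => (v, Lft)) (fun _ => pc.+1);
                    Instr r (fun _ => (Some b, Stay)) (fun _ => pc.+2)]
  | Pop r => [:: Instr r (fun _ => (None, Rgt)) (fun _ => pc.+1)]
  | Then p q => let c := compile p pc in c ++ compile q (pc + size c)
  | If r g p q =>
      let c1 := compile p pc.+1 in
      let l2 := (pc.+1 + size c1).+1 in
      let c2 := compile q l2 in
      test r g pc.+1 l2 :: c1 ++ goto (l2 + size c2) :: c2
  | While r g p =>
      let c1 := compile p pc.+1 in
      test r g pc.+1 (pc.+1 + size c1).+1 :: rcons c1 (goto pc)
  end.

Lemma step_stay cs (pc l : nat) s (c : config (machine_of cs)) r next :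
  pc < size cs -> nth noop cs pc = Instr r (fun v => (v, Stay)) next ->
  next (top r s) = l -> l <= size cs ->
  at_stacks pc s c -> at_stacks l s (step c).
Proof.
move=> Hpc HI Hl Hsz [H1 H2]; have := @step_machine cs c; rewrite H1 HI /=.
have Hr := bit_scanned cs (H2 (idx r)).
rewrite Hr idxK -/(top r s) Hl => /(_ Hpc) [/(_ Hsz) e1 e2].
split=> // i; rewrite e2.
case: eqrP => [ei|_]; last exact/stack_tape_stay.
have -> : i = idx r by rewrite -ei reg_ofK.
rewrite /top -[r in get r s]idxK -Hr bit_ofK.
by apply/stack_tape_stay.
Qed.

Lemma step_pop cs (pc : nat) s (c : config (machine_of cs)) r :
  pc < size cs ->
  nth noop cs pc = Instr r (fun _ => (None, Rgt)) (fun _ => pc.+1) ->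
  at_stacks pc s c -> at_stacks pc.+1 (upd r (behead (get r s)) s) (step c).
Proof.
move=> Hpc HI [H1 H2]; have := @step_machine cs c; rewrite H1 HI /=.
move=> /(_ Hpc) [/(_ Hpc) e1 e2]; split=> // i; rewrite e2 get_upd.
case: eqrP => [<-|_]; last exact/stack_tape_stay.
exact/stack_tape_pop.
Qed.

Lemma step_push cs (pc : nat) s (c : config (machine_of cs)) r b :
  pc.+1 < size cs ->
  nth noop cs pc = Instr r (fun v => (v, Lft)) (fun _ => pc.+1) ->
  nth noop cs pc.+1 = Instr r (fun _ => (Some b, Stay)) (fun _ => pc.+2) ->
  at_stacks pc s c -> at_stacks pc.+2 (upd r (b :: get r s) s) (step (step c)).
Proof.
move=> Hpc HI HI' [H1 H2]; have Hpc' := ltnW Hpc.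
have := @step_machine cs c; rewrite H1 HI /=.
move=> /(_ Hpc') [/(_ Hpc') e1 e2].
have := @step_machine cs (step c); rewrite e1 HI' /=.
move=> /(_ Hpc) [/(_ Hpc) e3 e4]; split=> // i; rewrite e4 e2 get_upd.
case: eqrP => [ei|_]; last by do 2 apply/stack_tape_stay.
have -> : i = idx r by rewrite -ei reg_ofK.
rewrite bit_ofK -[r in get r s]idxK; exact/stack_tape_push.
Qed.

(** The induction is on the execution, as a loop unfolds to itself over the same code. The context
    [pre], [post] is arbitrary: a subprogram is a segment of the same code behind a longer prefix,
    so that all induction hypotheses speak of one machine. *)
Lemma compile_correct p s s' t : exec p s s' t ->
  forall cs pre post, cs = pre ++ compile p (size pre) ++ post ->
  forall c : config (machine_of cs), at_stacks (size pre) s c ->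
  exists2 t0, t0 <= t &
    at_stacks (size pre + size (compile p (size pre))) s'
      (iter t0 (@step (machine_of cs)) c).
Proof.
have nthD pre l k : nth noop (pre ++ l) (size pre + k) = nth noop l k.
  by rewrite nth_cat ltnNge leq_addr addKn.
have nthE pre I post : nth noop (pre ++ I :: post) (size pre) = I.
  by rewrite -[size pre]addn0 nthD.
elim=> {p s s' t}.
- move=> r b s cs pre post -> c Hc; exists 2 => //=.
  rewrite addn2; apply: step_push Hc => //.
  + by rewrite !size_cat /=; lia.
  + by rewrite nthE.
  + by rewrite -[(size pre).+1]addn1 nthD /= addn1.
- move=> r s cs pre post -> c Hc; exists 1 => //=.
  rewrite addn1; apply: step_pop Hc; last by rewrite nthE.
  by rewrite !size_cat /=; lia.
- move=> p q s s' s'' t t' _ IH1 _ IH2 cs pre post /= e c Hc.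
  rewrite -catA in e.
  have [t1 Ht1 Hc1] := IH1 _ _ _ e _ Hc.
  have := IH2 cs (pre ++ compile p (size pre)) post.
  rewrite !size_cat -!catA => /(_ e _ Hc1) [t2 Ht2 Hc2].
  exists (t2 + t1); first by lia.
  by rewrite iterD addnA.
- move=> r g p q s s' t Hg _ IH cs pre post /= e c Hc.
  set c1 := compile p _ in e *; set c2 := compile q _ in e *.
  have e' : cs = rcons pre (test r g (size pre).+1 (size pre + size c1).+2) ++
     compile p (size (rcons pre (test r g (size pre).+1 (size pre + size c1).+2))) ++ 
     goto (size pre + size c1 + size c2).+2 :: (c2 ++ post).
    by rewrite size_rcons e cat_rcons /= -!catA /= !addSn.
  have Hc0 : at_stacks (size pre).+1 s (step c).
    apply: step_stay Hc; [| by rewrite e nthE| by rewrite /= Hg|];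
      by rewrite e !size_cat /= !size_cat /=; lia.
  have [|t1 Ht1 Hc1] := IH _ _ _ e' (step c); first by rewrite size_rcons.
  exists t1.+2; first by lia.
  rewrite iterS iterSr; move: Hc1; rewrite size_rcons => Hc1.
  apply: (step_stay (pc := (size pre).+1 + size c1)) Hc1.
  + by rewrite e !size_cat /= !size_cat /=; lia.
  + by rewrite e addSnnS nthD /= -catA nthE.
  + by rewrite /= size_cat /=; lia.
  + by rewrite e !size_cat /= !size_cat /=; lia.
- move=> r g p q s s' t Hg _ IH cs pre post /= e c Hc.
  set c1 := compile p _ in e *; set c2 := compile q _ in e *.
  pose pre' := pre ++ test r g (size pre).+1 (size pre + size c1).+2 :: c1 ++
      [:: goto (size pre + size c1 + size c2).+2].
  have sz : size pre' = ((size pre).+1 + size c1).+1.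
    by rewrite !size_cat /= size_cat /=; lia.
  have e' : cs = pre' ++ compile q (size pre') ++ post.
    by rewrite sz e /pre' -!catA /= -!catA /= !addSn.
  have Hc0 : at_stacks (size pre') s (step c).
    apply: step_stay Hc; [| by rewrite e nthE| by rewrite /= (negbTE Hg) sz|];
      by rewrite ?sz e !size_cat /= !size_cat /=; lia.
  have [t1 Ht1 Hc1] := IH _ _ _ e' (step c) Hc0.
  exists t1.+1; first by lia.
  rewrite iterSr; move: Hc1; rewrite sz -/c2; congr at_stacks.
  by rewrite /= size_cat /=; lia.
- move=> r g p s Hg cs pre post /= e c Hc.
  set c1 := compile p _ in e *.
  exists 1 => //; apply: step_stay Hc; first 1 last.
  + by rewrite e nthE.
  + by rewrite /= (negbTE Hg) size_rcons; lia.
  + by rewrite e !size_cat /= size_cat !size_rcons /=; lia.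
  + by rewrite e !size_cat /=; lia.
- move=> r g p s s' s'' t t' Hg _ IH1 _ IH2 cs pre post /= e c Hc.
  set c1 := compile p _ in e *.
  pose I := test r g (size pre).+1 (size pre + size c1).+2.
  have e' : cs = rcons pre I ++ compile p (size (rcons pre I)) ++ goto (size pre) :: post.
    by rewrite size_rcons e cat_rcons /= cat_rcons !addSn.
  have Hc0 : at_stacks (size pre).+1 s (step c).
    apply: step_stay Hc; [| by rewrite e nthE| by rewrite /= Hg|];
      by rewrite e !size_cat /= ?size_cat ?size_rcons /=; lia.
  have [|t1 Ht1 Hc1] := IH1 _ _ _ e' (step c); first by rewrite size_rcons.
  move: Hc1; rewrite size_rcons -/c1 => Hc1.
  have Hc2 : at_stacks (size pre) s' (step (iter t1 (@step _) (step c))).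
    apply: step_stay Hc1 => //.
    + by rewrite e !size_cat /= ?size_cat ?size_rcons /=; lia.
    + by rewrite e addSnnS nthD /= cat_rcons nthE.
    + by [].
    + by rewrite e !size_cat; lia.
  have [t2 Ht2 Hc3] := IH2 _ _ _ e _ Hc2.
  exists (t2 + t1.+2); first by lia.
  by rewrite iterD iterS iterSr.
- move=> p s s' t t' _ IH Ht cs pre post e c Hc.
  have [t0 H0 H] := IH _ _ _ e c Hc; exists t0 => //.
  exact: leq_trans Ht.
Qed.

Lemma iter_step_final (M : machine) (c : config M) t :
  final c.1 -> iter t (@step M) c = c.
Proof. by move=> H; elim: t => //= t ->; case: c H => q ts /= ->. Qed.

Lemma exec_polytime (P : prog) (f : word -> word) (p : {poly nat}) :
  (forall x, exists s, [/\ exec P (St x [::] [::] [::]) s (horner p (size x))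
     & s0 s = f x]) ->
  polytime f.
Proof.
move=> H; pose cs := compile P 0.
exists (machine_of cs), p => x c.
have [s [Hs <-]] := H x.
have [|t0 Ht0 [Hf1 Hf2]] := compile_correct (pre := [::]) Hs (esym (cats0 cs))
   (c := init (machine_of cs) x).
  split=> //= i; rewrite -(inj_eq val_inj).
  case: i => -[|i] Hi /=; exists 0, 0; rewrite ?cats0 //.
  by case: i {Hi} => [|[|]].
have fin : final (iter t0 (@step _) (init (machine_of cs) x)).1 by apply/eqP.
(* Final configurations are fixed points, so running on up to the polynomial bound changes
   nothing. *)
have -> : c = iter t0 (@step _) (init (machine_of cs) x).
  by rewrite /c -(subnK Ht0) iterD iter_step_final.
split=> //; rewrite /output.
have [m [n [_ ->]]] := Hf2 ord0; rewrite /=.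
elim: (s0 s) => [|b w IH] /=; first by case: n.
by congr cons.
Qed.

(** * Self-delimiting codes of binary trees and their handling on stacks *)

Inductive tree := Nil | Cons of tree & tree.

Fixpoint code (d : tree) : word :=
  match d with
  | Nil => [:: false]
  | Cons a b => true :: code a ++ code b
  end.

Lemma code_gt0 d : 0 < size (code d). Proof. by case: d. Qed.

Definition is_one : pred (option bool) := fun o => o == Some true.

Definition skip : prog := While R0 xpred0 (Pop R0).

Lemma exec_skip s : exec skip s s 1.
Proof. exact: exec_while_stop. Qed.

Ltac run1 := first
  [ exact: exec_skip | exact: exec_push | exact: exec_pop
  | apply: exec_then
  | apply: exec_if_true; [reflexivity|]
  | apply: exec_if_false; [reflexivity|] ].

Ltac run := repeat run1.

Lemma exec_eq p s s1 s' t : exec p s1 s' t -> s = s1 -> exec p s s' t.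
Proof. by move=> H ->. Qed.

Lemma exec_eq_res p s s1 s' t : exec p s s1 t -> s1 = s' -> exec p s s' t.
Proof. by move=> H <-. Qed.

(** In a work register a word is stored as by [pair_word], so that its end can
    be recognised whatever lies below it. *)
Definition drain (r : reg) (k : bool -> prog) : prog :=
  Then (While r is_one
    (Then (Pop r) (If r is_one (Then (Pop r) (k true)) (Then (Pop r) (k false)))))
  (Pop r).

(** In the state [S a w] the bits [a], latest first, have been handled and [w] is left. The constant
    [6] is the overhead per bit: two pops, and a test and a jump for the loop and for the
    conditional each. *)
Lemma exec_drain r k u c (S : word -> word -> stacks) :
  (forall a w, get r (S a w) = pair_word w u) ->
  (forall b a w, exec (k b) (upd r (pair_word w u) (S a (b :: w))) (S (b :: a) w) c) ->
  forall w, exec (drain r k) (S [::] w) (upd r u (S (rev w) [::]))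
              ((c + 6) * size w + 2).
Proof.
move=> Hr Hk w; have -> : rev w = rev w ++ [::] by rewrite cats0.
have updK v v' s : upd r v (upd r v' s) = upd r v s by case: r {Hr Hk}; case: s.
apply: (@exec_weaken _ _ _ ((c + 6) * size w + 1 + 1)); last by lia.
apply: exec_then; last first.
  have -> : upd r u (S (rev w ++ [::]) [::]) =
    upd r (behead (get r (S (rev w ++ [::]) [::]))) (S (rev w ++ [::]) [::]) by rewrite Hr.
  exact: exec_pop.
suff loop a : exec (While r is_one (Then (Pop r) (If r is_one (Then (Pop r) (k true)) (Then
    (Pop r) (k false)))))
    (S a w) (S (rev w ++ a) [::]) ((c + 6) * size w + 1) by exact: loop.
elim: w a => [|b w IH] a /=.
  by rewrite muln0; apply: exec_while_stop; rewrite /top Hr.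
apply: exec_weaken.
  apply: (exec_while_loop (t := 1 + (1 + c).+2)); first by rewrite /top Hr.
    apply: exec_then; first exact: exec_pop.
    rewrite Hr /=; case: b.
      apply: exec_if_true; first by rewrite /top get_upd; case: r {Hr Hk updK IH}.
      apply: exec_then; first exact: exec_pop.
      rewrite updK get_upd; have -> : eqr r r by case: (r).
      exact: Hk.
    apply: exec_if_false; first by rewrite /top get_upd; case: r {Hr Hk updK IH}.
    apply: exec_then; first exact: exec_pop.
    rewrite updK get_upd; have -> : eqr r r by case: (r).
    exact: Hk.
  rewrite rev_cons cat_rcons; exact: IH.
by lia.
Qed.

(** [R3] counts in unary, above a [false], the trees still to be read: a bit [true] replaces a
    pending tree by two, a bit [false] completes one. The code arrives in reverse order. *)
Definition grab (r : reg) : prog :=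
  Then (Push r false) (Then (Push R3 false) (Then (Push R3 true) (Then
   (While R3 is_one (Then (Pop R3) (If R0 is_one
      (Then (Pop R0) (Then (Push r true) (Then (Push r true)
        (Then (Push R3 true) (Push R3 true)))))
      (Then (Pop R0) (Then (Push r false) (Push r true))))))
   (Pop R3)))).

(** [work q] is [R1] or [R2]; in [on q a u v z] it holds [u], the other one [v]. *)
Definition work (q : bool) : reg := if q then R1 else R2.
Definition on (q : bool) (a u v z : word) : stacks :=
  if q then St a u v z else St a v u z.

Lemma exec_grab q d a u v z :
  exec (grab (work q)) (on q (code d ++ a) u v z)
    (on q a (pair_word (rev (code d)) u) v z) (15 * size (code d) + 10).
Proof.
rewrite -[rev _]/(catrev (code d) [::]).
rewrite /grab; set W := While _ _ _.
(* The rest of the loop is an arbitrary continuation ending in [s'], so that the runs over the two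
   subtrees can be chained. *)
have loop e : forall a w z s' t,
    exec W (on q a (pair_word (catrev (code e) w) u) v z) s' t ->
    exec W (on q (code e ++ a) (pair_word w u) v (true :: z)) s' (15 * size (code e) + t).
  elim: e => [|x IHx y IHy] a' w z' s' t H /=.
    apply: exec_weaken.
      apply: (@exec_while_loop _ _ _ _ (on q a' (pair_word (false :: w) u) v z')) (H).
        by case: (q).
      by case: (q); run.
    by lia.
  rewrite /= catrev_catl in H.
  have {}H := IHx (code y ++ a') (true :: w) (true :: z') _ _ (IHy _ _ _ _ _ H).
  apply: exec_weaken.
    rewrite -catA; apply: exec_while_loop (H); first by case: (q).
    by case: (q); run.
  by rewrite size_cat; lia.
have {}loop : exec W (on q (code d ++ a) (pair_word [::] u) v (true :: false :: z))
    (on q a (pair_word (catrev (code d) [::]) u) v (false :: z)) (15 * size (code d) + 1).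
  by apply/loop/exec_while_stop; case: (q).
apply: exec_weaken.
  apply: exec_then; first exact: exec_push.
  apply: exec_then; first exact: exec_push.
  apply: exec_then; first exact: exec_push.
  apply: exec_then.
    apply: exec_eq loop _; by case: (q).
  by apply: exec_eq_res; [exact: exec_pop | case: (q)].
by lia.
Qed.

Lemma exec_drain_work q k u v z c (S : word -> word -> word) (V : word -> word) :
  (forall b a w, exec (k b) (on q (S a (b :: w)) (pair_word w u) (V a) z)
     (on q (S (b :: a) w) (pair_word w u) (V (b :: a)) z) c) ->
  V [::] = v ->
  forall w, exec (drain (work q) k) (on q (S [::] w) (pair_word w u) v z)
     (on q (S (rev w) [::]) u (V (rev w)) z) ((c + 6) * size w + 2).
Proof.
move=> H <- w.
pose T a w' := on q (S a w') (pair_word w' u) (V a) z.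
have H1 a w' : get (work q) (T a w') = pair_word w' u by rewrite /T; case: (q).
have H2 b a w' : exec (k b) (upd (work q) (pair_word w' u) (T a (b :: w'))) (T (b :: a) w') c.
  by move: (H b a w'); rewrite /T; case: (q).
by apply: exec_eq_res (exec_drain H1 H2 w) _; rewrite /T; case: (q).
Qed.

Definition release (q : bool) : prog := drain (work q) (Push R0).

Lemma exec_release q a u v z w :
  exec (release q) (on q a (pair_word w u) v z) (on q (rev w ++ a) u v z)
    (8 * size w + 2).
Proof.
apply: (@exec_drain_work q (Push R0) u v z 2 (fun a' _ => a' ++ a) (fun _ => v)) => //.
by move=> b a' w'; case: q; run.
Qed.

Definition drop_tree : prog := Then (grab R1) (drain R1 (fun _ => skip)).

Lemma exec_drop d a u v z :
  exec drop_tree (St (code d ++ a) u v z) (St a u v z) (25 * size (code d) + 12).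
Proof.
apply: exec_weaken.
  apply: exec_then; first exact: (exec_grab true).
  apply: (@exec_drain_work true _ u v z 1 (fun _ _ => a) (fun _ => v)) => //.
  by move=> *; run.
by rewrite size_rev; lia.
Qed.

Definition swap_trees : prog :=
  Then (grab R1) (Then (grab R2) (Then (release true) (release false))).

Lemma exec_swap d e a u v z :
  exec swap_trees (St (code d ++ code e ++ a) u v z) (St (code e ++ code d ++ a) u v z)
    (23 * (size (code d) + size (code e)) + 24).
Proof.
apply: exec_weaken.
  apply: exec_then; first exact: (exec_grab true).
  apply: exec_then; first exact: (exec_grab false).
  apply: exec_then; first exact: (exec_release true).
  rewrite revK; apply: exec_eq_res; first exact: (exec_release false).
  by rewrite /= revK.
by rewrite !size_rev; lia.
Qed.

(** Every transfer reverses the code. Draining [R1] restores one copy on [R0]; the other copy has to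
    travel from [R2] through [R1] in order to come out in the right order. *)
Definition dup_tree : prog :=
  Then (grab R1) (Then (Push R2 false)
    (Then (drain R1 (fun b => Then (Push R0 b) (Then (Push R2 b) (Push R2 true))))
    (Then (Push R1 false)
    (Then (drain R2 (fun b => Then (Push R1 b) (Push R1 true))) (release true))))).

Lemma exec_dup d a u v z :
  exec dup_tree (St (code d ++ a) u v z) (St (code d ++ code d ++ a) u v z)
    (50 * size (code d) + 20).
Proof.
apply: exec_weaken.
  apply: exec_then; first exact: (exec_grab true).
  apply: exec_then; first exact: exec_push.
  apply: exec_then.
    apply: (@exec_drain_work true _ u _ z (2 + (2 + 2)) (fun b _ => b ++ a) (fun b =>
        pair_word b v)) => //.
    by move=> *; run.
  apply: exec_then; first exact: exec_push.
  apply: exec_then.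
    apply: (@exec_drain_work false _ v _ z (2 + 2) (fun b _ => rev (rev (code d)) ++ a)
        (fun b => pair_word b u)) => //.
    by move=> *; run.
  rewrite !revK /=; apply: exec_eq_res; first exact: (exec_release true).
  by rewrite revK.
by rewrite ?size_rev; lia.
Qed.

Fixpoint push_word (w : word) : prog :=
  if w is b :: w' then Then (push_word w') (Push R0 b) else skip.

Lemma exec_push_word w a u v z :
  exec (push_word w) (St a u v z) (St (w ++ a) u v z) (2 * size w + 1).
Proof.
elim: w => [|b w IH] /=; first by run.
by apply: exec_weaken; [apply: exec_then; [exact: IH | run] | lia].
Qed.

Lemma horner_nat_mono (p : {poly nat}) m n :
  m <= n -> horner p m <= horner p n.
Proof.
move=> le_mn; rewrite !horner_coef; apply: leq_sum => i _.
rewrite leq_mul // -!/(expn _ _); elim: (i : nat) => [|j IH] //.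
by rewrite !GRing.exprS leq_mul.
Qed.

Definition poly_bounded {E : Type} (sz b : E -> nat) : Prop :=
  exists p : {poly nat}, forall e, b e <= horner p (sz e).

(** * Polynomial-time operations on trees *)

(* [hornerD] and [hornerC] with the operations of [nat] displayed as such. *)
Lemma hornerD_nat (p q : {poly nat}) (n : nat) :
  horner (p + q)%R n = horner p n + horner q n.
Proof. exact: hornerD. Qed.

Lemma hornerC_nat (c n : nat) : horner (polyC c) n = c.
Proof. exact: hornerC. Qed.

Section PolyBounded.

Variables (E : Type) (sz : E -> nat).
Local Notation bounded := (poly_bounded sz).

Lemma bounded_le b b' : (forall e, b e <= b' e) -> bounded b' -> bounded b.
Proof. by move=> H [p Hp]; exists p => e; apply: leq_trans (H e) (Hp e). Qed.

Lemma bounded_const c : bounded (fun _ => c).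
Proof. by exists (polyC c) => e; rewrite hornerC. Qed.

Lemma bounded_size : bounded sz.
Proof. by exists 'X%R => e; rewrite hornerX. Qed.

Lemma bounded_add b b' : bounded b -> bounded b' -> bounded (fun e => b e + b' e).
Proof. by move=> [p Hp] [q Hq]; exists (p + q)%R => e; rewrite hornerD leq_add. Qed.

Lemma bounded_mul b b' : bounded b -> bounded b' -> bounded (fun e => b e * b' e).
Proof. by move=> [p Hp] [q Hq]; exists (p * q)%R => e; rewrite hornerM leq_mul. Qed.

Lemma bounded_horner (p : {poly nat}) b : bounded b -> bounded (fun e => horner p (b e)).
Proof.
move=> [q Hq]; exists (p \Po q)%R => e.
by rewrite horner_comp horner_nat_mono.
Qed.

End PolyBounded.

Definition tsize (d : tree) : nat := size (code d).

(** The program [P] turns the tree [i x] on top of [R0] into [o x], for [x] in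
    [D]; what lies below it, on every register, is left unchanged, which makes
    programs composable. *)
Definition tree_prog {X : Type} (D : X -> Prop) (i o : X -> tree) : Prop :=
  exists P (p : {poly nat}), forall x, D x -> forall a u v z,
    exec P (St (code (i x) ++ a) u v z) (St (code (o x) ++ a) u v z)
      (horner p (tsize (i x))).

Ltac bnd := repeat first
  [ apply: bounded_const | apply: bounded_size | apply: bounded_add
  | apply: bounded_mul | apply: bounded_horner ].

Section TreePrograms.

Variables (X : Type) (D : X -> Prop).
Implicit Types i o : X -> tree.

Lemma tree_prog_size i o : tree_prog D i o ->
  exists p : {poly nat}, forall x, D x -> tsize (o x) <= horner p (tsize (i x)).
Proof.
move=> [P [p H]]; exists ('X + p)%R => x Dx; rewrite hornerD hornerX.
by have := exec_size (H x Dx [::] [::] [::] [::]) R0; rewrite /= !cats0.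
Qed.

Lemma tree_progI i o P (T : nat -> nat) :
  poly_bounded id T ->
  (forall x, D x -> forall a u v z,
     exec P (St (code (i x) ++ a) u v z) (St (code (o x) ++ a) u v z) (T (tsize (i x)))) ->
  tree_prog D i o.
Proof.
move=> [p Hp] H; exists P, p => x Dx a u v z.
exact: exec_weaken (H x Dx a u v z) (Hp _).
Qed.

Lemma tree_prog_id i : tree_prog D i i.
Proof. by exists skip, (polyC 1) => x _ a u v z; rewrite hornerC; exact: exec_skip. Qed.

Lemma tree_prog_comp i m o :
  tree_prog D i m -> tree_prog D m o -> tree_prog D i o.
Proof.
move=> HG [P [p HP]]; have [b Hb] := tree_prog_size HG; have [Q [q HQ]] := HG.
apply: (@tree_progI _ _ (Then Q P) (fun n => horner q n + horner p (horner b n))).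
  by bnd.
move=> x Dx a u v z; apply: exec_then; first exact: HQ.
by apply: exec_weaken (HP _ Dx _ _ _ _) (horner_nat_mono _ (Hb _ Dx)).
Qed.

Lemma tree_prog_const i d0 : tree_prog D i (fun _ => d0).
Proof.
apply: (@tree_progI _ _ (Then drop_tree (push_word (code d0)))
  (fun n => (25 * n + 12) + (2 * size (code d0) + 1))).
  by bnd.
by move=> *; apply: exec_then; [exact: exec_drop | exact: exec_push_word].
Qed.

(** The input is duplicated, [g] is computed on one copy, the other copy is swapped to the top and
    [f] is computed there. The two results then lie side by side, and one more bit makes them the
    code of a pair. *)
Lemma tree_prog_cons i f g : tree_prog D i f -> tree_prog D i g ->
  tree_prog D i (fun x => Cons (f x) (g x)).
Proof.
move=> [P [p HP]] HG; have [b Hb] := tree_prog_size HG; have [Q [q HQ]] := HG.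
apply: (@tree_progI _ _ (Then dup_tree (Then Q (Then swap_trees (Then P (Push R0 true)))))
  (fun n => (50 * n + 20) + (horner q n +
     ((23 * (horner b n + n) + 24) + (horner p n + 2))))).
  by bnd.
move=> x Dx a u v z; apply: exec_then; first exact: exec_dup.
apply: exec_then; first exact: HQ.
apply: exec_then.
  by apply: exec_weaken (exec_swap _ _ _ _ _ _) _; have := Hb x Dx; rewrite /tsize; lia.
apply: exec_then; first exact: HP.
by rewrite /= -catA; exact: exec_push.
Qed.

Definition car d := if d is Cons a _ then a else Nil.
Definition cdr d := if d is Cons _ b then b else Nil.

Lemma tree_prog_car i : tree_prog D i (fun x => car (i x)).
Proof.
apply: (@tree_progI _ _ (If R0 is_one (Then (Pop R0) (Then swap_trees drop_tree)) skip)
  (fun n => 50 * n + 50)); first by bnd.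
move=> e _; case: (i e) => [|x y] a u v z; first by apply: exec_weaken; [run | ].
rewrite /tsize /= -catA; apply: exec_weaken.
  apply: exec_if_true => //; apply: exec_then; first exact: exec_pop.
  apply: exec_then; first exact: exec_swap.
  exact: exec_drop.
by rewrite size_cat; lia.
Qed.

Lemma tree_prog_cdr i : tree_prog D i (fun x => cdr (i x)).
Proof.
apply: (@tree_progI _ _ (If R0 is_one (Then (Pop R0) drop_tree) skip)
  (fun n => 50 * n + 50)); first by bnd.
move=> e _; case: (i e) => [|x y] a u v z; first by apply: exec_weaken; [run | ].
rewrite /tsize /= -catA; apply: exec_weaken.
  apply: exec_if_true => //; apply: exec_then; first exact: exec_pop.
  exact: exec_drop.
by rewrite size_cat; lia.
Qed.

End TreePrograms.

Lemma tree_prog_reindex X Y (D : X -> Prop) (D' : Y -> Prop) i o i' o' :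
  tree_prog D i o ->
  (forall y, D' y -> exists x, [/\ D x, i' y = i x & o' y = o x]) ->
  tree_prog D' i' o'.
Proof.
move=> [P [p H]] Hh; exists P, p => y Dy a u v z.
by have [x [Dx -> ->]] := Hh y Dy; exact: H.
Qed.

Definition is_cons d := if d is Cons _ _ then true else false.

Lemma tree_prog_if X (D : X -> Prop) i c o :
  tree_prog D i c ->
  tree_prog (fun x => D x /\ is_cons (c x)) i o ->
  tree_prog (fun x => D x /\ ~~ is_cons (c x)) i o ->
  tree_prog D i o.
Proof.
move=> HC [P [p HP]] [Q [q HQ]].
have [b Hb] := tree_prog_size HC; have [R [r HR]] := HC.
apply: (@tree_progI _ _ _ _ (Then dup_tree (Then R
    (If R0 is_one (Then drop_tree P) (Then drop_tree Q))))
  (fun n => (50 * n + 20) + (horner r n +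
     ((25 * horner b n + 12) + (horner p n + horner q n) + 2)))).
  by bnd.
move=> x Dx a u v z; apply: exec_then; first exact: exec_dup.
apply: exec_then; first exact: HR.
have := exec_drop (c x) (code (i x) ++ a) u v z; have := Hb x Dx; rewrite /tsize.
move: (HP x) (HQ x).
case: (c x) => [|d e] {}HP {}HQ le_b H.
  apply: exec_weaken; first apply: exec_if_false => //.
    apply: exec_then; first exact: H.
    exact: HQ.
  by rewrite /= /tsize in le_b *; lia.
apply: exec_weaken; first apply: exec_if_true => //.
  apply: exec_then; first exact: H.
  exact: HP.
by rewrite /tsize; lia.
Qed.

(** This is both the value of an encoded number and the length of an encoded list, so a single loop
    construct serves for both. *)
Fixpoint spine (d : tree) : nat := if d is Cons _ b then (spine b).+1 else 0.

Definition push_spine : prog :=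
  Then (Push R3 false) (Then (While R0 is_one
    (Then (Pop R0) (Then drop_tree (Push R3 true)))) (Pop R0)).

Lemma spine_le d : spine d <= tsize d.
Proof.
rewrite /tsize; elim: d => //= a _ b IH; rewrite size_cat.
by have := leq_addl (size (code a)) (size (code b)); lia.
Qed.

Lemma exec_push_spine d a u v z :
  exec push_spine (St (code d ++ a) u v z)
    (St a u v (nseq (spine d) true ++ false :: z)) (30 * tsize d + 10).
Proof.
rewrite /push_spine; set W := While _ _ _.
have loop e w : exec W (St (code e ++ a) u v w)
   (St (false :: a) u v (nseq (spine e) true ++ w)) (30 * tsize e).
  rewrite /tsize; elim: e w => [|x _ y IH] w /=.
    by apply: exec_weaken; [apply: exec_while_stop | ].
  rewrite -catA; have -> : true :: nseq (spine y) true ++ w = nseq (spine y) true ++ true :: w.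
    by elim: (spine y) => //= n ->.
  apply: exec_weaken.
    apply: exec_while_loop (IH _) => //.
    apply: exec_then; first exact: exec_pop.
    apply: exec_then; first exact: exec_drop.
    exact: exec_push.
  by rewrite size_cat /=; lia.
apply: exec_weaken.
  apply: exec_then; first exact: exec_push.
  apply: exec_then; first exact: loop.
  exact: exec_pop.
by lia.
Qed.

(** Iterating a polynomial-time step may produce values of exponential size, hence the bound [b] on
    all intermediate states. The counter waits on [R3]; it survives the step because programs
    preserve what lies below their data. *)
Lemma tree_prog_iter X (D : X -> Prop) i (n : X -> tree) (st : X -> nat -> tree)
    (b : {poly nat}) :
  tree_prog D i n -> tree_prog D i (fun x => st x 0) ->
  tree_prog (fun p => D p.1 /\ p.2 < spine (n p.1))
    (fun p => st p.1 p.2) (fun p => st p.1 p.2.+1) ->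
  (forall x j, D x -> j <= spine (n x) -> tsize (st x j) <= horner b (tsize (i x))) ->
  tree_prog D i (fun x => st x (spine (n x))).
Proof.
move=> HN [P [p HP]] [Q [q HQ]] Hs.
have [bn Hn] := tree_prog_size HN; have [R [r HR]] := HN.
apply: (@tree_progI _ _ _ _ (Then dup_tree (Then R (Then push_spine (Then P
   (Then (While R3 is_one (Then (Pop R3) Q)) (Pop R3))))))
  (fun m => (50 * m + 20) + (horner r m +
    ((30 * horner bn m + 10) + (horner p m +
    ((horner bn m * (horner q (horner b m) + 3) + 1) + 1)))))).
  by bnd.
move=> x Dx a u v z; apply: exec_then; first exact: exec_dup.
apply: exec_then; first exact: HR.
apply: exec_then.
  by apply: exec_weaken; [exact: exec_push_spine | have := Hn x Dx; lia].
apply: exec_then; first exact: HP.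
set m := tsize (i x); set N := spine (n x).
apply: (exec_then (s' := St (code (st x N) ++ a) u v (false :: z)));
  last exact: exec_pop.
apply: (@exec_weaken _ _ _ (N * (horner q (horner b m) + 3) + 1)); last first.
  by rewrite leq_add2r leq_mul2r (leq_trans (spine_le _) (Hn _ Dx)) orbT.
suff loop k j : j + k = N ->
    exec (While R3 is_one (Then (Pop R3) Q))
     (St (code (st x j) ++ a) u v (nseq k true ++ false :: z))
     (St (code (st x N) ++ a) u v (false :: z)) (k * (horner q (horner b m) + 3) + 1).
  exact: loop.
elim: k j => [|k IH] j; first by rewrite addn0 => ->; exact: exec_while_stop.
move=> ejk; have lt_jN : j < N by lia.
apply: exec_weaken.
  apply: exec_while_loop => //; last by apply: (IH j.+1); lia.
  apply: exec_then; first exact: exec_pop.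
  apply: exec_weaken; first exact: (HQ (x, j)).
  by apply: horner_nat_mono; apply: Hs (ltnW lt_jN).
by rewrite mulSn -/m; lia.
Qed.

(** * Polynomial-time functions on data types *)

Class data (T : Type) := enc : T -> tree.

(** Unary, like the encoding of instances: polynomial in the size means polynomial in the value. *)
#[export] Instance data_nat : data nat := fun n => iter n (Cons Nil) Nil.
#[export] Instance data_bool : data bool := fun b => if b then Cons Nil Nil else Nil.
#[export] Instance data_seq T `{data T} : data (seq T) :=
  foldr (fun x => Cons (enc x)) Nil.
#[export] Instance data_prod A B `{data A} `{data B} : data (A * B) :=
  fun p => Cons (enc p.1) (enc p.2).

Definition sz {T} `{data T} (x : T) : nat := tsize (enc x).

Lemma sz_gt0 T `{data T} (x : T) : 0 < sz x.
Proof. exact: code_gt0. Qed.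

Lemma sz_pair A B `{data A} `{data B} (p : A * B) : sz p = (sz p.1 + sz p.2).+1.
Proof. by rewrite /sz /tsize /= size_cat. Qed.

Lemma sz_cons A `{data A} (x : A) s : sz (x :: s) = (sz x + sz s).+1.
Proof. by rewrite /sz /tsize /= size_cat. Qed.

Lemma sz_nil A `{data A} : sz (@nil A) = 1.
Proof. by []. Qed.

Lemma sz_nat (n : nat) : sz n = n.*2.+1.
Proof. by rewrite /sz /tsize; elim: n => //= n ->. Qed.

Lemma sz_bool (b : bool) : sz b <= 3.
Proof. by case: b. Qed.

Lemma sz_cat A `{data A} (s t : seq A) : (sz (s ++ t)).+1 = sz s + sz t.
Proof. by elim: s => [|x s IH]; rewrite ?sz_nil //= !sz_cons; lia. Qed.

Lemma size_le_sz A `{data A} (s : seq A) : (size s) < sz s.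
Proof. by elim: s => [|x s IH] //=; rewrite sz_cons; lia. Qed.

Definition pt {A B} `{data A} `{data B} (f : A -> B) : Prop :=
  tree_prog (fun _ => True) enc (fun a => enc (f a)).

Notation bounded := (poly_bounded sz).

Section Basic.

Context {E : Type} `{data E}.

Lemma tree_prog_ext X (D : X -> Prop) i o o' :
  (forall x, D x -> o x = o' x) -> tree_prog D i o -> tree_prog D i o'.
Proof.
move=> e [P [p HP]]; exists P, p => x Dx a u v z.
by rewrite -(e x Dx); exact: HP.
Qed.

Lemma pt_ext {B} `{data B} (f g : E -> B) : f =1 g -> pt f -> pt g.
Proof. by move=> e; apply: tree_prog_ext => x _; rewrite e. Qed.

Lemma pt_bounded {B} `{data B} (f : E -> B) : pt f -> bounded (fun e => sz (f e)).
Proof. by move=> /tree_prog_size [p Hp]; exists p => e; exact: Hp. Qed.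

Lemma pt_id : pt (fun e : E => e).
Proof. exact: tree_prog_id. Qed.

Lemma pt_const {B} `{data B} (b : B) : pt (fun _ : E => b).
Proof. exact: tree_prog_const. Qed.

Lemma pt_comp {B C} `{data B} `{data C} (g : B -> C) (f : E -> B) :
  pt g -> pt f -> pt (fun e => g (f e)).
Proof.
move=> Hg Hf; apply: tree_prog_comp Hf _; apply: tree_prog_reindex Hg _ => e _.
by exists (f e).
Qed.

Lemma pt_pair {B C} `{data B} `{data C} (f : E -> B) (g : E -> C) :
  pt f -> pt g -> pt (fun e => (f e, g e)).
Proof. exact: tree_prog_cons. Qed.

Lemma pt_fst {B C} `{data B} `{data C} (f : E -> B * C) : pt f -> pt (fun e => (f e).1).
Proof. by move=> Hf; apply: tree_prog_comp Hf _; exact: tree_prog_car. Qed.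

Lemma pt_snd {B C} `{data B} `{data C} (f : E -> B * C) : pt f -> pt (fun e => (f e).2).
Proof. by move=> Hf; apply: tree_prog_comp Hf _; exact: tree_prog_cdr. Qed.

Lemma tree_prog_sub X (D D' : X -> Prop) i o :
  (forall x, D' x -> D x) -> tree_prog D i o -> tree_prog D' i o.
Proof. by move=> HD H1; apply: tree_prog_reindex H1 _ => x /HD Dx; exists x. Qed.

Lemma tree_prog_branch (c : E -> tree) (o f g : E -> tree) :
  tree_prog (fun _ => True) enc c ->
  tree_prog (fun _ => True) enc f -> tree_prog (fun _ => True) enc g ->
  (forall e, o e = if is_cons (c e) then f e else g e) ->
  tree_prog (fun _ => True) enc o.
Proof.
move=> Hc Hf Hg e; apply: (tree_prog_if Hc).
  apply: (tree_prog_ext (o := f)); first by move=> x [_ cx]; rewrite e cx.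
  exact: tree_prog_sub Hf.
apply: (tree_prog_ext (o := g)); first by move=> x [_ /negbTE cx]; rewrite e cx.
exact: tree_prog_sub Hg.
Qed.

Lemma pt_if {B} `{data B} (c : E -> bool) (f g : E -> B) :
  pt c -> pt f -> pt g -> pt (fun e => if c e then f e else g e).
Proof.
move=> Hc Hf Hg; apply: (tree_prog_branch Hc Hf Hg) => e.
by case: (c e).
Qed.

Lemma pt_cons {B} `{data B} (f : E -> B) (g : E -> seq B) :
  pt f -> pt g -> pt (fun e => f e :: g e).
Proof. exact: tree_prog_cons. Qed.

Lemma pt_S (f : E -> nat) : pt f -> pt (fun e => (f e).+1).
Proof. by move=> Hf; apply: tree_prog_cons Hf; exact: tree_prog_const. Qed.

Lemma pt_pred (f : E -> nat) : pt f -> pt (fun e => (f e).-1).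
Proof.
move=> Hf; apply: tree_prog_comp Hf _.
by apply: tree_prog_ext (tree_prog_cdr _ _) => e _; case: (f e).
Qed.

Lemma pt_behead {B} `{data B} (f : E -> seq B) : pt f -> pt (fun e => behead (f e)).
Proof.
move=> Hf; apply: tree_prog_comp Hf _.
by apply: tree_prog_ext (tree_prog_cdr _ _) => e _; case: (f e).
Qed.

Lemma pt_head {B} `{data B} (x : E -> B) (f : E -> seq B) :
  pt x -> pt f -> pt (fun e => head (x e) (f e)).
Proof.
move=> Hx Hf; apply: (tree_prog_branch (f := fun e => car (enc (f e))) Hf _ Hx).
  by apply: tree_prog_comp Hf _; exact: tree_prog_car.
by move=> e; case: (f e).
Qed.

Lemma pt_nilp {B} `{data B} (f : E -> seq B) : pt f -> pt (fun e => nilp (f e)).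
Proof.
move=> Hf; apply: (tree_prog_branch Hf (tree_prog_const _ _ (enc false)) (tree_prog_const _
    _ (enc true))).
by move=> e; case: (f e).
Qed.

Lemma pt_eqn0 (f : E -> nat) : pt f -> pt (fun e => f e == 0).
Proof.
move=> Hf; apply: (tree_prog_branch Hf (tree_prog_const _ _ (enc false)) (tree_prog_const _
    _ (enc true))).
by move=> e; case: (f e).
Qed.

Lemma pt_negb (b : E -> bool) : pt b -> pt (fun e => ~~ b e).
Proof. by move=> H1; apply: pt_if => //; apply: pt_const. Qed.

Lemma pt_andb (b c : E -> bool) : pt b -> pt c -> pt (fun e => b e && c e).
Proof. by move=> H1 H2; apply: pt_if => //; apply: pt_const. Qed.

Lemma pt_orb (b c : E -> bool) : pt b -> pt c -> pt (fun e => b e || c e).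
Proof. by move=> H1 H2; apply: pt_if => //; apply: pt_const. Qed.

Lemma pt_eqb (b c : E -> bool) : pt b -> pt c -> pt (fun e => b e == c e).
Proof.
move=> H1 H2; apply: (pt_ext (f := fun e => if b e then c e else ~~ c e)).
  by move=> e; case: (b e); case: (c e).
by apply: pt_if => //; apply: pt_negb.
Qed.

Lemma bounded_sz : bounded (fun e : E => sz e).
Proof. exact: bounded_size. Qed.

Lemma bounded_nat (f : E -> nat) : pt f -> bounded f.
Proof.
by move=> Hf; apply: bounded_le (pt_bounded Hf) => e; rewrite sz_nat; lia.
Qed.

Lemma spine_nat (n : nat) : spine (enc n) = n.
Proof. by elim: n => //= n ->. Qed.

Lemma spine_seq {B} `{data B} (s : seq B) : spine (enc s) = size s.
Proof. by elim: s => //= x s ->. Qed.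

Lemma pt_iter {A} `{data A} (n : E -> nat) (a : E -> A) (s : E -> A -> A) (b : E -> nat) :
  pt n -> pt a -> pt (fun p => s p.1 p.2) -> bounded b ->
  (forall e i, i <= n e -> sz (iter i (s e) (a e)) <= b e) ->
  pt (fun e => iter (n e) (s e) (a e)).
Proof.
move=> Hn Ha Hs [c Hc] Hb.
(* The step may depend on the environment, which therefore travels along with the accumulator and is
   discarded at the end. *)
apply: (@tree_prog_comp _ _ _ (fun e => enc (e, iter (n e) (s e) (a e)))); last first.
  exact: tree_prog_cdr.
apply: (tree_prog_ext (o := fun e => enc (e, iter (spine (enc (n e))) (s e) (a e)))).
  by move=> e _; rewrite spine_nat.
apply: (tree_prog_iter (st := fun e j => enc (e, iter j (s e) (a e)))
  (b := ('X + c + polyC 1%N)%R) Hn).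
- by apply: tree_prog_cons => //; exact: tree_prog_id.
- apply: tree_prog_cons; first exact: tree_prog_car.
  by apply: tree_prog_reindex Hs _ => -[e j] _; exists (e, iter j (s e) (a e)).
- move=> e j _; rewrite spine_nat => /Hb Hj; rewrite -/(sz _) sz_pair.
  rewrite !hornerD_nat hornerX hornerC_nat -/(sz e) addn1 ltnS leq_add2l.
  exact: leq_trans Hj (Hc e).
Qed.

Lemma pt_foldl {A B} `{data A} `{data B} (l : E -> seq B) (a : E -> A)
    (s : E -> A -> B -> A) (b : E -> nat) :
  pt l -> pt a -> pt (fun p => s p.1.1 p.1.2 p.2) -> bounded b ->
  (forall e l1 l2, l e = l1 ++ l2 -> sz (foldl (s e) (a e) l1) <= b e) ->
  pt (fun e => foldl (s e) (a e) (l e)).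
Proof.
move=> Hl Ha Hs [c Hc] Hb; have [q Hq] := pt_bounded Hl.
(* The state consists of the environment, the unread part of the list and the accumulator; the two
   pairing nodes account for the constant [2] in the bound. *)
pose (st := fun (e : E) (j : nat) =>
  enc (e, (drop j (l e), foldl (s e) (a e) (take j (l e))))).
refine (tree_prog_comp (m := fun e => st e (spine (enc (l e)))) _ _); last first.
  apply: (tree_prog_ext (o := fun e => cdr (cdr (st e (spine (enc (l e))))))).
    by move=> e _; rewrite /st spine_seq take_size.
  by apply: tree_prog_comp (tree_prog_cdr _ _) _; exact: tree_prog_cdr.
apply: (tree_prog_iter (b := ('X + (q + c) + polyC 2%N)%R) Hl).
- apply: (tree_prog_ext (o := fun e => enc (e, (l e, a e)))).
    by move=> e _; rewrite /st drop0 take0.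
  apply: tree_prog_cons; first exact: tree_prog_id.
  exact: tree_prog_cons.
- set i := (fun p => st p.1 p.2); set D := (fun p : E * nat => _).
  have Hcdr : tree_prog D i (fun p => cdr (i p)) by exact: tree_prog_cdr.
  have Hrest : tree_prog D i (fun p => car (cdr (i p))).
    by apply: tree_prog_comp Hcdr _; exact: tree_prog_car.
  apply: tree_prog_cons; first exact: tree_prog_car.
  apply: tree_prog_cons.
    apply: (tree_prog_ext (o := fun p => cdr (car (cdr (i p))))).
      move=> [e j] _ /=; rewrite -addn1 addnC -drop_drop drop1.
      by case: (drop j _).
    by apply: tree_prog_comp Hrest _; exact: tree_prog_cdr.
  apply: (@tree_prog_comp _ _ _ (fun p => Cons (Cons (car (i p)) (cdr (cdr (i p))))
     (car (car (cdr (i p)))))).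
    apply: tree_prog_cons.
      apply: tree_prog_cons; first exact: tree_prog_car.
      by apply: tree_prog_comp Hcdr _; exact: tree_prog_cdr.
    by apply: tree_prog_comp Hrest _; exact: tree_prog_car.
  apply: tree_prog_reindex Hs _ => -[e j] [_ /=]; rewrite spine_seq => Hj.
  case ed : (drop j (l e)) => [|x t].
    by have := size_drop j (l e); rewrite ed /=; lia.
  exists (e, foldl (s e) (a e) (take j (l e)), x); split=> //.
  have -> : take j.+1 (l e) = rcons (take j (l e)) x.
    by rewrite -addn1 takeD ed /= take0 cats1.
  by rewrite foldl_rcons.
- move=> e j _ _; rewrite -/(sz (e, (_, _))) !sz_pair /=.
  rewrite !hornerD_nat hornerX hornerC_nat -/(sz e).
  have := Hb e (take j (l e)) (drop j (l e)); rewrite cat_take_drop => /(_ erefl) h1.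
  have h2 := Hc e; have h3 := Hq e.
  have : sz (drop j (l e)) <= sz (l e).
    pose proof (sz_gt0 (take j (l e))) as h4.
    pose proof (sz_cat (take j (l e)) (drop j (l e))) as h5.
    by move: h5; rewrite cat_take_drop; lia.
  move: h1 h2 h3; rewrite -[in horner c _]/(sz e); lia.
Qed.

End Basic.

(* Redefined below to cover the derived operations. *)
Ltac pt_user := fail.

Ltac bnd_step := first
  [ exact: bounded_sz | apply: bounded_const | apply: bounded_add
  | apply: bounded_mul | apply: bounded_horner ].

Ltac pt_step := cbv beta; lazymatch goal with
  | |- pt (fun e => e) => apply pt_id
  | |- pt fst => apply (pt_fst pt_id)
  | |- pt snd => apply (pt_snd pt_id)
  | |- pt (fun e => (@?f e).1) => apply (pt_fst (f := f))
  | |- pt (fun e => (@?f e).2) => apply (pt_snd (f := f))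
  | |- pt (fun e => (@?f e, @?g e)) => apply (pt_pair (f := f) (g := g))
  | |- pt (fun e => @?f e :: @?g e) => apply (pt_cons (f := f) (g := g))
  | |- pt (fun e => ~~ (@?b e)) => apply (pt_negb (b := b))
  | |- pt (fun e => (@?b e) && (@?c e)) => apply (pt_andb (b := b) (c := c))
  | |- pt (fun e => (@?b e) || (@?c e)) => apply (pt_orb (b := b) (c := c))
  | |- pt (fun e => @eq_op _ (@?b e) (@?c e)) => first [apply (pt_eqb (b := b) (c := c)) |
      pt_user]
  | |- pt (fun e => (@?f e).-1) => apply (pt_pred (f := f))
  | |- pt (fun e => nilp (@?f e)) => apply (pt_nilp (f := f))
  | |- pt (fun e => behead (@?f e)) => apply (pt_behead (f := f))
  | |- pt (fun e => head (@?x e) (@?f e)) => apply (pt_head (x := x) (f := f))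
  | |- _ => first [simple apply pt_const | simple apply pt_if | pt_user]
  end.

Ltac pt_auto := repeat first [ eassumption | pt_step ].

Lemma pt_rev {E} `{data E} {B} `{data B} (l : E -> seq B) : pt l -> pt (fun e => rev (l e)).
Proof.
move=> Hl; apply: (pt_ext (f := fun e => foldl (fun a x => x :: a) [::] (l e))).
  move=> e; rewrite -[LHS]cats0 -[_ ++ _]revK.
  have loop (s a : seq B) : foldl (fun a x => x :: a) a s = catrev s a.
    by elim: s a => //= x s IH a; rewrite IH.
  by rewrite revK cats0 loop.
apply: (pt_foldl (b := fun e => sz (l e)) Hl); try by pt_auto.
  exact: pt_bounded.
move=> e l1 l2 ->.
have loop (s a : seq B) : (sz (foldl (fun a x => x :: a) a s)).+1 = sz s + sz a.
  elim: s a => [|x s IH] a; first by rewrite sz_nil.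
  by rewrite /= IH !sz_cons; lia.
pose proof (loop l1 [::]) as h1; pose proof (sz_cat l1 l2) as h2.
pose proof (sz_gt0 l2) as h3; rewrite sz_nil in h1; lia.
Qed.

Lemma pt_foldr {E} `{data E} {A B} `{data A} `{data B} (l : E -> seq B) (a : E -> A)
    (s : E -> B -> A -> A) (b : E -> nat) :
  pt l -> pt a -> pt (fun p => s p.1.1 p.1.2 p.2) -> bounded b ->
  (forall e l1 l2, l e = l1 ++ l2 -> sz (foldr (s e) (a e) l2) <= b e) ->
  pt (fun e => foldr (s e) (a e) (l e)).
Proof.
move=> Hl Ha Hs Hb Hsz.
apply: (pt_ext (f := fun e => foldl (fun a x => s e x a) (a e) (rev (l e)))).
  by move=> e; rewrite foldl_rev.
apply: pt_foldl Hb _ => //; first exact: pt_rev.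
  apply: (pt_comp (g := fun p => s p.1.1 p.1.2 p.2) (f := fun p => (p.1.1, p.2, p.1.2))) => //.
  by pt_auto.
move=> e l1 l2 el; rewrite -[l1]revK foldl_rev; apply: (Hsz e (rev l2)).
by rewrite -rev_cat -el revK.
Qed.

Lemma pt_map {E} `{data E} {A B} `{data A} `{data B} (l : E -> seq B) (f : E -> B -> A) :
  pt (fun p => f p.1 p.2) -> pt l -> pt (fun e => map (f e) (l e)).
Proof.
move=> Hf Hl; have [q Hq] := pt_bounded Hf.
apply: (pt_ext (f := fun e => foldr (fun x a => f e x :: a) [::] (l e))).
  by move=> e; elim: (l e) => //= x s ->.
have Hb := pt_bounded Hl.
(* The list has fewer than [sz (l e)] entries, and the size polynomial [q] of [f] bounds the image
   of each. *)
apply: (pt_foldr (b := fun e => 1 + sz (l e) * (1 + horner q (1 + sz e + sz (l e)))) Hl).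
- by pt_auto.
- apply: pt_cons; last by pt_auto.
  apply: (pt_comp (g := fun p => f p.1 p.2) (f := fun p => (p.1.1, p.1.2))) => //.
  by pt_auto.
- by repeat first [exact: Hb | bnd_step].
move=> e l1 l2 el.
have h1 : sz l2 <= sz (l e).
  rewrite el; pose proof (sz_cat l1 l2) as h2; pose proof (sz_gt0 l1) as h3; lia.
set c := 1 + horner q _.
apply: (@leq_trans (1 + sz l2 * c)); last by rewrite leq_add2l leq_mul2r h1 orbT.
elim: l2 {el} h1 => [|x s IH]; first by rewrite /= !sz_nil; lia.
rewrite sz_cons => h1; rewrite /= sz_cons.
have h2 : (sz (f e x)).+1 <= c.
  rewrite /c add1n ltnS; apply: leq_trans (Hq (e, x)) _.
  by apply: horner_nat_mono; rewrite sz_pair /=; lia.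
have : sz (foldr (fun x a => f e x :: a) [::] s) <= 1 + sz s * c by apply: IH; lia.
have : c <= sz x * c by rewrite leq_pmull // sz_gt0.
rewrite mulSn mulnDl; lia.
Qed.

Lemma pt_cat {E} `{data E} {A} `{data A} (s t : E -> seq A) :
  pt s -> pt t -> pt (fun e => s e ++ t e).
Proof.
move=> Hs Ht; apply: (pt_ext (f := fun e => foldr cons (t e) (s e))).
  by move=> e; elim: (s e) => //= x l ->.
have bs := pt_bounded Hs; have bt := pt_bounded Ht.
apply: (pt_foldr (b := fun e => sz (s e) + sz (t e)) Hs Ht).
- by pt_auto.
- by apply: bounded_add.
move=> e l1 l2 ->; have -> : foldr cons (t e) l2 = l2 ++ t e by elim: l2 => //= x l ->.
pose proof (sz_cat l1 l2) as h1; pose proof (sz_cat l2 (t e)) as h2.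
pose proof (sz_gt0 l1) as h3; lia.
Qed.

Lemma pt_flatten {E} `{data E} {A} `{data A} (s : E -> seq (seq A)) :
  pt s -> pt (fun e => flatten (s e)).
Proof.
move=> Hs; apply: (pt_foldr (b := fun e => sz (s e)) Hs).
- by pt_auto.
- by apply: pt_cat; pt_auto.
- exact: pt_bounded.
move=> e l1 l2 ->; pose proof (sz_cat l1 l2) as h1; pose proof (sz_gt0 l1) as h2.
have h3 : sz (flatten l2) <= sz l2; last first.
  by move: h3; rewrite /flatten; lia.
elim: {h1} l2 => // x l IH; rewrite sz_cons /=.
pose proof (sz_cat x (flatten l)); lia.
Qed.

Lemma pt_size {E} `{data E} {A} `{data A} (s : E -> seq A) : pt s -> pt (fun e => size (s e)).
Proof.
move=> Hs; apply: (pt_ext (f := fun e => foldr (fun _ n => n.+1) 0 (s e))).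
  by move=> e; elim: (s e) => //= x l ->.
apply: (pt_foldr (b := fun e => 2 * sz (s e)) Hs).
- by pt_auto.
- by apply: pt_S; pt_auto.
- by apply: bounded_mul; [exact: bounded_const | exact: pt_bounded].
move=> e l1 l2 ->; have -> : foldr (fun (_ : A) n => n.+1) 0 l2 = size l2.
  by elim: l2 => //= x l ->.
rewrite sz_nat.
pose proof (size_le_sz (l1 ++ l2)) as h; rewrite size_cat in h; lia.
Qed.

Lemma pt_addn {E} `{data E} (m n : E -> nat) : pt m -> pt n -> pt (fun e => m e + n e).
Proof.
move=> Hm Hn; apply: (pt_ext (f := fun e => iter (m e) succn (n e))).
  by move=> e; rewrite iter_succn addnC.
have bm := bounded_nat Hm; have bn := bounded_nat Hn.
apply: (pt_iter (b := fun e => 2 * (m e + n e) + 1) Hm Hn).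
- by apply: pt_S; pt_auto.
- by repeat first [eassumption | bnd_step].
by move=> e i Hi; rewrite iter_succn sz_nat; lia.
Qed.

Lemma pt_subn {E} `{data E} (m n : E -> nat) : pt m -> pt n -> pt (fun e => m e - n e).
Proof.
move=> Hm Hn; apply: (pt_ext (f := fun e => iter (n e) predn (m e))).
  by move=> e; rewrite iter_predn.
have bm := bounded_nat Hm.
apply: (pt_iter (b := fun e => 2 * m e + 1) Hn Hm).
- by pt_auto.
- by repeat first [eassumption | bnd_step].
by move=> e i Hi; rewrite iter_predn sz_nat; lia.
Qed.

Lemma pt_muln {E} `{data E} (m n : E -> nat) : pt m -> pt n -> pt (fun e => m e * n e).
Proof.
move=> Hm Hn; apply: (pt_ext (f := fun e => iter (m e) (addn (n e)) 0)).
  by move=> e; rewrite iter_addn addn0 mulnC.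
have bm := bounded_nat Hm; have bn := bounded_nat Hn.
apply: (pt_iter (b := fun e => 2 * (m e * n e) + 1) Hm).
- by pt_auto.
- apply: pt_addn; last by pt_auto.
  by apply: pt_comp Hn _; pt_auto.
- by repeat first [eassumption | bnd_step].
move=> e i Hi; rewrite iter_addn addn0 sz_nat.
have : n e * i <= n e * m e by rewrite leq_mul2l Hi orbT.
by rewrite mulnC; lia.
Qed.

Lemma pt_leq {E} `{data E} (m n : E -> nat) : pt m -> pt n -> pt (fun e => m e <= n e).
Proof. by move=> Hm Hn; apply: pt_eqn0; apply: pt_subn. Qed.

Lemma pt_eqn {E} `{data E} (m n : E -> nat) : pt m -> pt n -> pt (fun e => m e == n e).
Proof.
move=> Hm Hn; apply: (pt_ext (f := fun e => (m e <= n e) && (n e <= m e))).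
  by move=> e; rewrite eqn_leq.
by apply: pt_andb; apply: pt_leq.
Qed.

Lemma pt_drop {E} `{data E} {A} `{data A} (n : E -> nat) (s : E -> seq A) :
  pt n -> pt s -> pt (fun e => drop (n e) (s e)).
Proof.
move=> Hn Hs; apply: (pt_ext (f := fun e => iter (n e) behead (s e))).
  by move=> e; elim: (n e) (s e) => [|k IH] l; rewrite ?drop0 // iterSr IH -drop1 drop_drop
      addn1.
apply: (pt_iter (b := fun e => sz (s e)) Hn Hs).
- by pt_auto.
- exact: pt_bounded.
move=> e i _; elim: i => //= i; set l := iter _ _ _; case: l => [|x l] //=.
by rewrite sz_cons; lia.
Qed.

Lemma pt_nth {E} `{data E} {A} `{data A} (x : E -> A) (s : E -> seq A) (n : E -> nat) :
  pt x -> pt s -> pt n -> pt (fun e => nth (x e) (s e) (n e)).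
Proof.
move=> Hx Hs Hn; apply: (pt_ext (f := fun e => head (x e) (drop (n e) (s e)))).
  by move=> e; rewrite -nth0 nth_drop addn0.
by apply: pt_head => //; apply: pt_drop.
Qed.

Lemma pt_nseq {E} `{data E} {A} `{data A} (n : E -> nat) (x : E -> A) :
  pt n -> pt x -> pt (fun e => nseq (n e) (x e)).
Proof.
move=> Hn Hx; have bn := bounded_nat Hn; have bx := pt_bounded Hx.
have sE e i : iter i (cons (x e)) [::] = nseq i (x e) by elim: i => //= i ->.
apply: (pt_ext (f := fun e => iter (n e) (cons (x e)) [::])).
  by move=> e; rewrite sE.
apply: (pt_iter (b := fun e => 1 + n e * (1 + sz (x e))) Hn).
- by pt_auto.
- apply: pt_cons; last by pt_auto.
  by apply: pt_comp Hx _; pt_auto.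
- by repeat first [eassumption | bnd_step].
move=> e i Hi; apply: (@leq_trans (1 + i * (1 + sz (x e)))).
  by elim: (i) => //= j IH; rewrite sz_cons mulSn; lia.
by rewrite leq_add2l leq_mul2r Hi orbT.
Qed.

Lemma pt_iota0 {E} `{data E} (n : E -> nat) : pt n -> pt (fun e => iota 0 (n e)).
Proof.
move=> Hn.
have sE i : iter i (fun s => 0 :: map succn s) [::] = iota 0 i.
  by elim: i => //= i ->; rewrite (iotaDl 1 0 i).
apply: (pt_ext (f := fun e => iter (n e) (fun s => 0 :: map succn s) [::])).
  by move=> e; rewrite sE.
have bn := bounded_nat Hn.
apply: (pt_iter (b := fun e => 1 + n e * (2 * n e + 2)) Hn).
- by pt_auto.
- apply: pt_cons; first by pt_auto.
  by apply: pt_map; [apply: pt_S|]; pt_auto.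
- by repeat first [eassumption | bnd_step].
move=> e i Hi; rewrite sE; apply: (@leq_trans (1 + i * (2 * n e + 2))).
  have loop k : k + i <= n e -> sz (iota k i) <= 1 + i * (2 * n e + 2).
    elim: i {Hi} k => [|i IH] k Hk //=; rewrite sz_cons sz_nat mulSn.
    by have := IH k.+1; lia.
  exact: loop.
by rewrite leq_add2l leq_mul2r Hi orbT.
Qed.

Lemma pt_iota {E} `{data E} (m n : E -> nat) :
  pt m -> pt n -> pt (fun e => iota (m e) (n e)).
Proof.
move=> Hm Hn; apply: (pt_ext (f := fun e => map (addn (m e)) (iota 0 (n e)))).
  by move=> e; rewrite -iotaDl addn0.
apply: pt_map; last exact: pt_iota0.
by apply: pt_addn; [apply: pt_comp Hm _|]; pt_auto.
Qed.

Lemma pt_filter {E} `{data E} {A} `{data A} (s : E -> seq A) (p : E -> pred A) :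
  pt (fun q => p q.1 q.2) -> pt s -> pt (fun e => filter (p e) (s e)).
Proof.
move=> Hp Hs; apply: (pt_ext (f := fun e =>
    flatten (map (fun x => if p e x then [:: x] else [::]) (s e)))).
  by move=> e; elim: (s e) => //= x l ->; case: (p e x).
by apply: pt_flatten; apply: pt_map => //; apply: pt_if => //; pt_auto.
Qed.

Lemma pt_has {E} `{data E} {A} `{data A} (s : E -> seq A) (p : E -> pred A) :
  pt (fun q => p q.1 q.2) -> pt s -> pt (fun e => has (p e) (s e)).
Proof.
move=> Hp Hs; apply: (pt_ext (f := fun e => 0 < size (filter (p e) (s e)))).
  by move=> e; rewrite size_filter has_count.
apply: pt_leq; first by pt_auto.
by apply: pt_size; apply: pt_filter.
Qed.

Lemma pt_all {E} `{data E} {A} `{data A} (s : E -> seq A) (p : E -> pred A) :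
  pt (fun q => p q.1 q.2) -> pt s -> pt (fun e => all (p e) (s e)).
Proof.
move=> Hp Hs; apply: (pt_ext (f := fun e => ~~ has (fun x => ~~ p e x) (s e))).
  by move=> e; rewrite -all_predC; apply: eq_all => x /=; rewrite negbK.
by apply: pt_negb; apply: pt_has => //; apply: pt_negb.
Qed.

Lemma pt_mem_nat {E} `{data E} (x : E -> nat) (s : E -> seq nat) :
  pt x -> pt s -> pt (fun e => x e \in s e).
Proof.
move=> Hx Hs; apply: (pt_ext (f := fun e => has (fun y => y == x e) (s e))).
  by move=> e; rewrite has_pred1.
apply: pt_has => //; apply: pt_eqn; first by pt_auto.
by apply: pt_comp Hx _; pt_auto.
Qed.

Lemma pt_horner {E} `{data E} (p : {poly nat}) (n : E -> nat) : pt n -> pt (fun e => horner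
    p (n e)).
Proof.
move=> Hn; rewrite /horner; elim: (polyseq p) => [|a s IH] /=; first exact: pt_const.
by apply: pt_addn; [apply: pt_muln | exact: pt_const].
Qed.

Lemma pt_rcons {E} `{data E} {A} `{data A} (s : E -> seq A) (x : E -> A) :
  pt s -> pt x -> pt (fun e => rcons (s e) (x e)).
Proof.
move=> Hs Hx; apply: (pt_ext (f := fun e => s e ++ [:: x e])).
  by move=> e; rewrite cats1.
by apply: pt_cat => //; apply: pt_cons => //; exact: pt_const.
Qed.

Ltac pt_user ::= lazymatch goal with
  | |- pt (fun e => rev (@?l e)) => apply (pt_rev (l := l))
  | |- pt (fun e => map (@?f e) (@?l e)) => apply (pt_map (f := f) (l := l))
  | |- pt (fun e => cat (@?f e) (@?l e)) => apply (pt_cat (s := f) (t := l))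
  | |- pt (fun e => rcons (@?s e) (@?x e)) => apply (pt_rcons (s := s) (x := x))
  | |- pt (fun e => flatten (@?f e)) => apply (pt_flatten (s := f))
  | |- pt (fun e => size (@?f e)) => apply (pt_size (s := f))
  | |- pt (fun e => addn (@?m e) (@?n e)) => apply (pt_addn (m := m) (n := n))
  | |- pt (fun e => subn (@?m e) (@?n e)) => apply (pt_subn (m := m) (n := n))
  | |- pt (fun e => muln (@?m e) (@?n e)) => apply (pt_muln (m := m) (n := n))
  | |- pt (fun e => leq (@?m e) (@?n e)) => apply (pt_leq (m := m) (n := n))
  | |- pt (fun e => (@?n e).+1) => apply (pt_S (f := n))
  | |- pt (fun e => @eq_op _ (@?m e) (@?n e)) => apply (pt_eqn (m := m) (n := n))
  | |- pt (fun e => drop (@?m e) (@?n e)) => apply (pt_drop (n := m) (s := n))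
  | |- pt (fun e => nth (@?x e) (@?s e) (@?n e)) =>
      apply (pt_nth (x := x) (s := s) (n := n))
  | |- pt (fun e => nseq (@?m e) (@?n e)) => apply (pt_nseq (n := m) (x := n))
  | |- pt (fun e => iota (@?m e) (@?n e)) => apply (pt_iota (m := m) (n := n))
  | |- pt (fun e => filter (@?f e) (@?l e)) => apply (pt_filter (p := f) (s := l))
  | |- pt (fun e => has (@?f e) (@?l e)) => apply (pt_has (p := f) (s := l))
  | |- pt (fun e => all (@?f e) (@?l e)) => apply (pt_all (p := f) (s := l))
  | |- pt (fun e => @?x e \in @?s e) => apply (pt_mem_nat (x := x) (s := s))
  | |- pt (fun e => horner ?p (@?n e)) => apply (pt_horner p (n := n))
  end.

(** Under an iterator the environment becomes a nested pair; this splits off the access path to the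
    component on which a function known to be polynomial is evaluated. *)
Ltac pt_path := match goal with
  | Hf : pt ?f |- pt (fun p => ?f (@?g p)) => apply: (pt_comp Hf (f := g))
  end.

Ltac pt_all := repeat first [ pt_path | eassumption | pt_step ].

(** * Conversion between words and their codes *)

Definition is_bit : pred (option bool) := fun o => o != None.

(** After a first reversal the bits come last to first, so the list is built by consing. The strings
    pushed are the bit of [Cons] followed by the code of the boolean, [Cons Nil Nil] or [Nil]. *)
Definition read_word : prog :=
  Then (While R0 is_bit (If R0 is_one (Then (Pop R0) (Push R1 true))
                                      (Then (Pop R0) (Push R1 false))))
  (Then (Push R0 false)
  (While R1 is_bit (If R1 is_one
     (Then (Pop R1) (push_word [:: true; true; false; false]))
     (Then (Pop R1) (push_word [:: true; false]))))).

Lemma exec_read x :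
  exec read_word (St x [::] [::] [::]) (St (code (enc x)) [::] [::] [::])
    (30 * size x + 10).
Proof.
rewrite /read_word; set W1 := While R0 _ _; set W2 := While R1 _ _.
have loop1 y w : exec W1 (St y w [::] [::]) (St [::] (catrev y w) [::] [::]) (10 * size y + 1).
  elim: y w => [|b y IH] w; first by apply: exec_weaken; [exact: exec_while_stop|].
  apply: (exec_weaken (t := 5 + (10 * size y + 1) + 2)); last by rewrite /=; lia.
  rewrite addn2; apply: exec_while_loop (IH _) => //.
  by case: b; (apply: exec_weaken; [run|]).
have loop2 y w : exec W2 (St (code (enc w)) y [::] [::])
    (St (code (enc (catrev y w))) [::] [::] [::]) (20 * size y + 1).
  elim: y w => [|b y IH] w; first by apply: exec_weaken; [exact: exec_while_stop|].
  apply: (exec_weaken (t := 12 + (20 * size y + 1) + 2)); last by rewrite /=; lia.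
  rewrite addn2; apply: exec_while_loop (IH _) => //.
  by case: b; (apply: exec_weaken; [run|]).
apply: exec_weaken.
  apply: exec_then; first exact: loop1.
  apply: exec_then; first exact: exec_push.
  apply: exec_eq_res; first exact: (loop2 _ [::]).
  by rewrite -/(rev (rev x)) revK.
by rewrite size_rev; lia.
Qed.

Definition write_word : prog :=
  Then (While R0 is_one (Then (Pop R0) (If R0 is_one
          (Then (Pop R0) (Then (Pop R0) (Then (Pop R0) (Push R1 true))))
          (Then (Pop R0) (Push R1 false)))))
  (Then (Pop R0)
  (While R1 is_bit (If R1 is_one (Then (Pop R1) (Push R0 true))
                                 (Then (Pop R1) (Push R0 false))))).

Lemma exec_write x :
  exec write_word (St (code (enc x)) [::] [::] [::]) (St x [::] [::] [::])
    (30 * size x + 10).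
Proof.
rewrite /write_word; set W1 := While R0 _ _; set W2 := While R1 _ _.
have loop1 y w : exec W1 (St (code (enc y)) w [::] [::]) (St [:: false] (catrev y w) [::]
    [::]) (15 * size y + 1).
  elim: y w => [|b y IH] w; first by apply: exec_weaken; [exact: exec_while_stop|].
  apply: (exec_weaken (t := 10 + (15 * size y + 1) + 2)); last by rewrite /=; lia.
  rewrite addn2; apply: exec_while_loop (IH _) => //.
  by case: b; (apply: exec_weaken; [run|]).
have loop2 y w : exec W2 (St w y [::] [::]) (St (catrev y w) [::] [::] [::]) (10 * size y + 1).
  elim: y w => [|b y IH] w; first by apply: exec_weaken; [exact: exec_while_stop|].
  apply: (exec_weaken (t := 5 + (10 * size y + 1) + 2)); last by rewrite /=; lia.
  rewrite addn2; apply: exec_while_loop (IH _) => //.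
  by case: b; (apply: exec_weaken; [run|]).
apply: exec_weaken.
  apply: exec_then; first exact: loop1.
  apply: exec_then; first exact: exec_pop.
  apply: exec_eq_res; first exact: (loop2 _ [::]).
  by rewrite -/(rev (rev x)) revK.
by rewrite size_rev; lia.
Qed.

Lemma sz_word (x : seq bool) : sz x <= 4 * size x + 1.
Proof.
elim: x => [|b x IH] /=; first by rewrite sz_nil.
rewrite sz_cons; by have := sz_bool b; lia.
Qed.

Lemma pt_polytime (f : word -> word) : pt f -> polytime f.
Proof.
move=> Hf; have [P [p HP]] := Hf; have [q Hq] := pt_bounded Hf.
have [r Hr] : poly_bounded (@size bool) (fun x : word => (30 * size x + 10) +
   (horner p (4 * size x + 1) + (30 * horner q (4 * size x + 1) + 10))).
  by repeat first [exact: bounded_size | bnd_step].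
apply: (exec_polytime (P := Then read_word (Then P write_word)) (p := r)) => x.
exists (St (f x) [::] [::] [::]); split=> //.
apply: exec_weaken (Hr x); apply: exec_then; first exact: exec_read.
apply: (exec_then (s' := St (code (enc (f x))) [::] [::] [::])).
  apply: exec_weaken (horner_nat_mono _ (sz_word x)).
  by have := HP x I [::] [::] [::] [::]; rewrite !cats0.
apply: exec_weaken; first exact: exec_write.
rewrite leq_add2r leq_mul2l /=.
apply: leq_trans (horner_nat_mono _ (sz_word x)).
by apply: leq_trans (Hq x); exact/ltnW/size_le_sz.
Qed.

(** * Distances in trees with degrees 1 and 3 *)

Section BinaryTrees.

Variable A : eqType.

Inductive btree := Lf of A | Nd of btree & btree.

Fixpoint lv (t : btree) : seq A :=
  match t with Lf x => [:: x] | Nd a b => lv a ++ lv b end.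

Fixpoint depth (t : btree) (x : A) : nat :=
  match t with
  | Lf _ => 0
  | Nd a b => (if x \in lv a then depth a x else depth b x).+1
  end.

Fixpoint tdist (t : btree) (x y : A) : nat :=
  match t with
  | Lf _ => 0
  | Nd a b =>
      match x \in lv a, y \in lv a with
      | true, true => tdist a x y
      | true, false => depth a x + depth b y + 2
      | false, true => depth b x + depth a y + 2
      | false, false => tdist b x y
      end
  end.

End BinaryTrees.

Section TreeGraph.

Variables (T : finType) (e : rel T).

Lemma dist_le u p : path e u p -> dist e u (last u p) <= size p.
Proof.
move=> Hp; rewrite /dist; set P := (X in find X _).
have [lt_p|ge_p] := ltnP (size p) #|T|; last first.
  by apply: leq_trans (find_size _ _) _; rewrite size_iota.
rewrite leqNgt; apply/negP => /(before_find 0).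
rewrite nth_iota // add0n => E; suff : P (size p) by rewrite E.
by apply/existsP; exists (in_tuple p); rewrite /= Hp eqxx.
Qed.

Lemma dist_path u v : connect e u v ->
  exists p, [/\ path e u p, uniq (u :: p), last u p = v & size p = dist e u v].
Proof.
case/connectP => p0 Hp0 E; rewrite /dist; set P := (X in find X _).
have hasP : has P (iota 0 #|T|).
  case/shortenP: Hp0 E => p Hp Up _ E; apply/hasP; exists (size p).
    have := card_uniqP Up; rewrite mem_iota /= => <-; exact: max_card.
  by rewrite /P; apply/existsP; exists (in_tuple p); rewrite /= Hp E eqxx.
have lt_d : find P (iota 0 #|T|) < #|T| by rewrite -[X in _ < X](size_iota 0) -has_find.
have := nth_find 0 hasP; rewrite nth_iota // add0n {1}/P => /existsP[p /andP[Hp /eqP lp]].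
have := dist_le Hp; rewrite lp /dist -/P size_tuple => _.
case/shortenP: Hp lp => q Hq Uq sub_q lq.
exists q; split=> //; apply/eqP; rewrite eqn_leq.
have := dist_le Hq; rewrite lq /dist -/P => ->; rewrite andbT.
by rewrite -[X in _ <= X](size_tuple p) uniq_leq_size //; case/andP: Uq.
Qed.

Hypotheses (symE : symmetric e) (connE : forall u v, connect e u v).

Lemma dist_sym u v : dist e u v = dist e v u.
Proof.
suff H x y : dist e x y <= dist e y x by apply/eqP; rewrite eqn_leq !H.
have [p [Hp _ lp <-]] := dist_path (connE y x).
have := dist_le (u := x) (p := rev (belast y p)).
rewrite size_rev size_belast -lp rev_path (eq_path (e' := e)); last first.
  by move=> a b; rewrite symE.
move=> /(_ Hp); congr (dist _ _ _ <= _).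
by case: p {Hp lp} => //= a p; rewrite rev_cons last_rcons.
Qed.

Lemma dist_triangle u v w : dist e u w <= dist e u v + dist e v w.
Proof.
have [p [Hp _ lp <-]] := dist_path (connE u v).
have [q [Hq _ lq <-]] := dist_path (connE v w).
rewrite -size_cat -[X in dist e u X]lq -lp -last_cat.
by apply: dist_le; rewrite cat_path Hp lp.
Qed.

Lemma dist_refl u : dist e u u = 0.
Proof. by apply/eqP; rewrite -leqn0; exact: (@dist_le u [::]). Qed.

Hypotheses (irrE : irreflexive e) (acyc : forall c, ucycle e c -> size c <= 2).

(** Adjacency with [u] deleted: for a neighbour [v] of [u], what is connected to [v] under [off u]
    is the branch that hangs from [u] at [v]. *)
Definition off (u : T) : rel T := [rel x y | [&& e x y, x != u & y != u]].

Lemma off_sym u : connect_sym (off u).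
Proof. by apply: sym_connect_sym => x y; rewrite /off /= symE; congr andb; rewrite andbC. Qed.

Lemma off_path u v p : v != u -> path e v p -> u \notin p -> path (off u) v p.
Proof.
elim: p v => //= x p IH v vu /andP[evx Hp]; rewrite inE negb_or => /andP[ux up].
by rewrite IH ?andbT 1?eq_sym // /off /= evx vu eq_sym.
Qed.

Lemma path_off u v p : v != u -> path (off u) v p -> path e v p && (u \notin v :: p).
Proof.
elim: p v => [|x p IH] v vu; first by rewrite mem_seq1 eq_sym vu.
move=> /= /andP[] /and3P[evx _ xu] /(IH _ xu) /andP[H1 H2].
by rewrite /= evx H1 in_cons negb_or H2 andbT eq_sym vu.
Qed.

Lemma connect_off_neq u v w : v != u -> connect (off u) v w -> w != u.
Proof.
move=> vu /connectP[p /(path_off vu)/andP[_ H] ->].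
by apply: contraNneq H => <-; exact: mem_last.
Qed.

Lemma adj_neq u v : e u v -> v != u.
Proof. by move=> euv; apply/eqP => E; rewrite E irrE in euv. Qed.

(** Otherwise a simple path from [v] to [a] avoiding [u] would close, through [u], to a cycle with
    at least three vertices. *)
Lemma bridge u v a : e u v -> e u a -> connect (off u) v a -> v = a.
Proof.
move=> euv eua /connectP[p Hp E]; case/shortenP: Hp E => q Hq Uq _ E.
have /andP[Hq' nu] := path_off (adj_neq euv) Hq.
case: q Hq Hq' Uq nu E => [|x q] _ Hq' Uq nu E; first by rewrite E.
have /acyc // : ucycle e [:: u, v, x & q].
rewrite /ucycle cons_uniq nu Uq /= !andbT euv /= .
move: Hq' => /= /andP[-> Hq'] /=; rewrite rcons_path Hq' /=.
by rewrite /= in E; rewrite -E symE.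
Qed.

Lemma connect_first u w : w != u ->
  exists2 x, e u x & connect (off u) x w.
Proof.
move=> wu; have [p [Hp Up lp _]] := dist_path (connE u w).
case: p Hp Up lp => [|x p] /=; first by move=> _ _ E; rewrite E eqxx in wu.
case/andP => eux Hp /andP[nu _] lp; exists x => //.
apply/connectP; exists p => //; apply: off_path => //; first exact: adj_neq.
by apply: contra nu => up; rewrite inE up orbT.
Qed.

(** By [bridge], the second vertex of a simple path from [u] into the branch of [v] can only be
    [v]. *)
Lemma dist_step u v w : e u v -> connect (off u) v w ->
  dist e u w = (dist e v w).+1.
Proof.
move=> euv cvw; apply/eqP; rewrite eqn_leq; apply/andP; split.
  apply: leq_trans (dist_triangle u v w) _; rewrite -add1n leq_add2r.
  by apply: (@dist_le u [:: v]); rewrite /= euv.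
have [p [Hp Up lp <-]] := dist_path (connE u w).
have wu := connect_off_neq (adj_neq euv) cvw.
case: p Hp Up lp => [|x p] /=; first by move=> _ _ E; rewrite E eqxx in wu.
case/andP => eux Hp /andP[nu _] lp.
have cxw : connect (off u) x w.
  apply/connectP; exists p => //; apply: off_path => //; first exact: adj_neq.
  by apply: contra nu => up; rewrite inE up orbT.
have -> : v = x.
  by apply: (bridge euv eux); apply: connect_trans cvw _; rewrite off_sym.
by rewrite -lp ltnS; exact: dist_le.
Qed.

(** A path between two different branches at [v] must pass through [v], since avoiding it would
    connect [a] to [b] and contradict [bridge]. *)
Lemma dist_cross v a b w w' : e v a -> e v b -> a != b ->
  connect (off v) a w -> connect (off v) b w' ->
  dist e w w' = dist e v w + dist e v w'.
Proof.
move=> eva evb ab ca cb; apply/eqP; rewrite eqn_leq.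
rewrite {1}(dist_sym v w) dist_triangle /=.
have [p [Hp Up lp <-]] := dist_path (connE w w').
have [vp|vp] := boolP (v \in w :: p); last first.
  rewrite inE negb_or in vp; case/andP: vp => vw vp.
  have cww : connect (off v) w w'.
    by apply/connectP; exists p => //; apply: off_path => //; rewrite eq_sym.
  case/eqP: ab; apply: (bridge eva evb); apply: connect_trans ca _.
  by apply: connect_trans cww _; rewrite off_sym.
case/splitPl: vp Hp lp {Up} => p1 p2 l1; rewrite cat_path last_cat l1.
case/andP => H1 H2 l2; rewrite size_cat leq_add //.
  by rewrite dist_sym -l1; exact: dist_le.
by rewrite -l2; exact: dist_le.
Qed.

Hypothesis deg13 : forall t, degree e t = 1 \/ degree e t = 3.

Definition spans (u v : T) (t : btree T) : Prop :=
  [/\ uniq (lv t),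
      forall w, (w \in lv t) = connect (off u) v w && (degree e w == 1),
      forall w, w \in lv t -> dist e v w = depth t w &
      forall w w', w \in lv t -> w' \in lv t -> dist e w w' = tdist t w w'].

(** Branches are nested: a walk from [a] that avoids [v] never meets [u], because [a] and [u] are
    distinct neighbours of [v]. *)
Lemma connect_off_sub u v a w : e u v -> e v a -> a != u ->
  connect (off v) a w -> connect (off u) v w.
Proof.
move=> euv eva au /connectP[p Hp ->{w}].
have evu : e v u by rewrite symE.
have vu := adj_neq euv.
have base : connect (off u) v a by apply: connect1; rewrite /off /= eva vu au.
elim/last_ind: p Hp => [//|p x IH]; rewrite rcons_path last_rcons => /andP[Hp lx].
apply: connect_trans (IH Hp) _; apply: connect1; rewrite /off /=.
have cap : connect (off v) a (last a p) by apply/connectP; exists p.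
case/and3P: (lx) => -> lv' xv; apply/and3P; split=> //.
  by apply: contraNneq au => E; rewrite E in cap; rewrite (bridge eva evu cap).
apply: contraNneq au => E.
by rewrite (bridge eva evu) // -E; apply: connect_trans cap _; exact: connect1.
Qed.

(** Induction on the size of the branch. A [v] of degree 1 is the whole branch; a [v] of degree 3
    has two neighbours besides [u], whose branches are smaller because they miss [v], and whose
    trees are joined by [Nd]. *)
Lemma branch u v : e u v -> exists t, spans u v t.
Proof.
have [n] := ubnP #|[set w | connect (off u) v w]|.
elim: n u v => // n IH u v le_n euv; have vu := adj_neq euv.
have evu : e v u by rewrite symE.
case: (deg13 v) => dv.
  have cv w : connect (off u) v w = (w == v).
    apply/idP/eqP => [|->]; last exact: connect0.
    case/connectP => -[|x p] /=; first by [].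
    case/andP => /and3P[evx _ xu] _ _.
    have /eqP/cards1P[y Ey] := dv.
    have : x \in [set w | e v w] by rewrite inE.
    have : u \in [set w | e v w] by rewrite inE.
    by rewrite Ey !inE => /eqP E1 /eqP E2; rewrite E1 E2 eqxx in xu.
  exists (Lf v); split=> //.
  - by move=> w; rewrite cv inE andbC; case: eqP => [->|]; rewrite ?dv ?andbF.
  - by move=> w; rewrite inE => /eqP ->; rewrite dist_refl.
  - by move=> w w'; rewrite !inE => /eqP -> /eqP ->; rewrite dist_refl.
have uN : u \in [set w | e v w] by rewrite inE.
have /cards2P[a [b [ab Eab]]] : #|[set w | e v w] :\ u| == 2.
  by have := cardsD1 u [set w | e v w]; rewrite -/(degree e v) dv uN; lia.
have nbE x : e v x = [|| x == u, x == a | x == b].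
  have := in_setD1 x [set w | e v w] u; rewrite Eab !inE.
  by case: (x =P u) => [->|_] /=; [rewrite evu | move=> ->].
have inab x : x \in [set a; b] -> e v x && (x != u).
  by rewrite -Eab !inE andbC.
have /andP[eva au] : e v a && (a != u) by apply: inab; rewrite !inE eqxx.
have /andP[evb bu] : e v b && (b != u) by apply: inab; rewrite !inE eqxx orbT.
have sub x : e v x -> x != u ->
    #|[set w | connect (off v) x w]| < n.
  move=> evx xu; apply: leq_trans _ (ltnSE le_n); apply: proper_card.
  apply/properP; split.
    by apply/subsetP => w; rewrite !inE; exact: connect_off_sub.
  exists v; rewrite !inE ?connect0 //.
  by apply/negP => /(connect_off_neq (adj_neq evx)); rewrite eqxx.
have [ta [Ua Ma Da Ta]] := IH v a (sub _ eva au) eva.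
have [tb [Ub Mb Db Tb]] := IH v b (sub _ evb bu) evb.
have disj w : connect (off v) a w -> connect (off v) b w -> False.
  move=> ca cb; case/eqP: ab; apply: (bridge eva evb).
  by apply: connect_trans ca _; rewrite off_sym.
have conn w : connect (off u) v w =
    [|| w == v, connect (off v) a w | connect (off v) b w].
  apply/idP/or3P => [/connectP[p Hp E]|[/eqP ->|c|c]]; last 3 first.
  - exact: connect0.
  - exact: (connect_off_sub euv eva au c).
  - exact: (connect_off_sub euv evb bu c).
  case/shortenP: Hp E => -[|x q] Hq Uq _ E; first by constructor 1; rewrite E.
  move: Hq Uq E; rewrite /= => /andP[/and3P[evx _ xu] Hq] /andP[nv _] E.
  have cxw : connect (off v) x w.
    apply/connectP; exists q => //; apply: off_path; first exact: adj_neq.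
      by have /andP[] := path_off xu Hq.
    by apply: contra nv => vq; rewrite inE vq orbT.
  by move: evx; rewrite nbE (negbTE xu) /= => /orP[] /eqP E'; [constructor 2|constructor
      3]; rewrite -E'.
have nab w : w \in lv ta -> w \in lv tb -> False.
  by rewrite Ma Mb => /andP[ca _] /andP[cb _]; exact: disj ca cb.
exists (Nd ta tb); split.
- rewrite /= cat_uniq Ua Ub andbT /=; apply/hasPn => w wb.
  by apply/negP => wa; exact: (nab w).
- move=> w; rewrite mem_cat Ma Mb conn -andb_orl.
  by case: (w =P v) => // ->; rewrite dv !andbF.
- move=> w; rewrite mem_cat /=; case: ifP => [wa _|_ /= wb].
    by rewrite -Da //; apply: dist_step => //; move: wa; rewrite Ma => /andP[].
  by rewrite -Db //; apply: dist_step => //; move: wb; rewrite Mb => /andP[].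
- have step_a w : w \in lv ta -> dist e v w = (depth ta w).+1.
    by move=> wa; rewrite -Da //; apply: dist_step => //; move: wa; rewrite Ma => /andP[].
  have step_b w : w \in lv tb -> dist e v w = (depth tb w).+1.
    by move=> wb; rewrite -Db //; apply: dist_step => //; move: wb; rewrite Mb => /andP[].
  have cross w w' : w \in lv ta -> w' \in lv tb ->
      dist e w w' = depth ta w + depth tb w' + 2.
    move=> wa wb; have := dist_cross eva evb ab (w := w) (w' := w').
    rewrite step_a // step_b // => ->; first by rewrite addSn addnS addn2.
      by move: wa; rewrite Ma => /andP[].
    by move: wb; rewrite Mb => /andP[].
  move=> w w'; rewrite !mem_cat /=.
  case wa: (w \in lv ta); case wa': (w' \in lv ta) => /= Hw Hw'.
  + exact: Ta.
  + exact: cross.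
  + by rewrite dist_sym cross // addnC [_ + depth _ _ in RHS]addnC addnC.
  + exact: Tb.
Qed.

(** The single branch at a leaf [h] contains everything else; the edge from [h] to its neighbour
    accounts for the successor. *)
Lemma rooted_branch h : degree e h = 1 -> exists t,
  [/\ uniq (lv t), forall w, (w \in lv t) = (degree e w == 1) && (w != h),
      forall w, w \in lv t -> dist e h w = (depth t w).+1 &
      forall w w', w \in lv t -> w' \in lv t -> dist e w w' = tdist t w w'].
Proof.
move=> /eqP/cards1P[v Ev].
have eh x : e h x = (x == v) by have := in_set1 x v; rewrite -Ev inE.
have ehv : e h v by rewrite eh.
have [t [Ut Mt Dt Tt]] := branch ehv; exists t.
have conn w : connect (off h) v w = (w != h).
  apply/idP/idP; first exact/connect_off_neq/adj_neq.
  by case/connect_first => x; rewrite eh => /eqP ->.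
split=> // [w|w wt]; first by rewrite Mt conn andbC.
rewrite -Dt //; apply: dist_step => //.
by move: wt; rewrite Mt => /andP[].
Qed.

End TreeGraph.

(** * Perfect trees and triangles *)

Section Perfect.

Variable A : eqType.
Implicit Types t : btree A.

Fixpoint perfect (K : nat) t : bool :=
  match K, t with
  | 0, Lf _ => true
  | K'.+1, Nd a b => perfect K' a && perfect K' b
  | _, _ => false
  end.

Fixpoint sum_depth t : nat :=
  if t is Nd a b then sum_depth a + sum_depth b + size (lv t) else 0.

Lemma sum_depthE t : uniq (lv t) -> \sum_(x <- lv t) depth t x = sum_depth t.
Proof.
elim: t => [x|a IHa b IHb] /=; first by rewrite big_seq1.
rewrite cat_uniq => /and3P[Ua /hasPn nab Ub]; rewrite big_cat /= size_cat.
have -> : \sum_(x <- lv a) (if x \in lv a then depth a x else depth b x).+1 =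
    sum_depth a + size (lv a).
  rewrite -IHa // -sum1_size -big_split /= big_seq [RHS]big_seq.
  by apply: eq_bigr => x ->; rewrite addn1.
have -> : \sum_(x <- lv b) (if x \in lv a then depth a x else depth b x).+1 =
    sum_depth b + size (lv b).
  rewrite -IHb // -sum1_size -big_split /= big_seq [RHS]big_seq.
  by apply: eq_bigr => x /nab; rewrite addn1 => /negbTE ->.
by lia.
Qed.

(* The tangent at [2 ^ K] of the convex function n |-> n log n. *)
Lemma sum_depth_ge K t : K.+1 * size (lv t) <= sum_depth t + 2 ^ K.
Proof.
elim: t K => [x|a IHa b IHb] K /=; first by rewrite muln1 add0n ltn_expl.
rewrite size_cat; case: K => [|K]; first by rewrite mul1n; lia.
have := IHa K; have := IHb K; rewrite expnS; lia.
Qed.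

Lemma perfect_size K t : perfect K t -> size (lv t) = 2 ^ K.
Proof.
elim: K t => [|K IH] [x|a b] //= /andP[Ha Hb].
by rewrite size_cat !IH // expnS mul2n addnn.
Qed.

(** In the inductive step, taking slope [K.+2] in [sum_depth_ge] for one child and [K.+1] for the
    other shows that the former has at most [2 ^ K] leaves. By symmetry both have exactly half of
    them, and slope [K.+1] then leaves each child no excess depth. *)
Lemma sum_depth_perfect K t :
  size (lv t) = 2 ^ K -> sum_depth t <= K * 2 ^ K -> perfect K t.
Proof.
have lv_gt0 (u : btree A) : 0 < size (lv u) by elim: u => //= a Ha b _; rewrite size_cat; lia.
elim: K t => [|K IH] [x|a b] //=.
- by rewrite expn0 size_cat; have := lv_gt0 a; have := lv_gt0 b; lia.
- by rewrite expnS; have := expn_gt0 2 K; rewrite /=; lia.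
rewrite size_cat expnS => Hs Hd.
have := sum_depth_ge K a; have := sum_depth_ge K b.
have := sum_depth_ge K.+1 a; have := sum_depth_ge K.+1 b.
rewrite expnS => H1 H2 H3 H4.
have ea : size (lv a) = 2 ^ K by lia.
have eb : size (lv b) = 2 ^ K by lia.
have Hm : K.+1 * (2 * 2 ^ K) = 2 * (K * 2 ^ K) + 2 * 2 ^ K by lia.
by rewrite !IH //; rewrite ?ea ?eb in H1 H2 H3 H4; lia.
Qed.

Lemma perfect_depth K t x : perfect K t -> x \in lv t -> depth t x = K.
Proof.
elim: K t => [|K IH] [y|a b] //= /andP[Ha Hb]; rewrite mem_cat.
by case: ifP => [xa _|_ /= xb]; rewrite IH.
Qed.

Lemma perfect_tdist K t x y : perfect K t -> x \in lv t -> y \in lv t ->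
  tdist t x y <= 2 * K.
Proof.
elim: K t => [|K IH] [z|a b] //= /andP[Ha Hb]; rewrite !mem_cat.
case xa: (x \in lv a); case ya: (y \in lv a) => /= Hx Hy.
- by apply: leq_trans (IH a _ _ _) _ => //; lia.
- by rewrite (perfect_depth Ha) // (perfect_depth Hb) //; lia.
- by rewrite (perfect_depth Ha) // (perfect_depth Hb) //; lia.
- by apply: leq_trans (IH b _ _ _) _ => //; lia.
Qed.

Lemma perfect_tdist_top K a b x y : perfect K.+1 (Nd a b) ->
  x \in lv (Nd a b) -> y \in lv (Nd a b) ->
  if (x \in lv a) == (y \in lv a) then tdist (Nd a b) x y <= 2 * K
  else tdist (Nd a b) x y == 2 * K.+1.
Proof.
move=> /= /andP[Ha Hb]; rewrite !mem_cat.
case xa: (x \in lv a); case ya: (y \in lv a) => /= Hx Hy.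
- exact: perfect_tdist.
- by rewrite (perfect_depth Ha) // (perfect_depth Hb) //; lia.
- by rewrite (perfect_depth Ha) // (perfect_depth Hb) //; lia.
- exact: perfect_tdist.
Qed.

(** The sum [S] runs over ordered pairs. The two halves contribute their own sums, and each of the
    [2 * 4 ^ K] ordered pairs across the root is at distance [2 * K.+1]. Subtraction is avoided by
    moving a term to the left. *)
Lemma sum_tdist K t : uniq (lv t) -> perfect K t ->
  \sum_(x <- lv t) \sum_(y <- lv t) tdist t x y + 2 * (2 ^ K * 2 ^ K) =
  2 * 2 ^ K * (K * 2 ^ K + 1).
Proof.
elim: K t => [|K IH] [z|a b] //=; first by rewrite !big_seq1.
rewrite cat_uniq => /and3P[Ua /hasPn nab Ub] /andP[Ha Hb].
have {IH} := (IH a Ua Ha, IH b Ub Hb) => -[Sa Sb].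
have sz_a := perfect_size Ha; have sz_b := perfect_size Hb.
have inb x : x \in lv b -> (x \in lv a) = false by move/nab/negbTE.
have const (s1 s2 : seq A) (F : A -> A -> nat) c :
   (forall x y, x \in s1 -> y \in s2 -> F x y = c) ->
   \sum_(x <- s1) \sum_(y <- s2) F x y = size s1 * (size s2 * c).
  move=> HF; rewrite big_seq (eq_bigr (fun _ => size s2 * c)).
    by rewrite -big_seq big_const_seq count_predT iter_addn addn0 mulnC.
  move=> x xs; rewrite big_seq (eq_bigr (fun _ => c)).
    by rewrite -big_seq big_const_seq count_predT iter_addn addn0 mulnC.
  by move=> y; exact: HF.
rewrite big_cat /=.
under eq_bigr do rewrite big_cat /=.
under [X in _ + X + _]eq_bigr do rewrite big_cat /=.
rewrite !big_split /=.
have -> : \sum_(x <- lv a) \sum_(y <- lv a)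
   match x \in lv a, y \in lv a with
   | true, true => tdist a x y | true, false => depth a x + depth b y + 2
   | false, true => depth b x + depth a y + 2 | false, false => tdist b x y end
   = \sum_(x <- lv a) \sum_(y <- lv a) tdist a x y.
  rewrite big_seq [RHS]big_seq; apply: eq_bigr => x ->.
  by rewrite big_seq [RHS]big_seq; apply: eq_bigr => y ->.
have -> : \sum_(x <- lv b) \sum_(y <- lv b)
   match x \in lv a, y \in lv a with
   | true, true => tdist a x y | true, false => depth a x + depth b y + 2
   | false, true => depth b x + depth a y + 2 | false, false => tdist b x y end
   = \sum_(x <- lv b) \sum_(y <- lv b) tdist b x y.
  rewrite big_seq [RHS]big_seq; apply: eq_bigr => x /inb ->.
  by rewrite big_seq [RHS]big_seq; apply: eq_bigr => y /inb ->.
rewrite (const (lv a) (lv b) _ (2 * K.+1)); last first.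
  by move=> x y xa yb; rewrite xa (inb y yb) (perfect_depth Ha) // (perfect_depth Hb) //; lia.
rewrite (const (lv b) (lv a) _ (2 * K.+1)); last first.
  by move=> x y xb ya; rewrite ya (inb x xb) (perfect_depth Ha) // (perfect_depth Hb) //; lia.
rewrite sz_a sz_b expnS; move: Sa Sb; set N := 2 ^ K.
set S1 := \sum_(x <- _) _; set S2 := \sum_(x <- lv b) _.
by move=> Sa Sb; nia.
Qed.

End Perfect.

(** * Pairs, triangles and two-colourings *)

Definition pairs (n : nat) : seq (nat * nat) :=
  flatten [seq [seq (i, j) | j <- iota 0 n & i < j] | i <- iota 0 n].

Lemma pairsP n p : (p \in pairs n) = (p.1 < p.2) && (p.2 < n).
Proof.
case: p => i j /=; apply/flatten_mapP/idP => [[i' Hi' /mapP[j' Hj' [-> ->]]]|/andP[Hij Hjn]].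
  by move: Hj'; rewrite mem_filter mem_iota.
exists i; first by rewrite mem_iota /=; lia.
by apply/mapP; exists j; rewrite // mem_filter Hij mem_iota.
Qed.

Lemma pairs_uniq n : uniq (pairs n).
Proof.
apply: (@allpairs_uniq_dep nat (fun _ => nat) _ (fun i j => (i, j)) (iota 0 n)
   (fun i => [seq j <- iota 0 n | i < j])); first exact: iota_uniq.
  by move=> i _; rewrite filter_uniq // iota_uniq.
by move=> [i j] [i' j'] _ _ [-> ->].
Qed.

Lemma sum_pairs n (F : nat -> nat -> nat) :
  (forall x y, F x y = F y x) -> (forall x, F x x = 0) ->
  2 * \sum_(p <- pairs n) F p.1 p.2 =
  \sum_(x <- iota 0 n) \sum_(y <- iota 0 n) F x y.
Proof.
move=> symF F0; rewrite /pairs big_flatten big_map /=.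
rewrite (eq_bigr (fun i => \sum_(j <- iota 0 n | i < j) F i j)); last first.
  by move=> i _; rewrite big_map big_filter.
have -> : \sum_(x <- iota 0 n) \sum_(y <- iota 0 n) F x y =
   \sum_(x <- iota 0 n) \sum_(y <- iota 0 n | x < y) F x y +
   \sum_(x <- iota 0 n) \sum_(y <- iota 0 n | y < x) F x y.
  rewrite -big_split; apply: eq_bigr => x _ /=.
  rewrite (bigID (fun y => x < y)) /=; congr addn.
  rewrite (bigID (fun y => y < x)) /= [X in _ + X]big1 ?addn0.
    by apply: eq_bigl => y; lia.
  by move=> y Hy; have -> : y = x by lia.
rewrite mul2n -addnn; congr addn.
rewrite (exchange_big_dep predT) //=; apply: eq_bigr => x _.
by apply: eq_bigr => y _; rewrite symF.
Qed.

Lemma sum_remove (T : eqType) (s r : seq T) (F : T -> nat) :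
  uniq s -> uniq r -> {subset r <= s} ->
  \sum_(p <- s) F p = \sum_(p <- s | p \notin r) F p + \sum_(p <- r) F p.
Proof.
move=> Us Ur sub; rewrite (bigID [in r]) /= addnC; congr addn.
rewrite -big_filter; apply: perm_big; apply: uniq_perm => //.
  exact: filter_uniq.
move=> x; rewrite mem_filter; apply/andP/idP => [[]//|xr].
by split=> //; exact: sub.
Qed.

Definition triangle (c : nat) : seq (nat * nat) :=
  [:: (3 * c, 3 * c + 1); (3 * c, 3 * c + 2); (3 * c + 1, 3 * c + 2)].

Definition triangles (t : nat) : seq (nat * nat) :=
  flatten [seq triangle c | c <- iota 0 t].

Lemma trianglesP t p : p \in triangles t ->
  exists2 c, c < t & p \in triangle c.
Proof. by case/flatten_mapP => c; rewrite mem_iota => Hc Hp; exists c. Qed.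

Lemma triangle_bounds c p : p \in triangle c ->
  [/\ 3 * c <= p.1, p.1 < p.2 & p.2 < 3 * c.+1].
Proof. by rewrite !inE => /or3P[] /eqP -> /=; split; lia. Qed.

Lemma triangles_uniq t : uniq (triangles t).
Proof.
rewrite /triangles; elim: t 0 => [//|t IH] m.
change (uniq (triangle m ++ flatten [seq triangle c | c <- iota m.+1 t])).
rewrite cat_uniq IH andbT; apply/andP; split.
  by rewrite /= !inE !xpair_eqE; lia.
apply/hasPn => p /flatten_mapP[c]; rewrite mem_iota => Hc /triangle_bounds[h1 h2 h3].
by apply/negP => /triangle_bounds[h4 h5 h6]; lia.
Qed.

Definition mono (col : nat -> bool) (p : nat * nat) : bool := col p.1 == col p.2.

Definition bad_triangle (col : nat -> bool) (c : nat) : bool :=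
  mono col (3 * c, 3 * c + 1) && mono col (3 * c, 3 * c + 2).

Definition valid (t : nat) (E : seq (nat * nat)) (col : nat -> bool) : bool :=
  all (fun c => ~~ bad_triangle col c) (iota 0 t) &&
  all (fun p => ~~ mono col p) E.

(** With two colours on three vertices, either one or all three of the pairs are monochromatic. *)
Lemma count_triangle col c :
  count (mono col) (triangle c) = (bad_triangle col c).*2.+1.
Proof.
rewrite /bad_triangle /mono /=.
by case: (col (3 * c)); case: (col (3 * c + 1)); case: (col (3 * c + 2)).
Qed.

Lemma count_triangles col t :
  count (mono col) (triangles t) = t + 2 * count (bad_triangle col) (iota 0 t).
Proof.
rewrite /triangles count_flatten -map_comp.
rewrite (eq_map (g := fun c => 1 + 2 * bad_triangle col c)); last first.
  by move=> c; rewrite [LHS]count_triangle; lia.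
rewrite -sum1_count [in RHS]big_mkcond /= sumnE big_map big_split /= sum1_size size_iota.
by congr addn; rewrite big_distrr /=; apply: eq_bigr => c _; case: bad_triangle.
Qed.

(** Each triangle has at least one monochromatic pair, so [t] is the least conceivable count,
    attained only if there is no bad triangle and no monochromatic pair in [E]. This lets one
    number, the total loss, decide validity. *)
Lemma valid_count t E col :
  valid t E col = (count (mono col) (triangles t ++ E) <= t).
Proof.
rewrite count_cat count_triangles /valid; apply/andP/idP.
  move=> [/allP Ht /allP HE].
  have -> : count (bad_triangle col) (iota 0 t) = 0.
    by rewrite -[RHS](count_pred0 (iota 0 t)); apply: eq_in_count => c /Ht/negbTE.
  have -> : count (mono col) E = 0.
    by rewrite -[RHS](count_pred0 E); apply: eq_in_count => c /HE/negbTE.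
  by rewrite muln0 !addn0.
rewrite -[X in _ <= X]addn0 -addnA leq_add2l leqn0 addn_eq0 muln_eq0 /=.
case/andP => /eqP Ht /eqP HE; split; apply/allP => x xs; apply/negP => Hx.
  suff : 0 < count (bad_triangle col) (iota 0 t) by rewrite Ht.
  by rewrite -has_count; apply/hasP; exists x.
suff : 0 < count (mono col) E by rewrite HE.
by rewrite -has_count; apply/hasP; exists x.
Qed.

(** * From short layouts to colourings *)

Lemma tdist_sym (A : eqType) (t : btree A) x y : tdist t x y = tdist t y x.
Proof.
elim: t => //= a Ha b Hb; case: (x \in lv a); case: (y \in lv a) => //.
  by rewrite [depth a x + _]addnC.
by rewrite [depth b x + _]addnC.
Qed.

Lemma tdist_refl (A : eqType) (t : btree A) x : tdist t x x = 0.
Proof. by elim: t => //= a Ha b Hb; case: (x \in lv a). Qed.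

Lemma perfect_sides (A : eqType) K (t : btree A) : 0 < K -> perfect K t ->
  exists side : A -> bool, forall x y, x \in lv t -> y \in lv t ->
    tdist t x y + 2 * (side x == side y) <= 2 * K /\
    (tdist t x y < 2 * K) = (side x == side y).
Proof.
case: K => // K _; case: t => // a b perf; exists (fun x => x \in lv a) => x y Hx Hy.
by have := perfect_tdist_top perf Hx Hy; case: eqP => _ /=; lia.
Qed.

(** Sum of the distances between all pairs of leaves of the perfect tree of height [K]. *)
Definition pair_sum (K : nat) : nat := 2 ^ K * (K * 2 ^ K + 1) - 2 ^ K * 2 ^ K.

Section LabelledTree.

Variables (A : eqType) (t : btree A) (G : nat -> A) (K : nat).
Hypotheses (permG : perm_eq (map G (iota 0 (2 ^ K))) (lv t)) (uniq_t : uniq (lv t)).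

Let d i j := tdist t (G i) (G j).

Lemma label_in i : i < 2 ^ K -> G i \in lv t.
Proof. by move=> Hi; rewrite -(perm_mem permG) map_f // mem_iota. Qed.

Lemma sum_label (F : A -> nat) : \sum_(i <- iota 0 (2 ^ K)) F (G i) = \sum_(x <- lv t) F x.
Proof. by rewrite -(perm_big _ permG) big_map. Qed.

Lemma size_label : size (lv t) = 2 ^ K.
Proof. by rewrite -(perm_size permG) size_map size_iota. Qed.

Lemma sum_pairs_perfect : perfect K t ->
  \sum_(p <- pairs (2 ^ K)) d p.1 p.2 = pair_sum K.
Proof.
move=> perf; have := @sum_pairs (2 ^ K) d.
move=> /(_ (fun x y => tdist_sym _ _ _) (fun x => tdist_refl _ _)).
rewrite /d (eq_bigr (fun i => \sum_(y <- lv t) tdist t (G i) y)); last first.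
  by move=> i _; rewrite -sum_label.
rewrite (sum_label (fun x => \sum_(y <- lv t) tdist t x y)) => H.
have := sum_tdist uniq_t perf; rewrite /pair_sum; lia.
Qed.

End LabelledTree.

(** * The graph of a colouring instance *)

Definition graph_edges (W N : nat) (R : seq (nat * nat)) : seq (nat * nat) :=
  flatten [seq nseq W (N, x) | x <- iota 0 N] ++ [seq p <- pairs N | p \notin R].

Definition proper_edges (N : nat) (es : seq (nat * nat)) : bool :=
  all (fun p => [&& p.1 != p.2, p.1 <= N & p.2 <= N]) es.

Lemma inord_edges_loopless N es : proper_edges N es ->
  all (fun p : 'I_N.+1 * 'I_N.+1 => p.1 != p.2)
      [seq (inord p.1, inord p.2) | p <- es].
Proof.
move=> /allP H; apply/allP => _ /mapP[p /H /and3P[H1 H2 H3] ->] /=.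
by rewrite -val_eqE /= !inordK.
Qed.

Definition graph_of (N : nat) es (H : proper_edges N es) : multigraph :=
  Multigraph (inord_edges_loopless H).

Lemma graph_edges_proper W N R : proper_edges N (graph_edges W N R).
Proof.
apply/allP => p; rewrite mem_cat => /orP[|].
  case/flatten_mapP => x; rewrite mem_iota mem_nseq => Hx /andP[_ /eqP ->] /=.
  by apply/and3P; split; lia.
by rewrite mem_filter pairsP => /andP[_ H]; apply/and3P; split; lia.
Qed.

Lemma graph_of_nats N es (H : proper_edges N es) :
  multigraph_nats (graph_of H) = N.+1 :: flatten [seq [:: p.1; p.2] | p <- es].
Proof.
rewrite /multigraph_nats /=; congr cons; rewrite -map_comp; congr flatten.
apply/eq_in_map => p ps /=; have /and3P[_ H1 H2] := allP H _ ps.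
by rewrite !inordK.
Qed.

(** Reduction from colouring: the hub [N] is joined [W] times to every other
    vertex, which forces the layout rooted at the hub to be perfect; the
    constraint pairs are the non-edges. *)
Definition constraints t E := triangles t ++ E.
(** One extra unit of total distance to the hub must outweigh everything else in the threshold,
    hence more than [pair_sum K + 2 * t]. The term with the number of constraints makes the
    truncated subtraction in [threshold] exact. *)
Definition weight t E K := pair_sum K + 2 * t + 2 * K * size (constraints t E) + 1.
(** In a perfect layout every vertex is at distance [K.+1] from the hub and all pairs together give
    [pair_sum K]; the missing pairs save [2 * K] each, apart from a loss of [2] for one pair of
    every triangle. *)
Definition threshold t E K :=
  weight t E K * (2 ^ K * K.+1) + pair_sum K + 2 * t - 2 * K * size (constraints t E).

Definition instance t E K : multigraph :=
  graph_of (graph_edges_proper (weight t E K) (2 ^ K) (constraints t E)).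

Definition ldist N (l : layout N.+1) (i j : nat) : nat :=
  dist (@adj _ l) (phi l (inord i)) (phi l (inord j)).

(** The strict inequality says that vertex [i] lies on the same side of the root as vertex [0],
    provided the layout is perfect. *)
Definition layout_colour N (l : layout N.+1) K (i : nat) : bool := ldist l 0 i < 2 * K.

Section Correctness.

Variables (t : nat) (E : seq (nat * nat)) (K : nat).
Let N := 2 ^ K.
Let B := 2 ^ (K - 2).
Let R := constraints t E.
Let W := weight t E K.
Hypotheses (K2 : 1 < K) (uniqE : uniq E) (tB : 3 * t <= B).
(** The bound [3 * t <= p.2] separates [E] from the pairs of the triangles, so no constraint is
    counted twice. *)
Hypothesis E_bounds : forall p : nat * nat, p \in E -> [/\ p.1 < p.2, p.2 < B & 3 * t <= p.2].

Lemma constraints_bounds p : p \in R -> (p.1 < p.2) && (p.2 < B).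
Proof.
rewrite mem_cat => /orP[/trianglesP[c Hc /triangle_bounds[h1 h2 h3]]|/E_bounds[-> ->//]].
by move: tB; lia.
Qed.

Lemma NB : N = 4 * B.
Proof. by rewrite /N /B -{1}(subnK K2) expnD mulnC. Qed.

Lemma constraints_uniq : uniq R.
Proof.
rewrite cat_uniq triangles_uniq uniqE andbT /=; apply/hasPn => p /E_bounds[_ _ h].
by case: p h => i j /= h; apply/negP => /trianglesP[c Hc /triangle_bounds[/= h1 h2 h3]]; lia.
Qed.

Lemma constraints_sub : {subset R <= pairs N}.
Proof. by case=> i j /constraints_bounds/andP[/= h1 h2]; rewrite pairsP NB /= h1; lia. Qed.

(** Adding the distances of the missing pairs back completes the sum over all pairs, which is a
    constant once the layout is perfect. *)
Lemma instance_length (l : layout N.+1) :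
  @layout_length (instance t E K) l + \sum_(p <- R) ldist l p.1 p.2 =
  W * (\sum_(x <- iota 0 N) ldist l N x) + \sum_(p <- pairs N) ldist l p.1 p.2.
Proof.
rewrite (sum_remove _ (pairs_uniq N) constraints_uniq constraints_sub).
rewrite addnA; congr addn; rewrite /layout_length big_map big_cat /= big_filter; congr addn.
rewrite big_flatten big_map big_distrr /=; apply: eq_bigr => x _.
by rewrite big_nseq iter_addn addn0 mulnC.
Qed.

Lemma weight_enough : 2 * K * size R <= W * (N * K.+1) + pair_sum K + 2 * t.
Proof.
have : 0 < N * K.+1 by rewrite muln_gt0 expn_gt0.
rewrite /W /weight -/R; nia.
Qed.

Lemma layout_btree (l : layout N.+1) : @tree_layout (instance t E K) l ->
  exists s : btree 'I_(nodes l),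
  [/\ perm_eq (map (fun i => phi l (inord i)) (iota 0 N)) (lv s), uniq (lv s),
      forall i, i < N -> ldist l N i = (depth s (phi l (inord i))).+1 &
      forall i j, i < N -> j < N ->
        ldist l i j = tdist s (phi l (inord i)) (phi l (inord j))].
Proof.
move=> [[symE irrE _ connE acyc] deg13 inj_phi img].
pose h := phi l (inord N).
have leafE w : (degree (@adj _ l) w == 1) = (w \in [set phi l v | v : 'I_N.+1]).
  by move: img => /= ->; rewrite inE.
have dh : degree (@adj _ l) h = 1.
  by apply/eqP; rewrite leafE; apply/imsetP; exists (inord N).
have [s [Us Ms Ds Ts]] := rooted_branch symE connE irrE acyc deg13 dh.
have ins i : i < N -> phi l (inord i) \in lv s.
  move=> Hi; rewrite Ms leafE imset_f //=.
  by apply/eqP => /inj_phi /(congr1 val); rewrite /= !inordK //; lia.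
exists s; split=> // [|i Hi|i j Hi Hj]; last 2 first.
- by rewrite -Ds ?ins.
- by rewrite -Ts ?ins.
apply: uniq_perm => //.
  rewrite map_inj_in_uniq ?iota_uniq // => i j; rewrite !mem_iota => Hi Hj.
  by move=> /inj_phi /(congr1 val); rewrite /= !inordK //; lia.
move=> w; apply/mapP/idP => [[i]|].
  by rewrite mem_iota => Hi ->; exact: ins.
rewrite Ms leafE => /andP[/imsetP[v _ ->] nh]; exists (val v); last by rewrite inord_val.
rewrite mem_iota /= add0n ltn_neqAle -ltnS ltn_ord andbT.
apply: contraNneq nh => Ev; apply/eqP; congr (phi l _).
by apply/val_inj; rewrite /= inordK.
Qed.

Lemma layout_valid (l : layout N.+1) : @tree_layout (instance t E K) l ->
  @layout_length (instance t E K) l <= threshold t E K ->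
  valid t E (layout_colour l K).
Proof.
move=> tl; have [s [permG Us Dh Dd]] := layout_btree tl.
rewrite /threshold -/W -/R -/N => Hlen; have Wok := weight_enough.
have Hlen' : @layout_length (instance t E K) l + 2 * K * size R
   <= W * (N * K.+1) + pair_sum K + 2 * t by lia.
have len := instance_length l.
have sumh : \sum_(x <- iota 0 N) ldist l N x = sum_depth s + N.
  rewrite big_seq (eq_bigr (fun x => depth s (phi l (inord x)) + 1)); last first.
    by move=> x; rewrite mem_iota => Hx; rewrite Dh // addn1.
  rewrite -big_seq big_split /= sum1_size size_iota (sum_label permG (depth s)).
  by rewrite sum_depthE.
have sz_s := size_label permG.
(* If the tree is not perfect, the hub edges exceed [W * (N * K.+1)] by at least [W], which is more
   than the slack [pair_sum K + 2 * t]. *)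
have perf : perfect K s.
  apply: sum_depth_perfect => //; rewrite leqNgt; apply/negP => Hgt.
  have : W * (N * K.+1 + 1) <= W * (sum_depth s + N).
    by rewrite leq_mul2l; apply/orP; right; rewrite -/N in Hgt; lia.
  rewrite -sumh mulnDr muln1.
  have le_sum : \sum_(p <- R) ldist l p.1 p.2 <= \sum_(p <- pairs N) ldist l p.1 p.2.
    rewrite (sum_remove _ (pairs_uniq N) constraints_uniq constraints_sub).
    exact: leq_addl.
  have eW : W = pair_sum K + 2 * t + 2 * K * size R + 1 by [].
  by move: (size R) eW len Hlen' => r eW; lia.
have ldE p : p \in pairs N -> ldist l p.1 p.2 =
    tdist s (phi l (inord p.1)) (phi l (inord p.2)).
  by rewrite pairsP => Hp; apply: Dd; lia.
have sumd : \sum_(p <- pairs N) ldist l p.1 p.2 = pair_sum K.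
  rewrite -(sum_pairs_perfect permG Us perf) big_seq [RHS]big_seq.
  by apply: eq_bigr => p /ldE.
have Hd : sum_depth s + N >= N * K.+1.
  by have := sum_depth_ge K s; rewrite sz_s -/N; lia.
have HW : W * (N * K.+1) <= W * (sum_depth s + N) by rewrite leq_mul2l Hd orbT.
(* The hub edges already use up their share of the threshold, so the missing pairs together fall
   short of the maximal distance by at most [2 * t]. *)
have sumR : 2 * K * size R <= \sum_(p <- R) ldist l p.1 p.2 + 2 * t.
  by rewrite sumh sumd in len; lia.
have [side Hside] := perfect_sides (ltnW K2) perf.
have ins i : i < N -> phi l (inord i) \in lv s by move=> Hi; exact: (label_in permG).
rewrite valid_count -/(constraints t E) -/R.
(* A monochromatic pair is not separated by the root and falls short of [2 * K] by at least [2].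
   With the previous bound this gives at most [t] monochromatic pairs. *)
have : \sum_(p <- R) ldist l p.1 p.2 + 2 * count (mono (layout_colour l K)) R
   <= 2 * K * size R.
  have -> : count (mono (layout_colour l K)) R =
      \sum_(p <- R) mono (layout_colour l K) p.
    by rewrite -sum1_count big_mkcond; apply: eq_bigr => p _; case: mono.
  rewrite -sum1_size !big_distrr /= -big_split /=.
  rewrite big_seq [X in _ <= X]big_seq; apply: leq_sum => p pR.
  have /ldE -> := constraints_sub pR.
  have /andP[h1 h2] := constraints_bounds pR; rewrite /mono /layout_colour.
  have N0 : 0 < N by rewrite expn_gt0.
  have := NB => eN.
  have [h3 h4 h5] : [/\ p.1 < N, p.2 < N & 0 < N] by split; lia.
  have [h6 _] := Hside _ _ (ins _ h3) (ins _ h4).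
  have [_ h7] := Hside _ _ (ins _ h5) (ins _ h3).
  have [_ h8] := Hside _ _ (ins _ h5) (ins _ h4).
  rewrite muln1; rewrite !Dd // h7 h8.
  apply: leq_trans h6; rewrite leq_add2l.
  by case: (side _); case: (side _); case: (side _).
move=> H; rewrite -(leq_pmul2l (isT : 0 < 2)) -(leq_add2l (\sum_(p <- R) ldist l p.1 p.2)).
exact: leq_trans H sumR.
Qed.

End Correctness.

(** * From colourings to short layouts *)

Fixpoint heap_btree (k u : nat) : btree nat :=
  if k is k'.+1 then Nd (heap_btree k' (2 * u)) (heap_btree k' (2 * u + 1)) else Lf u.

Lemma lv_heap_btree k u : lv (heap_btree k u) = iota (u * 2 ^ k) (2 ^ k).
Proof.
elim: k u => [|k IH] u /=; first by rewrite muln1.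
rewrite !IH expnS [2 * _ in RHS]mul2n -addnn iotaD; congr cat; congr iota; lia.
Qed.

Lemma heap_btree_perfect k u : perfect k (heap_btree k u).
Proof. by elim: k u => //= k IH u; rewrite !IH. Qed.

Section Heap.

Variable K : nat.
Let N := 2 ^ K.
(** The nodes are the numbers below [2 * N]: the hub [0], the top [1] of the heap, whose half is the
    hub, and the leaves from [N] on. The predecessor lets the node type have the form ['I_m.+1] that
    [inord] requires. *)
Let m := (2 * N).-1.

Let N_gt0 : 0 < N. Proof. by rewrite expn_gt0. Qed.
Let m2 : m.+1 = 2 * N. Proof. by rewrite /m; lia. Qed.

(** The nodes below [1] form a binary heap; the root [0] is the hub. *)
Definition heap_adj : rel 'I_m.+1 :=
  fun u v => (0 < u) && (u %/ 2 == v) || (0 < v) && (v %/ 2 == u).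

Lemma heap_sym : symmetric heap_adj.
Proof. by move=> u v; rewrite /heap_adj orbC. Qed.

Lemma heap_irr : irreflexive heap_adj.
Proof. by move=> u; rewrite /heap_adj orbb; apply/negbTE; lia. Qed.

Lemma heap_parent (u : 'I_m.+1) : 0 < u -> heap_adj u (inord (u %/ 2)).
Proof.
move=> u0; rewrite /heap_adj u0 inordK ?eqxx //.
by have := ltn_ord u; lia.
Qed.

Lemma heap_connect u v : connect heap_adj u v.
Proof.
have to0 w : connect heap_adj w ord0.
  have [n] := ubnP (w : nat); elim: n w => // n IH w le_n.
  have [/eqP w0|w0] := eqVneq (w : nat) 0.
    by rewrite (_ : w = ord0) ?connect0 //; apply/val_inj/eqP.
  rewrite -lt0n in w0; apply: connect_trans (connect1 (heap_parent w0)) _.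
  by apply: IH; rewrite /= inordK; have := ltn_ord w; lia.
apply: connect_trans (to0 u) _.
by rewrite (sym_connect_sym heap_sym).
Qed.

(** Both neighbours on the cycle of its largest node are smaller, hence both are its parent, whereas
    a cycle of length at least three does not repeat a node. *)
Lemma heap_acyclic c : ucycle heap_adj c -> size c <= 2.
Proof.
case: c => // x0 c0; set c := x0 :: c0 => Hc; rewrite leqNgt; apply/negP => Hs.
have [x xc xmax] : exists2 x, x \in c & forall y, y \in c -> (y : nat) <= x.
  exists [arg max_(i > x0 in c) val i].
    by case: arg_maxnP => //; rewrite mem_head.
  by case: arg_maxnP => [|i _ Hi y /Hi//]; rewrite mem_head.
have [i p Ep] := rot_to xc.
move: Hc; rewrite -(rot_ucycle i) Ep /ucycle => /andP[].
have : size (x :: p) > 2 by rewrite -Ep size_rot.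
have le_x y : y \in p -> y <= x by move=> yp; apply: xmax; rewrite -(mem_rot i) Ep inE yp orbT.
case: p {Ep} le_x => [|a p] //; case/lastP: p => [|p b] // le_x _.
rewrite /= rcons_path last_rcons => /andP[xa /andP[_ bx]] /and3P[xn an _].
have ax : a <= x by apply: le_x; rewrite mem_head.
have bx' : b <= x by apply: le_x; rewrite inE mem_rcons mem_head orbT.
have : a = b.
  apply/val_inj; move: xa bx; rewrite /heap_adj /=.
  have : val a != val x by apply: contraNneq xn => /val_inj ->; rewrite mem_head.
  have : val b != val x.
    by apply: contraNneq xn => /val_inj ->; rewrite !inE mem_rcons mem_head !orbT.
  move: ax bx'; rewrite /=; lia.
by move=> E; rewrite E mem_rcons mem_head in an.
Qed.

Lemma heap_tree : is_tree heap_adj.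
Proof.
split; [exact: heap_sym | exact: heap_irr | by rewrite card_ord | exact: heap_connect|].
exact: heap_acyclic.
Qed.

Lemma heap_degree (u : 'I_m.+1) :
  degree heap_adj u = if (0 < u) && (u < N) then 3 else 1.
Proof.
have lt_u := ltn_ord u; rewrite /degree.
case: ifP => [/andP[u0 uN]|Hu].
  have -> : [set v | heap_adj u v] =
     [set inord (u %/ 2); inord (2 * u); inord (2 * u + 1)].
    apply/setP => v; rewrite !inE -!val_eqE /= !inordK ?/heap_adj; [|lia..].
    by apply/idP/idP; lia.
  rewrite -setUA cardsU1 cards2 !inE -!val_eqE /= !inordK; [|lia..].
  by do 2 (rewrite [_ == _](_ : _ = false) ?/=; last by apply/negbTE; lia); apply/eqP; lia.
have [u0|u0] := posnP u.
  rewrite [X in #|pred_of_set X|](_ : _ = [set inord 1]) ?cards1 //.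
  apply/setP => v; rewrite !inE -val_eqE /= inordK ?/heap_adj; last by lia.
  by apply/idP/idP; lia.
rewrite [X in #|pred_of_set X|](_ : _ = [set inord (u %/ 2)]) ?cards1 //.
apply/setP => v; rewrite !inE -val_eqE /= inordK ?/heap_adj; last by lia.
by have lt_v := ltn_ord v; apply/idP/idP; lia.
Qed.

Let hd (u v : nat) := dist heap_adj (inord u) (inord v).

Lemma heap_child u v : 0 < v -> v < 2 * N -> v %/ 2 = u -> hd u v <= 1.
Proof.
move=> v0 vN Hu.
have E : heap_adj (inord u) (inord v).
  by rewrite /heap_adj !inordK ?v0 ?Hu ?eqxx ?orbT; lia.
by have := @dist_le _ heap_adj (inord u) [:: inord v]; rewrite /= E => /(_ isT).
Qed.

(** Upper bounds are the direction that a short layout asks for, and they follow from the triangle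
    inequality through [u] alone. *)
Lemma heap_dist k u : 0 < u -> u.+1 * 2 ^ k <= 2 * N ->
  (forall x, x \in lv (heap_btree k u) -> hd u x <= depth (heap_btree k u) x) /\
  (forall x y, x \in lv (heap_btree k u) -> y \in lv (heap_btree k u) ->
     hd x y <= tdist (heap_btree k u) x y).
Proof.
have hd0 x : hd x x = 0 by exact: dist_refl.
have tri x y z : hd x z <= hd x y + hd y z by apply: dist_triangle; exact: heap_connect.
have sym x y : hd x y = hd y x by apply: dist_sym; [exact: heap_sym | exact: heap_connect].
elim: k u => [|k IH] u u0 Hu /=.
  split=> [x|x y]; rewrite !inE; first by move=> /eqP ->; rewrite hd0.
  by move=> /eqP -> /eqP ->; rewrite hd0.
have gt0 := expn_gt0 2 k; rewrite expnS /= in Hu.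
have [Da Ta] : _ /\ _ := IH (2 * u) ltac:(lia) ltac:(nia).
have [Db Tb] : _ /\ _ := IH (2 * u + 1) ltac:(lia) ltac:(nia).
have ca : hd u (2 * u) <= 1 by apply: heap_child; [lia|nia|lia].
have cb : hd u (2 * u + 1) <= 1 by apply: heap_child; [lia|nia|lia].
set ta := heap_btree k (2 * u) in Da Ta *; set tb := heap_btree k (2 * u + 1) in Db Tb *.
have Da' x : x \in lv ta -> hd u x <= (depth ta x).+1.
  by move=> /Da H; have := tri u (2 * u) x; lia.
have Db' x : x \in lv tb -> hd u x <= (depth tb x).+1.
  by move=> /Db H; have := tri u (2 * u + 1) x; lia.
split=> [x|x y]; rewrite !mem_cat.
  by case: ifP => [/Da'//|_ /Db'].
case xa: (x \in lv ta); case ya: (y \in lv ta) => /= Hx Hy.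
- exact: Ta.
- by have := tri x u y; rewrite (sym x u); have := Da' _ xa; have := Db' _ Hy; lia.
- by have := tri x u y; rewrite (sym x u); have := Da' _ ya; have := Db' _ Hx; lia.
- exact: Tb.
Qed.

Section Layout.

Variable pos : nat -> nat.
Hypothesis perm_pos : perm_eq (map pos (iota 0 N)) (iota 0 N).

Lemma pos_lt i : i < N -> pos i < N.
Proof.
by move=> Hi; have := perm_mem perm_pos (pos i); rewrite map_f mem_iota //= => <-.
Qed.

Lemma pos_inj i j : i < N -> j < N -> pos i = pos j -> i = j.
Proof.
have Up : uniq (map pos (iota 0 N)) by rewrite (perm_uniq perm_pos) iota_uniq.
move=> Hi Hj E; apply/eqP; rewrite -(nth_uniq 0 _ _ Up) ?size_map ?size_iota //.
by rewrite !(nth_map 0) ?size_iota // !nth_iota // !add0n E.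
Qed.

Definition heap_phi (v : 'I_N.+1) : 'I_m.+1 :=
  if v == N :> nat then ord0 else inord (N + pos v).

Definition heap_layout : layout N.+1 := Layout heap_adj heap_phi.

Lemma heap_phiE i : i < N -> heap_phi (inord i) = inord (N + pos i).
Proof. by move=> Hi; rewrite /heap_phi inordK ?ltn_eqF //; lia. Qed.

Lemma heap_phi_hub : heap_phi (inord N) = ord0.
Proof. by rewrite /heap_phi inordK ?eqxx. Qed.

Lemma heap_tree_layout es (H : proper_edges N es) :
  @tree_layout (graph_of H) heap_layout.
Proof.
split.
- exact: heap_tree.
- by move=> u; rewrite /= heap_degree; case: ifP; [right|left].
- have sz i : i < N -> N + pos i < m.+1 by move/pos_lt; rewrite m2; lia.
  change (injective heap_phi) => u v; have lt_u : u < N.+1 := ltn_ord u; have lt_v : v <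
      N.+1 := ltn_ord v.
  rewrite /= /heap_phi.
  case: ((u : nat) =P N) => Hu; case: ((v : nat) =P N) => Hv; move=> E; apply/val_inj.
  + by rewrite /= Hu Hv.
  + move/(congr1 val): E; rewrite /= inordK => [E'|]; last by apply: sz; lia.
    by have := addn_gt0 N (pos v); rewrite -E' N_gt0.
  + move/(congr1 val): E; rewrite /= inordK => [E'|]; last by apply: sz; lia.
    by have := addn_gt0 N (pos u); rewrite E' N_gt0.
  + apply: (@pos_inj u v); [lia|lia|].
    by move/(congr1 val): E; rewrite /= !inordK; [lia | apply: sz; lia | apply: sz; lia].
change ([set heap_phi v | v : 'I_N.+1] = leaves heap_adj).
apply/setP => w; rewrite inE heap_degree; have lt_w := ltn_ord w.
apply/imsetP/idP => [[v _ ->]|].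
  case: ifP => //= /andP[]; rewrite /heap_phi; case: eqP => // Hv _.
  have lt_v : v < N.+1 := ltn_ord v.
  have pv : pos v < N by apply: pos_lt; lia.
  by rewrite inordK ?m2; lia.
have [w0 _|w0] := posnP w.
  by exists (inord N) => //; rewrite /= heap_phi_hub; exact/val_inj.
case: ltnP => //= Hw _.
have : w - N \in map pos (iota 0 N) by rewrite (perm_mem perm_pos) mem_iota; lia.
case/mapP => i; rewrite mem_iota => Hi Ei; exists (inord i) => //=.
by rewrite heap_phiE; last lia; apply/val_inj; rewrite /= inordK; lia.
Qed.

Lemma heap_ldist i j : i < N -> j < N ->
  ldist heap_layout i j <= tdist (heap_btree K 1) (N + pos i) (N + pos j).
Proof.
move=> Hi Hj; rewrite /ldist /= !heap_phiE //.
have [_ H] : _ /\ _ := @heap_dist K 1 isT ltac:(lia).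
by apply: H; rewrite lv_heap_btree mem_iota mul1n; have := pos_lt Hi; have := pos_lt Hj; lia.
Qed.

Lemma heap_ldist_hub i : i < N -> ldist heap_layout N i <= K.+1.
Proof.
move=> Hi; rewrite /ldist /= heap_phi_hub heap_phiE //.
have -> : ord0 = inord 0 :> 'I_m.+1 by apply/val_inj; rewrite /= inordK.
apply: leq_trans (dist_triangle heap_connect _ (inord 1) _) _.
apply: (@leq_add _ _ 1 K); first by apply: heap_child; lia.
have [H _] : _ /\ _ := @heap_dist K 1 isT ltac:(lia).
have Hp : N + pos i \in lv (heap_btree K 1).
  by rewrite lv_heap_btree mem_iota mul1n; have := pos_lt Hi; lia.
by apply: leq_trans (H _ Hp) _; rewrite (perfect_depth (heap_btree_perfect K 1)).
Qed.

End Layout.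
End Heap.

(** [quarter] splits each monochromatic pair of a triangle at the second level
    of the tree; the colour decides the first level. *)
Definition second (t : nat) (col : nat -> bool) (i : nat) : bool :=
  (i < 3 * t) &&
  ((i %% 3 == 1) && (col i.-1 == col i) ||
   (i %% 3 == 2) && ((col i.-1 == col i) || (col i.-2 == col i))).

Definition quarter t (col : nat -> bool) (i : nat) : nat := 2 * col i + second t col i.

(** Vertex [3 * c] has second bit [false]; each later vertex gets [true] if it repeats the colour of
    an earlier one. Two vertices with colour and second bit in common would both be repeats, which
    makes the triangle monochromatic. *)
Lemma quarter_triangle t col c p : c < t -> ~~ bad_triangle col c ->
  p \in triangle c -> quarter t col p.1 != quarter t col p.2.
Proof.
move=> ct; rewrite /bad_triangle /mono /=.
have e0 : second t col (3 * c) = false.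
  by rewrite /second; apply/negbTE; lia.
have e1 : second t col (3 * c + 1) = (col (3 * c) == col (3 * c + 1)).
  rewrite /second (_ : (3 * c + 1).-1 = 3 * c); last by lia.
  have -> : 3 * c + 1 < 3 * t by lia.
  have -> : (3 * c + 1) %% 3 = 1 by lia.
  by rewrite /= orbF.
have e2 : second t col (3 * c + 2) =
    (col (3 * c + 1) == col (3 * c + 2)) || (col (3 * c) == col (3 * c + 2)).
  rewrite /second (_ : (3 * c + 2).-1 = 3 * c + 1); last by lia.
  rewrite (_ : (3 * c + 1).-1 = 3 * c); last by lia.
  have -> : 3 * c + 2 < 3 * t by lia.
  by have -> : (3 * c + 2) %% 3 = 2 by lia.
rewrite !inE /quarter => Hbad /or3P[] /eqP -> /=; rewrite ?e0 ?e1 ?e2; move: Hbad;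
  by case: (col (3 * c)); case: (col (3 * c + 1)); case: (col (3 * c + 2)).
Qed.

Section Spread.

Variables (B : nat) (q : nat -> nat).

(** Column [i < B] consists of the vertices [i], [B + i], [2 * B + i] and
    [3 * B + i]; its rotation by [q i] moves [i] to the quarter [q i]. *)
Definition spread (i : nat) : nat := ((i %/ B + q (i %% B)) %% 4) * B + i %% B.

Lemma spread_small i : q i < 4 -> i < B -> spread i = q i * B + i.
Proof. by move=> q4 Hi; rewrite /spread divn_small // modn_small // add0n modn_small. Qed.

(** The column [i %% B] is preserved and its four members are rotated, so the map is injective; it
    sends a finite interval into itself and is therefore a permutation of it. *)
Lemma spread_perm : perm_eq (map spread (iota 0 (4 * B))) (iota 0 (4 * B)).
Proof.
have [->//|B0] := posnP B.
have div_lt i : i < 4 * B -> i %/ B < 4 by move=> Hi; rewrite ltn_divLR.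
have Us : uniq (map spread (iota 0 (4 * B))).
  rewrite map_inj_in_uniq ?iota_uniq // => i j; rewrite !mem_iota /= !add0n => Hi Hj E.
  have Em : i %% B = j %% B.
    have := congr1 (modn^~ B) E; rewrite /spread !modnMDl !modn_mod; exact.
  have Ed : (i %/ B + q (i %% B)) %% 4 = (j %/ B + q (i %% B)) %% 4.
    have := congr1 (divn^~ B) E; rewrite /spread /= !divnMDl // !(divn_small (ltn_pmod _ B0)).
    by rewrite !addn0 Em.
  rewrite (divn_eq i B) (divn_eq j B) Em; congr (_ * _ + _).
  move: (div_lt i Hi) (div_lt j Hj) Ed.
  by move: (i %/ B) (j %/ B) (q _) => a b c; lia.
apply: uniq_perm => //; first exact: iota_uniq.
have sub : {subset map spread (iota 0 (4 * B)) <= iota 0 (4 * B)}.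
  move=> x /mapP[i _ ->]; rewrite mem_iota /= add0n /spread.
  have := ltn_pmod i B0; set r := i %% B => Hr.
  have : (i %/ B + q r) %% 4 * B <= 3 * B by rewrite leq_mul2r -ltnS ltn_pmod ?orbT.
  by lia.
by have [] := uniq_min_size Us sub (eq_leq (esym (size_map _ _))).
Qed.

End Spread.

(** The number of the half is [a %/ 2]. Leaves in different halves meet at the top, at distance
    [2 * K]; different quarters of one half meet one level below, which costs exactly [2]. *)
Lemma heap_quarter_tdist K B (a b i j : nat) : 1 < K -> B = 2 ^ (K - 2) ->
  a < 4 -> b < 4 -> i < B -> j < B -> a != b ->
  2 * K <= tdist (heap_btree K 1) (2 ^ K + (a * B + i)) (2 ^ K + (b * B + j)) +
     2 * (a %/ 2 == b %/ 2).
Proof.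
case: K => // -[|k] // _; rewrite subSS subn1 /= => EB Ha Hb Hi Hj nab.
have E2 : 2 ^ k.+2 = 4 * B by rewrite EB !expnS mulnA.
have E1 : 2 ^ k.+1 = 2 * B by rewrite EB expnS.
(* Quarter [c] of the leaves is the subtree at heap node [4 + c], two levels below the top [1]. *)
have inT (c d r : nat) : c < 4 -> d < 4 -> r < B ->
    ((4 * B + (d * B + r))%N \in lv (heap_btree k (4 + c))) = (d == c).
  move=> Hc Hd Hr; rewrite lv_heap_btree mem_iota -EB.
  by case: c Hc => [|[|[|[|]]]] // _; case: d Hd => [|[|[|[|]]]] // _; apply/idP/idP; lia.
have dT u x : x \in lv (heap_btree k u) -> depth (heap_btree k u) x = k.
  exact: (perfect_depth (heap_btree_perfect k u)).
rewrite E2 /= -[2 * (2 * 1)]/(4 + 0) -[4 + 0 + 1]/(4 + 1).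
rewrite -[2 * (2 * 1 + 1)]/(4 + 2) -[4 + 2 + 1]/(4 + 3) !mem_cat !inT //.
have dE (c r d : nat) : c < 4 -> r < B -> d == c ->
    depth (heap_btree k (4 + d)) (4 * B + (c * B + r)) = k.
  by move=> Hc Hr /eqP ->; apply: dT; rewrite inT.
case: a Ha nab => [|[|[|[|]]]] // _; case: b Hb => [|[|[|[|]]]] // _ _ /=;
  by rewrite !dE //; lia.
Qed.

Section Colouring.

Variables (t : nat) (E : seq (nat * nat)) (K : nat) (col : nat -> bool).
Let N := 2 ^ K.
Let B := 2 ^ (K - 2).
Hypotheses (K2 : 1 < K) (uniqE : uniq E) (tB : 3 * t <= B).
Hypothesis E_bounds : forall p : nat * nat, p \in E -> [/\ p.1 < p.2, p.2 < B & 3 * t <= p.2].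
Hypothesis col_valid : valid t E col.

Definition colour_layout : layout N.+1 :=
  heap_layout K (spread B (quarter t col)).

Lemma quarter4 i : quarter t col i < 4.
Proof. by rewrite /quarter; case: (col i); case: (second t col i). Qed.

Lemma spread_perm_N : perm_eq (map (spread B (quarter t col)) (iota 0 N)) (iota 0 N).
Proof. by rewrite /N (NB K2); exact: spread_perm. Qed.

Lemma colour_layout_tree : @tree_layout (instance t E K) colour_layout.
Proof. exact/heap_tree_layout/spread_perm_N. Qed.

Lemma quarter_half i : quarter t col i %/ 2 = col i.
Proof. by rewrite /quarter; case: (col i); case: (second t col i). Qed.

Lemma quarter_constraint p : p \in constraints t E ->
  quarter t col p.1 != quarter t col p.2.
Proof.
move/andP: col_valid => [/allP Ht /allP HE].
rewrite mem_cat => /orP[/trianglesP[c ct pc]|pE].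
  by apply: quarter_triangle pc => //; apply: Ht; rewrite mem_iota.
have := HE p pE; rewrite /mono; apply: contraNneq => Eq.
have := congr1 (divn^~ 2) Eq; rewrite /= !quarter_half.
by case: (col p.1); case: (col p.2).
Qed.

Lemma colour_layout_length :
  @layout_length (instance t E K) colour_layout <= threshold t E K.
Proof.
pose R := constraints t E; pose W := weight t E K; pose l := colour_layout.
have Rb p : p \in R -> (p.1 < p.2) && (p.2 < B).
  exact: (constraints_bounds K2 uniqE tB E_bounds).
have UR : uniq R by exact: (constraints_uniq K2 uniqE tB E_bounds).
have subR : {subset R <= pairs N} by exact: (constraints_sub K2 uniqE tB E_bounds).
pose pos i := N + spread B (quarter t col) i.
pose d i j := tdist (heap_btree K 1) (pos i) (pos j).
have eN : N = 4 * B by exact: NB.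
have len : layout_length (l : layout (nverts (instance t E K))) =
  W * (\sum_(x <- iota 0 N) ldist l N x) +
    \sum_(p <- pairs N | p \notin R) ldist l p.1 p.2.
  have := instance_length K2 uniqE tB E_bounds l.
  rewrite (sum_remove _ (pairs_uniq N) UR subR) addnA.
  by move=> /eqP; rewrite eqn_add2r => /eqP.
have hubs : \sum_(x <- iota 0 N) ldist l N x <= N * K.+1.
  apply: (@leq_trans (\sum_(x <- iota 0 N) K.+1)); last first.
    by rewrite big_const_seq count_predT size_iota iter_addn addn0 mulnC.
  rewrite big_seq [X in _ <= X]big_seq; apply: leq_sum => x; rewrite mem_iota => Hx.
  by apply: (heap_ldist_hub spread_perm_N).
have others : \sum_(p <- pairs N | p \notin R) ldist l p.1 p.2 <=
    \sum_(p <- pairs N | p \notin R) d p.1 p.2.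
  rewrite big_seq_cond [X in _ <= X]big_seq_cond; apply: leq_sum => -[i j] /andP[].
  by rewrite pairsP /= => Hp _; apply: (heap_ldist spread_perm_N); lia.
(* Graph distances are only bounded above by [d]. The constraint pairs are therefore subtracted from
   the sum of [d], whose total is known exactly, and bounded below there. *)
have sumd : \sum_(p <- pairs N) d p.1 p.2 = pair_sum K.
  apply: sum_pairs_perfect (heap_btree_perfect K 1); rewrite lv_heap_btree mul1n ?iota_uniq //.
  have -> : iota (2 ^ K) (2 ^ K) = map (addn N) (iota 0 N) by rewrite -iotaDl addn0.
  by rewrite (map_comp (addn N) (spread B (quarter t col))) perm_map // spread_perm_N.
rewrite (sum_remove _ (pairs_uniq N) UR subR) in sumd.
have cnt : count (mono col) R <= t by rewrite -valid_count.
have low : 2 * K * size R <= \sum_(p <- R) d p.1 p.2 + 2 * count (mono col) R.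
  have -> : count (mono col) R = \sum_(p <- R) mono col p.
    by rewrite -sum1_count big_mkcond; apply: eq_bigr => p _; case: mono.
  rewrite -sum1_size !big_distrr /= -big_split /=.
  rewrite big_seq [X in _ <= X]big_seq; apply: leq_sum => p pR; rewrite muln1.
  have /andP[h1 h2] := Rb p pR; have h3 := ltn_trans h1 h2.
  rewrite /d /pos !spread_small ?quarter4 //.
  have := heap_quarter_tdist K2 (erefl B) (quarter4 p.1) (quarter4 p.2) h3 h2
      (quarter_constraint pR).
  by rewrite !quarter_half /mono; case: (col p.1); case: (col p.2).
have HW : W * \sum_(x <- iota 0 N) ldist l N x <= W * (N * K.+1) by rewrite leq_mul2l hubs
    orbT.
rewrite /threshold -/R -/W -/N.
have step1 : layout_length (l : layout (nverts (instance t E K))) + 2 * K * size R <=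
   W * (N * K.+1) + pair_sum K + 2 * t.
  rewrite len; move: HW others sumd cnt low.
  move: (\sum_(p <- pairs N | _) ldist _ _ _) => a.
  move: (\sum_(p <- pairs N | _) d _ _) => b.
  move: (\sum_(p <- R) d _ _) => c.
  move: (W * \sum_(x <- _) _) (W * (N * K.+1)) (2 * K * size R) (count _ _) => e f g h.
  by lia.
by move: step1; rewrite -/l; lia.
Qed.

End Colouring.

(** * The Cook-Levin tableau *)

(** Injective because [a] is smaller than the gap between the squares of [a + b] and its successor,
    and polynomial, so that names of variables stay short in unary. The inverse by exhaustive search
    only occurs in assignments. *)
Definition pairing (a b : nat) : nat := (a + b) * (a + b) + a.

Definition unpairing (n : nat) : nat * nat :=
  head (0, 0) [seq p <- [seq (a, b) | a <- iota 0 n.+1, b <- iota 0 n.+1]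
              | pairing p.1 p.2 == n].

Lemma pairing_inj a b a' b' : pairing a b = pairing a' b' -> a = a' /\ b = b'.
Proof.
rewrite /pairing => E; suff : a + b = a' + b' by move=> E'; rewrite E' in E; lia.
have [lt|lt|//] := ltngtP (a + b) (a' + b'); exfalso.
  have : (a + b).+1 * (a + b).+1 <= (a' + b') * (a' + b') by rewrite leq_mul.
  lia.
have : (a' + b').+1 * (a' + b').+1 <= (a + b) * (a + b) by rewrite leq_mul.
lia.
Qed.

Lemma pairingK a b : unpairing (pairing a b) = (a, b).
Proof.
rewrite /unpairing; set n := pairing a b; set s := filter _ _.
have : (a, b) \in s.
  rewrite mem_filter eqxx; apply/allpairsPdep; exists a, b; split=> //;
  rewrite mem_iota add0n ltnS /n /pairing; first exact: leq_addl.
  apply: leq_trans (leq_addr _ _); case: (a + b) (leq_addl a b) => // m H.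
  by apply: leq_trans H _; rewrite leq_pmulr.
have : all (fun p => pairing p.1 p.2 == n) s by exact: filter_all.
by case: s => [//|[a' b'] s] /= /andP[/eqP/pairing_inj[-> ->] _] _.
Qed.

Definition lit : Type := bool * nat.

Definition lit_true (v : nat -> bool) (l : lit) : bool := v l.2 == l.1.

Definition sat (v : nat -> bool) (F : seq (seq lit)) : bool :=
  all (has (lit_true v)) F.

Definition implication (ps : seq nat) (x : nat) : seq lit :=
  rcons [seq (false, p) | p <- ps] (true, x).

Lemma implicationP v ps x :
  has (lit_true v) (implication ps x) = (all v ps ==> v x).
Proof.
rewrite /implication has_rcons has_map implybE -has_predC orbC {2}/lit_true /=.
by congr orb; [apply: eq_has => p; rewrite /lit_true /=; case: (v p) | case: (v x)].
Qed.

Lemma shift_target o n : 0 < o -> n <= 2 -> o + (2 - n) = (o.+1 - n).+1.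
Proof. by lia. Qed.

Section Tableau.

Variables (M : machine) (T O' : nat) (u : seq bool) (g : nat).
Let k := (extra M).+1.
Let O := O'.+1.

Definition state_rank (q : state M) : nat := enum_rank q.
Definition cell_rank (c : cell (aux M)) : nat := enum_rank c.
Definition bit_rank (b : bool) : nat := cell_rank (Some (inl b)).
Definition blank_rank : nat := cell_rank None.

(** [var t i y s]: at time [t] the cell [y] of tape [i] holds the symbol [s],
    where cells are numbered relatively to the head, which is at [O]; the state
    is treated as the scanned symbol of an additional tape. *)
Definition var (t i y s : nat) : nat := pairing t (pairing i (pairing y s)).

Definition content (tp : tape (aux M)) (y : nat) : cell (aux M) :=
  if y < O then nth None (before tp) (O - y.+1) else nth None (after tp) (y - O).

(** One more than the displacement of the head, so that it is a natural number: cell [y.+1] after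
    the move was cell [y + shift m] before. *)
Definition shift (m : move) : nat := match m with Lft => 0 | Stay => 1 | Rgt => 2 end.

Lemma content_act c m (tp : tape (aux M)) y :
  content (act (c, m) tp) y.+1 =
  if y + shift m == O then c else content tp (y + shift m).
Proof.
case: tp => b a; rewrite /content /O; case: m => /=.
- rewrite addn0; have [lt|gt|->] := ltngtP y O'.+1.
  + rewrite (_ : (y.+1 < O'.+1) = (y < O')) //; case: ltnP => h.
      by rewrite nth_behead; congr nth; lia.
    have -> : y = O' by lia.
    by rewrite subnn -nth0.
  + rewrite (_ : (y.+1 < O'.+1) = false); last by lia.
    rewrite (_ : y.+1 - O'.+1 = (y - O'.+1).-1.+2) /=; last by lia.
    by rewrite nth_behead; congr nth; lia.
  + by rewrite ltnNge leqnSn /= subSnn.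
- rewrite addn1; have [lt|gt|->] := ltngtP y.+1 O'.+1 => //.
    rewrite (_ : y.+1 - O'.+1 = (y - O'.+1).+1) /=; last by lia.
    by rewrite nth_behead.
  by rewrite subnn.
- rewrite addn2; have [lt|gt|E] := ltngtP y.+2 O'.+1.
  + by rewrite (_ : O'.+1 - y.+2 = (O'.+1 - y.+3).+1) //; lia.
  + by rewrite nth_behead; congr nth; lia.
  + by rewrite -E subnn.
Qed.

Lemma scanned_content (tp : tape (aux M)) : scanned tp = content tp O.
Proof. by rewrite /content ltnn subnn nth0. Qed.

Definition view : finType := (state M * {ffun 'I_k -> cell (aux M)})%type.

Definition next (r : view) : state M * {ffun 'I_k -> cell (aux M) * move} :=
  if final r.1 then (r.1, [ffun i => (r.2 i, Stay)]) else trans r.1 r.2.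

Definition view_of (c : config M) : view := (c.1, [ffun i => scanned (c.2 i)]).

Lemma step_state (c : config M) : (step c).1 = (next (view_of c)).1.
Proof. by case: c => q ts; rewrite /step /next /=; case: ifP => //; case: trans. Qed.

Lemma step_content (c : config M) i y :
  content ((step c).2 i) y.+1 =
  let a := (next (view_of c)).2 i in
  if y + shift a.2 == O then a.1 else content (c.2 i) (y + shift a.2).
Proof.
case: c => q ts; rewrite /step /next /=; case: ifP => _ /=.
  rewrite ffunE /= addn1; case: eqP => // ->.
  by rewrite ffunE scanned_content.
case: trans => q' a /=; case: (a i) => c m; exact: content_act.
Qed.

Definition premises (r : view) : seq (nat * nat) :=
  (k, state_rank r.1) :: [seq (val i, cell_rank (r.2 i)) | i <- enum 'I_k].

(** Positions are offsets from [O'], one before the head: offset [1] is the head itself, where the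
    state is kept, and the freshly written cell ends up at offset [2 - shift]. *)
Definition write_table : seq (seq (nat * nat) * (nat * nat * nat)) :=
  flatten [seq (premises r, (k, 1, state_rank (next r).1)) ::
    [seq (premises r, (val i, 2 - shift ((next r).2 i).2, cell_rank ((next r).2 i).1))
      | i <- enum 'I_k] | r <- enum view].

Definition copy_table : seq (seq (nat * nat) * (nat * nat * nat)) :=
  flatten [seq flatten [seq [seq
     (premises r, (val i, shift ((next r).2 i).2, cell_rank s))
      | s <- enum (cell (aux M))] | i <- enum 'I_k] | r <- enum view].

Definition at_head (t : nat) (ps : seq (nat * nat)) : seq nat :=
  [seq var t p.1 O p.2 | p <- ps].

Definition write_clauses : seq (seq lit) :=
  flatten [seq [seq implication (at_head t r.1) (var t.+1 r.2.1.1 (O' + r.2.1.2) r.2.2)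
    | r <- write_table] | t <- iota 0 T].

Definition copy_clauses : seq (seq lit) :=
  flatten [seq flatten [seq [seq
     implication (var t r.2.1.1 (y + r.2.1.2) r.2.2 :: at_head t r.1)
       (var t.+1 r.2.1.1 y.+1 r.2.2)
    | r <- [seq r <- copy_table | y + r.2.1.2 != O]] | y <- iota 0 (2 * O)]
    | t <- iota 0 T].

(** The [g] cells after the fixed part [u] are free for a certificate, which may be shorter; hence
    the blank among the choices, which [init_clauses] then propagates to the right. *)
Definition options (y : nat) : seq nat :=
  if y < O then [:: blank_rank]
  else if y < O + size u then [:: if nth false u (y - O) then bit_rank true else bit_rank
      false]
  else if y < O + size u + g then [:: bit_rank true; bit_rank false; blank_rank]
  else [:: blank_rank].

Definition init_clauses : seq (seq lit) :=
  [:: (true, var 0 k O (state_rank (start M)))] ::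
  flatten [seq [seq [:: (true, var 0 i y blank_rank)] | y <- iota 0 (2 * O).+1]
          | i <- iota 1 (extra M)] ++
  [seq [seq (true, var 0 0 y s) | s <- options y] | y <- iota 0 (2 * O).+1] ++
  [seq implication [:: var 0 0 y blank_rank] (var 0 0 y.+1 blank_rank)
  | y <- iota (O + size u) g].

Definition accept_clauses : seq (seq lit) :=
  [seq [:: (false, var T 0 O s)]
  | s <- [seq cell_rank c | c <- enum (cell (aux M)) & c != Some (inl true)]] ++
  [seq [:: (false, var T 0 O.+1 s)] | s <- [:: bit_rank true; bit_rank false]].

(** No clause forbids several symbols in one cell. The implications force the variables that
    describe the actual run to be true, and the negative clauses at the end refute a run with a
    wrong outcome. *)
Definition tableau : seq (seq lit) :=
  init_clauses ++ write_clauses ++ copy_clauses ++ accept_clauses.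

Definition accepts (c : config M) : bool :=
  (content (c.2 ord0) O == Some (inl true)) &&
  (content (c.2 ord0) O.+1 \notin [:: Some (inl true); Some (inl false)]).

Lemma rank_inj : injective cell_rank.
Proof. by move=> x y /val_inj/enum_rank_inj. Qed.

Lemma state_rank_inj : injective state_rank.
Proof. by move=> x y /val_inj/enum_rank_inj. Qed.

(** Within [T] steps the head must stay inside the window of radius [O], and the longest input must
    fit into its right half. *)
Hypotheses (T_le : T < O') (ug_le : size u + g <= O).

Section Run.

Variable x : seq bool.
Let run t := iter t (@step M) (init M x).

Definition symbol (t i y : nat) : nat :=
  if i == k then state_rank (run t).1 else cell_rank (content ((run t).2 (inord i)) y).

Definition premises_hold t (r : view) :
  all (fun p => symbol t p.1 O == p.2) (premises r) = (view_of (run t) == r).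
Proof.
rewrite /= {1}/symbol eqxx; case: r => q a; rewrite xpair_eqE /=; congr andb.
  by apply/eqP/eqP => [/state_rank_inj|->].
apply/allP/eqP => [H|<- p /mapP[i _ ->]].
  apply/ffunP => i; rewrite ffunE scanned_content; apply: rank_inj.
  have /H : (val i, cell_rank (a i)) \in [seq (val i, cell_rank (a i)) | i <- enum 'I_k].
    by apply/mapP; exists i; rewrite ?mem_enum.
  by rewrite /symbol /= (ltn_eqF (ltn_ord i)) inord_val => /eqP.
by rewrite /symbol /= (ltn_eqF (ltn_ord i)) inord_val ffunE scanned_content.
Qed.

Lemma write_table_sound t r : r \in write_table ->
  all (fun p => symbol t p.1 O == p.2) r.1 ->
  symbol t.+1 r.2.1.1 (O' + r.2.1.2) = r.2.2.
Proof.
case/flatten_mapP => w _; rewrite inE => /orP[/eqP ->|/mapP[i _ ->]];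
  (move=> Hp; have /eqP Ew : view_of (run t) == w by rewrite -premises_hold; exact: Hp);
      rewrite /= /symbol /=.
  by rewrite eqxx step_state Ew.
rewrite (ltn_eqF (ltn_ord i)) inord_val.
set a := (next w).2 i; have sh : shift a.2 <= 2 by case: (a.2).
rewrite shift_target ?(leq_ltn_trans _ T_le) //.
rewrite step_content Ew -/a /= subnK ?eqxx //.
by apply: leq_trans sh _; rewrite ltnS (leq_ltn_trans _ T_le).
Qed.

Lemma copy_table_sound t r y : r \in copy_table ->
  all (fun p => symbol t p.1 O == p.2) r.1 -> y + r.2.1.2 != O ->
  symbol t r.2.1.1 (y + r.2.1.2) = r.2.2 -> symbol t.+1 r.2.1.1 y.+1 = r.2.2.
Proof.
case/flatten_mapP => w _ /flatten_mapP[i _ /mapP[s _ ->]] Hp.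
have /eqP Ew : view_of (run t) == w by rewrite -premises_hold; exact: Hp.
rewrite /= /symbol /= !(ltn_eqF (ltn_ord i)) inord_val => yO.
by rewrite step_content Ew /= (negbTE yO).
Qed.

Lemma content_init i y : i < k ->
  cell_rank (content ((run 0).2 (inord i)) y) =
  if (i == 0) && (O <= y) && (y < O + size x) then bit_rank (nth false x (y - O))
  else blank_rank.
Proof.
move=> ik; rewrite /run /= /content /=.
have -> : ((inord i : 'I_k) == ord0) = (i == 0) by rewrite -val_eqE /= inordK.
case: ltnP => [lt|ge]; first by rewrite andbF nth_nil.
case: eqP => [_|_]; last by rewrite nth_nil.
case: ltnP => h /=; first by rewrite (nth_map false) //; lia.
by rewrite nth_default // size_map; lia.
Qed.

Lemma accepts_output t : accepts (run t) = (output (run t) == [:: true]).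
Proof.
rewrite /accepts /output /content ltnn ltnNge leqnSn /= subnn subSnn.
move: (after _) => s; rewrite -[seq _]/(seq (option (bool + aux M))) in s *.
by case: s => [|[[[]|a]|] [|[[[]|b]|] s]].
Qed.

Lemma symbol0 i y : i < k -> symbol 0 i y =
  if (i == 0) && (O <= y) && (y < O + size x) then bit_rank (nth false x (y - O))
  else blank_rank.
Proof. by move=> ik; rewrite /symbol ltn_eqF // content_init. Qed.

Lemma bit_neq_blank b : (bit_rank b == blank_rank) = false.
Proof. by apply/eqP => /rank_inj. Qed.

Definition run_values (n : nat) : bool :=
  let p := unpairing n in let q := unpairing p.2 in let r := unpairing q.2 in
  symbol p.1 q.1 r.1 == r.2.

Lemma run_valuesE t i y s : run_values (var t i y s) = (symbol t i y == s).
Proof. by rewrite /run_values /var !pairingK. Qed.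

Lemma run_premises t ps : all run_values (at_head t ps) =
  all (fun p => symbol t p.1 O == p.2) ps.
Proof. by rewrite all_map; apply: eq_all => p; rewrite /= run_valuesE. Qed.

Lemma tableau_complete c : x = u ++ c -> size c <= g -> accepts (run T) ->
  sat run_values tableau.
Proof.
move=> Ex size_c /andP[acc1 acc2]; rewrite /sat /tableau !all_cat.
apply/and4P; split.
- rewrite /init_clauses -cat1s !all_cat; apply/and4P; split.
  + by rewrite /= /lit_true /= run_valuesE /symbol !eqxx.
  + apply/allP => _ /flatten_mapP[i + /mapP[y _ ->]]; rewrite mem_iota => Hi.
    rewrite /= /lit_true /= run_valuesE symbol0 /k; last by lia.
    have -> : (i == 0) = false by apply/negbTE; lia.
    by rewrite /= eqxx.
  + apply/allP => _ /mapP[y _ ->]; rewrite has_map /options.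
    rewrite (eq_has (a2 := fun s => symbol 0 0 y == s)); last first.
      by move=> s; rewrite /= /lit_true /= run_valuesE eqb_id.
    rewrite symbol0 //= Ex size_cat nth_cat.
    case: (ltnP y O) => [lt|ge] /=; first by rewrite eqxx.
    case: (ltnP y (O + size u)) => [lt|ge2] /=.
      have -> : y < O + (size u + size c) by lia.
      have -> : y - O < size u by lia.
      by case: nth; rewrite eqxx.
    case: (ltnP y (O + size u + g)) => [lt|ge3] /=.
      case: ifP => _; last by rewrite eqxx !orbT.
      by case: ifP => _; case: nth; rewrite eqxx ?orbT.
    have -> : (y < O + (size u + size c)) = false by apply/negbTE; lia.
    by rewrite eqxx.
  + apply/allP => _ /mapP[y + ->]; rewrite mem_iota => Hy.
    rewrite implicationP /= andbT !run_valuesE !symbol0 //= Ex size_cat.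
    have -> : O <= y by lia.
    have -> : O <= y.+1 by lia.
    case: (ltnP y (O + (size u + size c))) => [lt|ge] /=; first by rewrite bit_neq_blank.
    have -> : (y.+1 < O + (size u + size c)) = false by apply/negbTE; lia.
    by rewrite !eqxx.
- apply/allP => _ /flatten_mapP[t _ /mapP[r Hr ->]].
  rewrite implicationP run_premises run_valuesE; apply/implyP => Hp.
  by rewrite (write_table_sound Hr Hp).
- apply/allP => _ /flatten_mapP[t _ /flatten_mapP[y _ /mapP[r + ->]]].
  rewrite mem_filter => /andP[yO Hr]; rewrite implicationP /= run_premises !run_valuesE.
  apply/implyP => /andP[/eqP Hs Hp].
  by rewrite (copy_table_sound Hr Hp yO Hs).
have sym0 y : symbol T 0 y = cell_rank (content ((run T).2 ord0) y).
  by rewrite /symbol /k /=; congr (cell_rank (content (_ _) _)); apply/val_inj; rewrite /=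
      inordK.
rewrite !all_map; apply/andP; split.
  apply/allP => d; rewrite mem_filter => /andP[dt _].
  rewrite /= /lit_true /= run_valuesE sym0 orbF eqbF_neg; apply: contra dt.
  by move=> /eqP/rank_inj <-.
apply/allP => s; rewrite !inE => Hs; rewrite /= /lit_true /= run_valuesE sym0 orbF eqbF_neg.
apply: contra acc2 => /eqP E; rewrite !inE.
by case/orP: Hs => /eqP Es; rewrite Es in E; move/rank_inj: E => ->.
Qed.

End Run.

Section Sound.

Variable v : nat -> bool.
Hypothesis v_sat : sat v tableau.

(** The first free cell whose blank variable holds, or [g] if there is none. *)
Definition guess_end : nat :=
  find (fun j => v (var 0 0 (O + size u + j) blank_rank)) (iota 0 g).

Definition guess : seq bool :=
  [seq v (var 0 0 (O + size u + j) (bit_rank true)) | j <- iota 0 guess_end].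

Lemma guess_end_le : guess_end <= g.
Proof. by apply: leq_trans (find_size _ _) _; rewrite size_iota. Qed.

Let x := u ++ guess.
Let run t := iter t (@step M) (init M x).

Lemma sat_init c : c \in init_clauses -> has (lit_true v) c.
Proof. by move=> Hc; apply: (allP v_sat); rewrite mem_cat Hc. Qed.

Lemma sat_option y : y <= 2 * O ->
  exists2 s, s \in options y & v (var 0 0 y s).
Proof.
move=> Hy; have : has (lit_true v) [seq (true, var 0 0 y s) | s <- options y].
  apply: sat_init; rewrite inE !mem_cat; apply/orP; right; apply/orP; right.
  by apply/orP; left; apply/mapP; exists y; rewrite // mem_iota.
by case/hasP => _ /mapP[s Hs ->] /eqP Ev; exists s.
Qed.

Lemma blank_step y : O + size u <= y -> y < O + size u + g ->
  v (var 0 0 y blank_rank) -> v (var 0 0 y.+1 blank_rank).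
Proof.
move=> H1 H2; have : has (lit_true v)
    (implication [:: var 0 0 y blank_rank] (var 0 0 y.+1 blank_rank)).
  apply: sat_init; rewrite inE !mem_cat; apply/orP; right; apply/orP; right.
  by apply/orP; right; apply/mapP; exists y; rewrite // mem_iota H1.
by rewrite implicationP /= andbT => /implyP.
Qed.

Lemma guess_blank j : guess_end <= j -> j < g ->
  v (var 0 0 (O + size u + j) blank_rank).
Proof.
move=> H1 H2; have lt : guess_end < g by apply: leq_ltn_trans H2.
have base : v (var 0 0 (O + size u + guess_end) blank_rank).
  have := @nth_find _ 0 (fun j => v (var 0 0 (O + size u + j) blank_rank)) (iota 0 g).
  rewrite -/guess_end nth_iota // add0n; apply.
  by rewrite has_find size_iota.
elim: j H1 H2 => [|j IH] H1 H2; first by move: H1 base; rewrite leqn0 => /eqP ->.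
have [le|gt] := leqP guess_end j; last first.
  by rewrite (_ : j.+1 = guess_end) //; lia.
by rewrite addnS; apply: blank_step; [lia|lia|apply: IH; lia].
Qed.

Lemma values_init y : y <= 2 * O -> v (var 0 0 y (symbol x 0 0 y)).
Proof.
move=> Hy; rewrite symbol0 //= size_cat size_map size_iota nth_cat.
have le_g := guess_end_le; have [s + Hs] := sat_option Hy; rewrite /options.
case: (ltnP y O) => [_|ge] /=; first by rewrite inE => /eqP <-.
case: (ltnP y (O + size u)) => [lt|ge2] /=.
  have -> : y < O + (size u + guess_end) by lia.
  have -> : y - O < size u by lia.
  by rewrite inE => /eqP; case: nth => <-.
have -> : y - O < size u = false by apply/negbTE; lia.
have Ey : O + size u + (y - O - size u) = y by lia.
case: (ltnP y (O + (size u + guess_end))) => [lt|ge3].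
  have -> : y < O + size u + g by lia.
  have lt_j : y - O - size u < guess_end by lia.
  rewrite /guess (nth_map 0) ?size_iota // nth_iota // add0n Ey.
  have := before_find 0 lt_j; rewrite nth_iota ?add0n ?Ey; last by lia.
  (* Before [guess_end] the blank is excluded; if the variable for [true] fails as well, the clause
     of this cell leaves only [false], as [guess] does. *)
  move=> nb; rewrite !inE; case vT: (v (var 0 0 y (bit_rank true))) => //.
  by case/or3P => /eqP Es; rewrite Es ?vT ?nb // in Hs *.
case: (ltnP y (O + size u + g)) => [lt _|ge4]; last by rewrite inE => /eqP <-.
by rewrite -Ey; apply: guess_blank; lia.
Qed.

(** A cell depends on cells at most one position away from its own index, so the part of the window
    under control shrinks by one at both ends in each step. *)
Lemma values_run t : t <= T ->
  v (var t k O (symbol x t k O)) /\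
  forall i y, i < k -> t <= y -> y + t <= 2 * O -> v (var t i y (symbol x t i y)).
Proof.
elim: t => [_|t IH ltT].
  split=> [|i y ik _]; rewrite ?addn0.
    have /sat_init : [:: (true, var 0 k O (state_rank (start M)))] \in init_clauses by
        rewrite inE eqxx.
    by rewrite /= orbF /lit_true /= /symbol eqxx => /eqP.
  move=> Hy; have [->|i0] := posnP i; first exact: values_init.
  have /sat_init : [:: (true, var 0 i y blank_rank)] \in init_clauses.
    rewrite inE !mem_cat; apply/orP; right; apply/orP; left.
    apply/flatten_mapP; exists i; first by rewrite mem_iota; move: ik; rewrite /k; lia.
    by apply/mapP; exists y; rewrite // mem_iota.
  by rewrite /= orbF /lit_true /= symbol0 // eqn0Ngt i0 => /eqP.
have [Hst Hcell] := IH (ltnW ltT).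
pose r := view_of (run t).
have Hprem : all v (at_head t (premises r)).
  have /allP H : all (fun p => symbol x t p.1 O == p.2) (premises r).
    by rewrite premises_hold.
  rewrite all_map; apply/allP => p Hp /=; have /eqP <- := H p Hp.
  move: Hp; rewrite inE => /orP[/eqP ->|/mapP[i _ ->]] //=.
  have tO : t <= O := leqW (ltnW (ltn_trans ltT T_le)).
  by apply: Hcell => //; rewrite mul2n -addnn leq_add2l.
have Hwrite p : p \in write_table -> p.1 = premises r ->
    v (var t.+1 p.2.1.1 (O' + p.2.1.2) p.2.2).
  move=> Hp Ep; have : has (lit_true v)
     (implication (at_head t p.1) (var t.+1 p.2.1.1 (O' + p.2.1.2) p.2.2)).
    apply: (allP v_sat); rewrite /tableau !mem_cat; apply/or4P; apply: Or42.
    apply/flatten_mapP; exists t; first by rewrite mem_iota.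
    by apply/mapP; exists p.
  by rewrite implicationP Ep Hprem.
split.
  have := Hwrite (premises r, (k, 1, state_rank (next r).1)).
  rewrite /= addn1 -/O /symbol eqxx step_state; apply=> //.
  by apply/flatten_mapP; exists r; rewrite ?mem_enum // mem_head.
move=> i [//|y] ik Hty Hy; pose io : 'I_k := Ordinal ik.
have Eio : inord i = io by apply/val_inj; rewrite /= inordK.
rewrite /symbol ltn_eqF // Eio step_content -/r -/(run t) /=.
set a := (next r).2 io; have sh : shift a.2 <= 2 by case: (a.2).
have O'0 : 0 < O' by apply: leq_ltn_trans T_le.
case: eqP => [Esrc|/eqP nsrc].
  have := Hwrite (premises r, (val io, 2 - shift a.2, cell_rank a.1)).
  rewrite /= shift_target // -/O -Esrc addnK; apply=> //.
  apply/flatten_mapP; exists r; first by rewrite mem_enum.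
  by rewrite inE; apply/orP; right; apply/mapP; exists io; rewrite ?mem_enum.
set c := content _ _.
have : has (lit_true v) (implication
   (var t i (y + shift a.2) (cell_rank c) :: at_head t (premises r))
   (var t.+1 i y.+1 (cell_rank c))).
  apply: (allP v_sat); rewrite /tableau !mem_cat; apply/or4P; apply: Or43.
  apply/flatten_mapP; exists t; first by rewrite mem_iota.
  apply/flatten_mapP; exists y; first by rewrite mem_iota; lia.
  apply/mapP; exists (premises r, (val io, shift a.2, cell_rank c)) => //.
  rewrite mem_filter nsrc; apply/flatten_mapP; exists r; first by rewrite mem_enum.
  apply/flatten_mapP; exists io; first by rewrite mem_enum.
  by apply/mapP; exists c; rewrite ?mem_enum.
rewrite implicationP => /implyP; apply; apply/andP; split; last exact: Hprem.
have := Hcell i (y + shift a.2) ik; rewrite /symbol ltn_eqF // Eio; apply; lia.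
Qed.

Lemma tableau_sound : accepts (run T).
Proof.
have [_ H] := values_run (leqnn T).
have val0 y : T <= y -> y + T <= 2 * O ->
    v (var T 0 y (cell_rank (content ((run T).2 ord0) y))).
  move=> h1 h2; have := H 0 y isT h1 h2; rewrite /symbol /k /=.
  by rewrite (_ : inord 0 = ord0) //; apply/val_inj; rewrite /= inordK.
have acc c : c \in accept_clauses -> has (lit_true v) c.
  by move: c; apply/allP; move: v_sat; rewrite /sat /tableau !all_cat => /and4P[].
have TO : T < O := ltnW T_le.
apply/andP; split; apply: contraT => Hc.
  have := acc [:: (false, var T 0 O (cell_rank (content ((run T).2 ord0) O)))].
  rewrite /= orbF /lit_true /= val0; [|lia..]; apply.
  rewrite mem_cat; apply/orP; left; apply/mapP; eexists; last by [].
  by apply/mapP; eexists; last by []; rewrite mem_filter Hc mem_enum.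
have := acc [:: (false, var T 0 O.+1 (cell_rank (content ((run T).2 ord0) O.+1)))].
rewrite /= orbF /lit_true /= val0; [|lia..]; apply.
rewrite mem_cat; apply/orP; right; apply/mapP; eexists; last by [].
by move: Hc; rewrite negbK !inE => /orP[] /eqP ->; rewrite eqxx ?orbT.
Qed.

End Sound.

End Tableau.

(** * From satisfiability to colouring *)

(** Not-all-equal constraints are invariant under negating all variables, so falsity is represented
    by a reference variable. First component [0] is for it and the original variables, [i.+1] for
    the auxiliary ones of clause [i]. *)
Definition false_lit : lit := (true, pairing 0 0).

Definition wrap (l : lit) : lit := (l.1, pairing 0 l.2.+1).

(** [link i j] states that one of the first [j] literals of clause [i] holds. *)
Definition link (i j : nat) : lit :=
  if j == 0 then false_lit else (false, pairing i.+1 j.-1).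

(** The third literal of the first kind of triple is the negation of [link i j.+1]. Hence a false
    link and a false literal force the next link to be false, and the closing triple demands that
    the last link differ from falsity. *)
Definition split_clause (i : nat) (c : seq lit) : seq (lit * lit * lit) :=
  [seq (link i j, wrap (nth (true, 0) c j), (true, pairing i.+1 j))
  | j <- iota 0 (size c)] ++
  [:: (link i (size c), link i (size c), false_lit)].

Definition nae_of (F : seq (seq lit)) : seq (lit * lit * lit) :=
  flatten [seq split_clause i (nth [::] F i) | i <- iota 0 (size F)].

Definition nae3 (v : nat -> bool) (q : lit * lit * lit) : bool :=
  ~~ ((lit_true v q.1.1 == lit_true v q.1.2) && (lit_true v q.1.1 == lit_true v q.2)).

Lemma nae_of_complete v F : sat v F -> exists w, all (nae3 w) (nae_of F).
Proof.
move=> /allP satF; pose pre i j := has (lit_true v) (take j (nth [::] F i)).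
(* Links are negative literals, so the auxiliary variable takes the negated disjunction of the first
   [b.+1] literals. *)
pose w n := let: (a, b) := unpairing n in
  if a == 0 then (if b == 0 then false else v b.-1) else ~~ pre a.-1 b.+1.
have wE a b : w (pairing a b) =
   if a == 0 then (if b == 0 then false else v b.-1) else ~~ pre a.-1 b.+1.
  by rewrite /w pairingK.
exists w; apply/allP => q /flatten_mapP[i]; rewrite mem_iota add0n => Hi.
have linkE j : lit_true w (link i j) = pre i j.
  rewrite /link /lit_true; case: j => [|j] /=; first by rewrite wE /pre take0.
  by rewrite wE /= eqbF_neg negbK.
rewrite mem_cat => /orP[/mapP[j + ->]|].
  rewrite mem_iota add0n => Hj; rewrite /nae3 /= linkE /lit_true /= !wE /= !eqb_id.
  have -> : pre i j.+1 = pre i j || lit_true v (nth (true, 0) (nth [::] F i) j).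
    by rewrite /pre (take_nth (true, 0)) // has_rcons orbC.
  by rewrite /lit_true; case: (pre i j); case: (v _ == _).
rewrite inE => /eqP ->; rewrite /nae3 /= eqxx linkE /lit_true wE /=.
by rewrite /pre take_size eqb_id; have /satF -> : nth [::] F i \in F by exact: mem_nth.
Qed.

Lemma nae_of_sound w F : all (nae3 w) (nae_of F) -> exists v, sat v F.
Proof.
move=> /allP naeF; pose f := w (pairing 0 0).
(* Adding the value of the reference variable makes falsity false and preserves all triples. *)
pose u n := w n (+) f; exists (fun x => u (pairing 0 x.+1)); apply/allP => c cF.
have nae_u q : nae3 u q = nae3 w q.
  rewrite /nae3 /lit_true /u; case: q => [[[s1 v1] [s2 v2]] [s3 v3]] /=.
  by case: (f); case: (w v1); case: (w v2); case: (w v3); case: s1; case: s2; case: s3.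
have [i Hi <-] : exists2 i, i < size F & nth [::] F i = c.
  by exists (index c F); rewrite ?index_mem ?nth_index.
have Hq q : q \in split_clause i (nth [::] F i) -> nae3 u q.
  move=> Hq; rewrite nae_u; apply: naeF; apply/flatten_mapP.
  by exists i; rewrite // mem_iota.
have u0 : u (pairing 0 0) = false by rewrite /u addbb.
apply: contraT => /hasPn none.
have linkF j : j <= size (nth [::] F i) -> lit_true u (link i j) = false.
  elim: j => [_|j IH lt_j]; first by rewrite /link /lit_true /= u0.
  have := Hq (link i j, wrap (nth (true, 0) (nth [::] F i) j), (true, pairing i.+1 j)).
  rewrite mem_cat map_f ?mem_iota // => /(_ isT); rewrite /nae3 /= IH 1?ltnW //.
  have /none : nth (true, 0) (nth [::] F i) j \in nth [::] F i by exact: mem_nth.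
  rewrite /link /lit_true /= => /negbTE ->.
  by case: (u _).
have := Hq (link i (size (nth [::] F i)), link i (size (nth [::] F i)), false_lit).
rewrite mem_cat inE eqxx orbT => /(_ isT).
by rewrite /nae3 /= !linkF // /lit_true /= u0.
Qed.

(** * Triangles and conflict pairs from triples of literals *)

Definition flat (T : seq (lit * lit * lit)) : seq lit :=
  flatten [seq [:: q.1.1; q.1.2; q.2] | q <- T].

Lemma size_flat T : size (flat T) = 3 * size T.
Proof. by elim: T => //= q T IH; rewrite -/(flat T) IH; lia. Qed.

Lemma nth_flat T c q0 l0 : c < size T ->
  [/\ nth l0 (flat T) (3 * c) = (nth q0 T c).1.1,
      nth l0 (flat T) (3 * c + 1) = (nth q0 T c).1.2 &
      nth l0 (flat T) (3 * c + 2) = (nth q0 T c).2].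
Proof.
elim: T c => // q T IH [|c] Hc //.
by have [h1 h2 h3] := IH c Hc; rewrite mulnS !addSn.
Qed.

(** The vertices are the occurrences [i < n] of literals, which carry the
    triangles, and a negated copy [n + i] of each of them. *)
Definition same_lit (l m : lit) : bool := (l.1 == m.1) && (l.2 == m.2).
Definition opposite_lit (l m : lit) : bool := (l.1 != m.1) && (l.2 == m.2).

(** The larger end of each pair is a negated copy, so no pair is an edge of a triangle, even if a
    triple contains a literal twice or together with its negation. The case [i = j] of the first
    family ties each copy to its original. *)
Definition conflicts (L : seq lit) : seq (nat * nat) :=
  flatten [seq [seq (i, size L + j) | j <- iota 0 (size L)
      & same_lit (nth (true, 0) L i) (nth (true, 0) L j)] | i <- iota 0 (size L)] ++
  flatten [seq [seq (size L + i, size L + j) | j <- iota 0 (size L)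
      & (i < j) && opposite_lit (nth (true, 0) L i) (nth (true, 0) L j)]
    | i <- iota 0 (size L)].

Lemma conflictsP L p : p \in conflicts L -> exists i j,
  [/\ i < size L, j < size L &
      p = (i, size L + j) /\ same_lit (nth (true, 0) L i) (nth (true, 0) L j) \/
      [/\ p = (size L + i, size L + j), i < j &
          opposite_lit (nth (true, 0) L i) (nth (true, 0) L j)]].
Proof.
rewrite mem_cat => /orP[] /flatten_mapP[i]; rewrite mem_iota => Hi /mapP[j];
  rewrite mem_filter mem_iota.
  by move=> /andP[H Hj] ->; exists i, j; split=> //; left.
by move=> /andP[/andP[ij H] Hj] ->; exists i, j; split=> //; right.
Qed.

Lemma conflicts_bounds L p : p \in conflicts L ->
  [/\ p.1 < p.2, p.2 < 2 * size L & size L <= p.2].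
Proof.
by case/conflictsP => i [j [Hi Hj [[-> _]|[-> ij _]]]] /=; split; lia.
Qed.

Lemma conflicts_uniq L : uniq (conflicts L).
Proof.
rewrite cat_uniq; apply/and3P; split.
- apply: (@allpairs_uniq_dep nat (fun _ => nat) _ (fun i j => (i, size L + j))
     (iota 0 (size L)) (fun i => [seq j <- iota 0 (size L) | _])).
  + exact: iota_uniq.
  + by move=> i _; rewrite filter_uniq // iota_uniq.
  + by move=> [i j] [i' j'] _ _ /= [-> /eqP]; rewrite eqn_add2l => /eqP ->.
- apply/hasPn => p /flatten_mapP[i]; rewrite mem_iota => Hi /mapP[j _ ->].
  apply/negP => /flatten_mapP[i']; rewrite mem_iota => Hi' /mapP[j' _ []]; lia.
- apply: (@allpairs_uniq_dep nat (fun _ => nat) _ (fun i j => (size L + i, size L + j))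
     (iota 0 (size L)) (fun i => [seq j <- iota 0 (size L) | _])).
  + exact: iota_uniq.
  + by move=> i _; rewrite filter_uniq // iota_uniq.
  + by move=> [i j] [i' j'] _ _ /= [/eqP + /eqP]; rewrite !eqn_add2l => /eqP -> /eqP ->.
Qed.

Lemma nae_colouring w T : all (nae3 w) T ->
  exists col, valid (size T) (conflicts (flat T)) col.
Proof.
move=> /allP naeT; pose L := flat T; pose n := size L.
pose val i := lit_true w (nth (true, 0) L i).
exists (fun i => if i < n then val i else ~~ val (i - n)).
have small i : i < n -> (if i < n then val i else ~~ val (i - n)) = val i by move=> ->.
have large i : (if n + i < n then val (n + i) else ~~ val (n + i - n)) = ~~ val i.
  by rewrite ltnNge leq_addr addKn.
apply/andP; split; apply/allP; [move=> c | move=> p].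
  rewrite mem_iota add0n => Hc; rewrite /bad_triangle /mono /=.
  have sL : n = 3 * size T by exact: size_flat.
  rewrite !small; [|lia..]; rewrite /val.
  have [-> -> ->] := nth_flat ((true, 0), (true, 0), (true, 0)) (true, 0) Hc.
  exact/naeT/mem_nth.
case/conflictsP => i [j [Hi Hj [[-> /andP[h1 h2]]|[-> ij /andP[h1 h2]]]]];
  rewrite /mono /= -/L -/n !large ?small // /val /lit_true (eqP h2).
  by rewrite (eqP h1); case: (w _ == _).
by move: h1; rewrite -/L; case: (nth _ L i).1; case: (nth _ L j).1; case: (w _).
Qed.

Lemma colouring_nae col T : valid (size T) (conflicts (flat T)) col ->
  exists w, all (nae3 w) T.
Proof.
pose L := flat T; pose n := size L; case/andP => /allP Ht /allP HE.
pose lt i := nth (true, 0) L i.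
have Hsame i j : i < n -> j < n -> same_lit (lt i) (lt j) -> col i != col (n + j).
  move=> Hi Hj Hs; apply: (HE (i, n + j)); rewrite mem_cat; apply/orP; left.
  by apply/flatten_mapP; exists i; [rewrite mem_iota | apply/mapP; exists j; rewrite //
      mem_filter Hs mem_iota].
have Hopp i j : i < n -> j < n -> i < j -> opposite_lit (lt i) (lt j) ->
    col (n + i) != col (n + j).
  move=> Hi Hj ij Hs; apply: (HE (n + i, n + j)); rewrite mem_cat; apply/orP; right.
  apply/flatten_mapP; exists i; first by rewrite mem_iota.
  by apply/mapP; exists j; rewrite // mem_filter ij Hs mem_iota.
have Hself i : i < n -> col (n + i) = ~~ col i.
  move=> Hi; have := Hsame i i Hi Hi; rewrite /same_lit !eqxx => /(_ isT).
  by case: (col i); case: (col _).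
(* All occurrences of a variable propose the same value for it, whatever their signs. *)
have agree i j : i < n -> j < n -> (lt i).2 = (lt j).2 ->
    (col i == (lt i).1) = (col j == (lt j).1).
  wlog ij : i j / i < j => [W|] Hi Hj E.
    have [lt_ij|lt_ji|->//] := ltngtP i j; first exact: W.
    by rewrite (W j i).
  have [Es|Es] := eqVneq (lt i).1 (lt j).1.
    have := Hsame i j Hi Hj; rewrite /same_lit Es E !eqxx Hself // => /(_ isT).
    by case: (col i); case: (col j).
  have := Hopp i j Hi Hj ij; rewrite /opposite_lit Es E eqxx !Hself // => /(_ isT).
  by move: Es; case: (col i); case: (col j); case: (lt i).1; case: (lt j).1.
(* A variable is true if some occurrence proposes it, and false by default if it does not occur. *)
pose w x := has (fun i => ((lt i).2 == x) && (col i == (lt i).1)) (iota 0 n).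
exists w; apply/allP => q qT.
have litE i : i < n -> lit_true w (lt i) = col i.
  move=> Hi; have -> : lit_true w (lt i) = ((col i == (lt i).1) == (lt i).1).
    rewrite /lit_true; congr (_ == _); apply/hasP/idP => [[j]|Hc].
      by rewrite mem_iota => Hj /andP[/eqP E H]; rewrite (agree i j).
    by exists i; rewrite ?mem_iota // eqxx.
  by case: (col i); case: (lt i).1.
have sL : n = 3 * size T by exact: size_flat.
have [c Hc <-] : exists2 c, c < size T & nth q T c = q.
  by exists (index q T); rewrite ?index_mem ?nth_index.
have [h1 h2 h3] := nth_flat q (true, 0) Hc.
have := Ht c; rewrite mem_iota add0n => /(_ Hc); rewrite /bad_triangle /mono /=.
by rewrite /nae3 -h1 -h2 -h3 -![nth _ _ _]/(lt _) !litE //; lia.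
Qed.

Lemma sat_colouring F :
  (exists v, sat v F) <->
  (exists col, valid (size (nae_of F)) (conflicts (flat (nae_of F))) col).
Proof.
split=> [[v /nae_of_complete[w]]|[col /colouring_nae[w]]]; first exact: nae_colouring.
exact: nae_of_sound.
Qed.

(** * The reduction in polynomial time *)

Section Encodings.

Context {E : Type} `{data E}.

Lemma pt_tableau (M : machine) (T O' g : E -> nat) (u : E -> seq bool) :
  pt T -> pt O' -> pt g -> pt u ->
  pt (fun e => tableau M (T e) (O' e) (u e) (g e)).
Proof.
move=> HT HO Hg Hu; rewrite /tableau /init_clauses /write_clauses /copy_clauses.
rewrite /accept_clauses /implication /at_head /var /pairing /options.
(* The tables depend on the machine alone and are constants here. *)
move: (write_table M) (copy_table M) => wt ct.
by pt_all.
Qed.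

Lemma pt_nae_of (F : E -> seq (seq lit)) : pt F -> pt (fun e => nae_of (F e)).
Proof.
move=> HF; rewrite /nae_of /split_clause /link /wrap /false_lit /pairing.
by pt_all.
Qed.

Lemma pt_flat (F : E -> seq (lit * lit * lit)) : pt F -> pt (fun e => flat (F e)).
Proof. by move=> HF; rewrite /flat; pt_all. Qed.

Lemma pt_conflicts (L : E -> seq lit) : pt L -> pt (fun e => conflicts (L e)).
Proof.
move=> HL; rewrite /conflicts /same_lit /opposite_lit.
by pt_all.
Qed.

End Encodings.

(** The guard stops the doubling at the first power of two that is at least [n]; unguarded, [n]
    doublings would give a number of exponential size. *)
Definition double_until (n : nat) (p : nat * nat) : nat * nat :=
  if p.1 < n then (p.1 + p.1, p.2.+1) else p.

Definition grow (n : nat) : nat * nat := iter n (double_until n) (1, 0).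

Definition height (n : nat) : nat := (grow n).2.+2.

Lemma growP n i : let p := iter i (double_until n) (1, 0) in
  [/\ p.1 = 2 ^ p.2, p.1 <= 2 * n + 1, p.2 <= i & i < p.1 \/ n <= p.1].
Proof.
elim: i => [|i [IH1 IH2 IH3 IH4]] /=; first by split=> //; [lia | left].
rewrite /double_until; set p := iter _ _ _ in IH1 IH2 IH3 IH4 *.
case: ltnP => h /=; last by split=> //; [lia | right].
by split; [rewrite expnS -IH1; lia | lia | lia | lia].
Qed.

Lemma height_ge n : n <= 2 ^ (height n - 2).
Proof.
by rewrite /height subn2 /=; have [<- _ _] := growP n n; rewrite /grow; lia.
Qed.

Lemma exp_height n : 2 ^ height n = 4 * (grow n).1.
Proof. by have [e _ _ _] := growP n n; rewrite /height !expnS -e mulnA. Qed.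

Section Instances.

Context {E : Type} `{data E}.

Lemma pt_grow (n : E -> nat) : pt n -> pt (fun e => grow (n e)).
Proof.
move=> Hn; have bn := bounded_nat Hn.
apply: (pt_iter (b := fun e => 100 * n e + 100) Hn); rewrite /double_until.
- by pt_all.
- by pt_all.
- by repeat first [eassumption | bnd_step].
move=> e i Hi; have [_ h1 h2 _] := growP (n e) i.
by rewrite sz_pair !sz_nat; move: h1 h2; rewrite /double_until; lia.
Qed.

Lemma pt_height (n : E -> nat) : pt n -> pt (fun e => height (n e)).
Proof. by move=> Hn; rewrite /height; have Hg := pt_grow Hn; pt_all. Qed.

(** Exponentiation is not polynomial on unary numbers; the power is obtained from the first
    component of [grow], which stays linear in [n]. *)
Lemma pt_exp_height (n : E -> nat) : pt n -> pt (fun e => 2 ^ height (n e)).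
Proof.
move=> Hn; apply: (pt_ext (f := fun e => 4 * (grow (n e)).1)).
  by move=> e; rewrite exp_height.
by have Hg := pt_grow Hn; pt_all.
Qed.

Variables (t K N : E -> nat) (C : E -> seq (nat * nat)).
Hypotheses (Ht : pt t) (HK : pt K) (HN : pt N) (HC : pt C).
Hypothesis expK : forall e, 2 ^ K e = N e.

Lemma pt_constraints : pt (fun e => constraints (t e) (C e)).
Proof. by rewrite /constraints /triangles /triangle; pt_all. Qed.

Lemma pt_pair_sum : pt (fun e => pair_sum (K e)).
Proof.
apply: (pt_ext (f := fun e => N e * (K e * N e + 1) - N e * N e)).
  by move=> e; rewrite -expK.
by pt_all.
Qed.

Lemma pt_weight : pt (fun e => weight (t e) (C e) (K e)).
Proof.
rewrite /weight; have Hc := pt_constraints; have Hp := pt_pair_sum.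
by pt_all.
Qed.

Lemma pt_threshold : pt (fun e => threshold (t e) (C e) (K e)).
Proof.
apply: (pt_ext (f := fun e => weight (t e) (C e) (K e) * (N e * (K e).+1) +
   pair_sum (K e) + 2 * t e - 2 * K e * size (constraints (t e) (C e)))).
  by move=> e; rewrite -expK.
have Hc := pt_constraints; have Hp := pt_pair_sum; have Hw := pt_weight.
by pt_all.
Qed.

Lemma pt_graph_edges (W : E -> nat) (R : E -> seq (nat * nat)) : pt W -> pt R ->
  pt (fun e => graph_edges (W e) (N e) (R e)).
Proof.
move=> HW HR; apply: (pt_ext (f := fun e => flatten [seq nseq (W e) (N e, x) | x <- iota 0
    (N e)] ++
    [seq p <- pairs (N e) | ~~ has (fun q => (p.1 == q.1) && (p.2 == q.2)) (R e)])).
  move=> e; rewrite /graph_edges; congr cat; apply: eq_filter => p; congr negb.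
  rewrite -has_pred1; apply: eq_has => q /=; rewrite -[q == p]/(q == p).
  by case: p q => a b [c d]; rewrite xpair_eqE eq_sym [d == b]eq_sym.
by rewrite /pairs; pt_all.
Qed.

End Instances.

(** * Reading the colouring off a layout *)

Definition decode_nats (w : seq bool) : seq nat :=
  foldr (fun b s => if b then (head 0 s).+1 :: behead s else 0 :: s) [::] w.

Lemma decode_encode s : decode_nats (encode_nats s) = s.
Proof.
rewrite /encode_nats; elim: s => //= n s {2}<-.
by rewrite /decode_nats foldr_cat foldr_rcons; elim: n => //= n ->.
Qed.

(** The markers sit at even positions and the first [false] among them ends the first word. Even
    positions after it belong to the second word, so all markers up to the current one are
    inspected. *)
Definition unpair_size (w : seq bool) : nat :=
  size [seq j <- iota 0 (size w) | all (fun i => nth false w (2 * i)) (iota 0 j.+1)].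

Definition unpair_fst (w : seq bool) : seq bool :=
  [seq nth false w (2 * j + 1) | j <- iota 0 (unpair_size w)].

Definition unpair_snd (w : seq bool) : seq bool := drop (2 * unpair_size w + 1) w.

Lemma pair_word_cons b x y : pair_word (b :: x) y = [:: true, b & pair_word x y].
Proof. by []. Qed.

Lemma size_pair_word x y : size (pair_word x y) = 2 * size x + 1 + size y.
Proof. by elim: x => [|b x IH] //=; rewrite IH; lia. Qed.

Lemma nth_pair_even x y i : i <= size x -> nth false (pair_word x y) (2 * i) = (i < size x).
Proof.
elim: x i => [|b x IH] [|i] // Hi; rewrite mulnS !addSn pair_word_cons /=.
exact: IH.
Qed.

Lemma nth_pair_odd x y i : i < size x ->
  nth false (pair_word x y) (2 * i + 1) = nth false x i.
Proof.
elim: x i => [|b x IH] [|i] // Hi; rewrite mulnS !addSn pair_word_cons /=.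
exact: IH.
Qed.

Lemma unpair_sizeE x y : unpair_size (pair_word x y) = size x.
Proof.
rewrite /unpair_size size_pair_word.
have -> : 2 * size x + 1 + size y = size x + (size x + 1 + size y) by lia.
rewrite iotaD filter_cat size_cat.
rewrite (eq_in_filter (a2 := predT)) ?filter_predT ?size_iota; last first.
  move=> j; rewrite mem_iota add0n => Hj; apply/allP => i; rewrite mem_iota => Hi.
  by rewrite nth_pair_even; lia.
rewrite (eq_in_filter (a2 := pred0)) ?filter_pred0 ?addn0 //.
move=> j; rewrite mem_iota => Hj; apply/negbTE/allPn; exists (size x).
  by rewrite mem_iota; lia.
by rewrite nth_pair_even // ltnn.
Qed.

Lemma unpair_fstE x y : unpair_fst (pair_word x y) = x.
Proof.
rewrite /unpair_fst unpair_sizeE; apply: (@eq_from_nth _ false).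
  by rewrite size_map size_iota.
move=> i; rewrite size_map size_iota => Hi.
by rewrite (nth_map 0) ?size_iota // nth_iota // add0n nth_pair_odd.
Qed.

Lemma unpair_sndE x y : unpair_snd (pair_word x y) = y.
Proof.
rewrite /unpair_snd unpair_sizeE; elim: x => [|b x IH]; first by rewrite /= drop0.
by rewrite [size _]/= mulnS !addSn; exact: IH.
Qed.

(** [reach nodes es m s]: the nodes at distance at most [m] from [s] in the graph
    whose edges are the pairs of consecutive entries of [es]; an index past the
    end yields the harmless edge [(0, 0)]. *)
Definition reach (nodes : nat) (es : seq nat) (m s : nat) : seq nat :=
  iter m (fun S => [seq v <- iota 0 nodes | (v \in S) ||
    has (fun i => (nth 0 es (2 * i) \in S) && (nth 0 es (2 * i + 1) == v) ||
                  (nth 0 es (2 * i + 1) \in S) && (nth 0 es (2 * i) == v))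
        (iota 0 (size es))]) [:: s].

Definition layout_nats (n : nat) (l : layout n) : seq nat :=
  n :: nodes l :: [seq val (phi l v) | v <- enum 'I_n] ++
    flatten [seq [:: val e.1; val e.2] |
               e : 'I_(nodes l) * 'I_(nodes l) <- enum {: 'I_(nodes l) * 'I_(nodes l)}
               & (e.1 < e.2) && adj e.1 e.2].

(** Entry [0] is the number of vertices and entry [1] that of nodes; the image of vertex [i] is
    entry [i.+2], and the edges come after all the images. *)
Definition decoded_colour (d : seq nat) (m i : nat) : bool :=
  nth 0 d i.+2 \in reach (nth 0 d 1) (drop (nth 0 d 0).+2 d) m (nth 0 d 2).

Lemma dist_le_succ (T : finType) (e : rel T) (u w : T) m :
  (forall x y, connect e x y) ->
  (dist e u w <= m.+1) = (dist e u w <= m) || [exists x, (dist e u x <= m) && e x w].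
Proof.
move=> conn; apply/idP/orP => [le|[/leqW//|/existsP[x /andP[Hx xw]]]]; last first.
  have [p [Hp _ lp sp]] := dist_path (conn u x).
  have := @dist_le _ e u (rcons p w); rewrite last_rcons size_rcons sp rcons_path Hp lp xw.
  by move=> /(_ isT) H; apply: leq_trans H _.
have [le_m|gt_m] := leqP (dist e u w) m; [by left | right].
have [p [Hp _ lp sp]] := dist_path (conn u w).
case/lastP: p Hp lp sp => [|p y] Hp lp sp; first by rewrite -sp in gt_m.
rewrite last_rcons in lp; rewrite rcons_path size_rcons lp in Hp sp.
case/andP: Hp => Hp xw; apply/existsP; exists (last u p); rewrite xw andbT.
by apply: leq_trans (dist_le Hp) _; rewrite -ltnS sp.
Qed.

Lemma nth_flat_pairs (s : seq (nat * nat)) i :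
  nth 0 (flatten [seq [:: p.1; p.2] | p <- s]) (2 * i) = (nth (0, 0) s i).1 /\
  nth 0 (flatten [seq [:: p.1; p.2] | p <- s]) (2 * i + 1) = (nth (0, 0) s i).2.
Proof.
elim: s i => [i|p s IH [|i] //]; first by rewrite [flatten _]/= !nth_nil.
by rewrite mulnS !addSn; exact: IH.
Qed.

Section Decode.

Variables (n : nat) (l : layout n.+1).
Hypothesis tree_l : is_tree (@adj _ l).

Let es := flatten [seq [:: val e.1; val e.2] |
   e : 'I_(nodes l) * 'I_(nodes l) <- enum {: 'I_(nodes l) * 'I_(nodes l)}
   & (e.1 < e.2) && adj e.1 e.2].

Lemma edge_list (S : seq nat) (v : 'I_(nodes l)) :
  (val v \in S) ||
    has (fun i => (nth 0 es (2 * i) \in S) && (nth 0 es (2 * i + 1) == val v) ||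
                  (nth 0 es (2 * i + 1) \in S) && (nth 0 es (2 * i) == val v))
        (iota 0 (size es)) =
  (val v \in S) || [exists x, (val x \in S) && adj x v].
Proof.
have [symE irrE _ _ _] := tree_l.
pose ps := [seq (val e.1, val e.2) | e : 'I_(nodes l) * 'I_(nodes l) <-
   enum {: 'I_(nodes l) * 'I_(nodes l)} & (e.1 < e.2) && adj e.1 e.2].
have Ees : es = flatten [seq [:: p.1; p.2] | p <- ps] by rewrite /ps -map_comp.
have size_es : size ps <= size es.
  by rewrite Ees; elim: (ps) => //= p s IH; rewrite ltnS leqW.
have psP a b : (a, b) \in ps -> exists x y : 'I_(nodes l), [/\ a = val x, b = val y & @adj
    _ l x y].
  by case/mapP => -[x y]; rewrite mem_filter => /andP[/andP[_ xy] _] [-> ->]; exists x, y.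
case vS : (val v \in S) => //=; apply/hasP/existsP => [[i Hi]|[x /andP[xS xv]]].
  rewrite Ees; have [-> ->] := nth_flat_pairs ps i.
  have [lt|ge] := ltnP i (size ps); last first.
    by rewrite nth_default //= => /orP[] /andP[H /eqP E]; rewrite -E H in vS.
  have := mem_nth (0, 0) lt; case: (nth _ ps i) => a b /psP[x [y [-> -> xy]]] /=.
  case/orP => /andP[H /eqP/val_inj E]; rewrite -E; first by exists x; rewrite H.
  by exists y; rewrite H symE.
have mem_ps (a b : 'I_(nodes l)) : @adj _ l a b -> a < b -> (val a, val b) \in ps.
  by move=> ab lt; apply/mapP; exists (a, b); rewrite // mem_filter /= lt ab mem_enum.
have [lt|gt|E] := ltngtP x v; last first.
- by move/val_inj: E => E; rewrite E irrE in xv.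
- have H : (val v, val x) \in ps by apply: mem_ps; rewrite // symE.
  exists (index (val v, val x) ps).
    by rewrite mem_iota add0n (leq_trans _ size_es) // index_mem.
  rewrite Ees; have [-> ->] := nth_flat_pairs ps (index (val v, val x) ps).
  by rewrite nth_index //= xS eqxx orbT.
- have H : (val x, val v) \in ps by exact: mem_ps.
  exists (index (val x, val v) ps).
    by rewrite mem_iota add0n (leq_trans _ size_es) // index_mem.
  rewrite Ees; have [-> ->] := nth_flat_pairs ps (index (val x, val v) ps).
  by rewrite nth_index //= xS eqxx.
Qed.

Lemma reachE (u v : 'I_(nodes l)) m :
  (val v \in reach (nodes l) es m (val u)) = (dist (@adj _ l) u v <= m).
Proof.
have [symE irrE _ conn _] := tree_l.
elim: m v => [|m IH] v.
  rewrite /= inE; apply/eqP/idP => [/val_inj ->|]; first by rewrite dist_refl.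
  have [p [_ _ lp <-]] := dist_path (conn u v).
  by rewrite leqn0 => /nilP Ep; rewrite -lp Ep.
rewrite {1}/reach iterS mem_filter mem_iota /= ltn_ord andbT edge_list dist_le_succ // IH.
by congr orb; apply: eq_existsb => x; rewrite IH.
Qed.

Lemma decoded_colourE m i : i <= n ->
  decoded_colour (layout_nats l) m i = (ldist l 0 i <= m).
Proof.
move=> Hi; have nth_phi j : j <= n -> nth 0 (layout_nats l) j.+2 = val (phi l (inord j)).
  move=> Hj; rewrite /= nth_cat size_map size_enum_ord ltnS Hj.
  rewrite (nth_map ord0) ?size_enum_ord //; congr (val (phi l _)); apply/val_inj.
  by rewrite /= nth_enum_ord // inordK.
rewrite /decoded_colour nth_phi // (nth_phi 0) //=.
rewrite drop_cat size_map size_enum_ord ltnn subnn drop0.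
exact: reachE.
Qed.

Lemma decoded_layout_colour K i : 0 < K -> i <= n ->
  decoded_colour (layout_nats l) (2 * K).-1 i = layout_colour l K i.
Proof.
move=> K0 Hi; rewrite decoded_colourE // /layout_colour -[LHS]ltnS prednK //.
by rewrite muln_gt0.
Qed.

End Decode.

Section DecodePolytime.

Context {E : Type} `{data E}.

Lemma pt_encode_nats (s : E -> seq nat) : pt s -> pt (fun e => encode_nats (s e)).
Proof. by move=> Hs; rewrite /encode_nats; pt_all. Qed.

Lemma pt_decode_nats (w : E -> seq bool) : pt w -> pt (fun e => decode_nats (w e)).
Proof.
move=> Hw; have bw := pt_bounded Hw.
apply: (pt_foldr (b := fun e => 4 * sz (w e)) Hw).
- by pt_all.
- by pt_all.
- by repeat first [eassumption | bnd_step].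
move=> e l1 l2 ->; apply: (@leq_trans (4 * size l2 + 1)); last first.
  by pose proof (size_le_sz (l1 ++ l2)) as h; rewrite size_cat in h; lia.
elim: l2 => [|b l2 IH] //=; move: IH; case: (foldr _ _ _) => [|m s] /=.
  by rewrite sz_nil; case: b; rewrite sz_cons sz_nat sz_nil; lia.
by case: b; rewrite !sz_cons !sz_nat; lia.
Qed.

Lemma pt_unpair_size (w : E -> seq bool) : pt w -> pt (fun e => unpair_size (w e)).
Proof. by move=> Hw; rewrite /unpair_size; pt_all. Qed.

Lemma pt_unpair_fst (w : E -> seq bool) : pt w -> pt (fun e => unpair_fst (w e)).
Proof. by move=> Hw; have Hs := pt_unpair_size Hw; rewrite /unpair_fst; pt_all. Qed.

Lemma pt_unpair_snd (w : E -> seq bool) : pt w -> pt (fun e => unpair_snd (w e)).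
Proof. by move=> Hw; have Hs := pt_unpair_size Hw; rewrite /unpair_snd; pt_all. Qed.

Lemma sz_filter (a : pred nat) (s : seq nat) : sz (filter a s) <= sz s.
Proof. by elim: s => //= x s IH; case: (a x); rewrite !sz_cons; lia. Qed.

Lemma pt_reach (nodes m s : E -> nat) (es : E -> seq nat) :
  pt nodes -> pt m -> pt s -> pt es ->
  pt (fun e => reach (nodes e) (es e) (m e) (s e)).
Proof.
move=> Hn Hm Hs He; have Hi := pt_iota0 Hn.
have Hs1 : pt (fun e => [:: s e]) by pt_all.
have bi := pt_bounded Hi; have bs := pt_bounded Hs1.
apply: (pt_iter (b := fun e => sz (iota 0 (nodes e)) + sz [:: s e]) Hm).
- by pt_all.
- by pt_all.
- by repeat first [eassumption | bnd_step].
move=> e [|i] _ /=; first exact: leq_addl.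
by apply: leq_trans (leq_addr _ _); exact: sz_filter.
Qed.

Lemma pt_valid (t : E -> nat) (C : E -> seq (nat * nat)) (d : E -> seq nat) (m : E -> nat) :
  pt t -> pt C -> pt d -> pt m ->
  pt (fun e => valid (t e) (C e) (decoded_colour (d e) (m e))).
Proof.
move=> Ht HC Hd Hm; rewrite /valid /bad_triangle /mono /decoded_colour.
pose S e := reach (nth 0 (d e) 1) (drop (nth 0 (d e) 0).+2 (d e)) (m e) (nth 0 (d e) 2).
have HS : pt S by apply: pt_reach; pt_all.
apply: (pt_ext (f := fun e =>
  all (fun c => ~~ (((nth 0 (d e) (3 * c).+2 \in S e) == (nth 0 (d e) (3 * c + 1).+2 \in S
      e)) &&
     ((nth 0 (d e) (3 * c).+2 \in S e) == (nth 0 (d e) (3 * c + 2).+2 \in S e)))) (iota 0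
         (t e)) &&
  all (fun p => ~~ ((nth 0 (d e) p.1.+2 \in S e) == (nth 0 (d e) p.2.+2 \in S e))) (C e)))
      => //.
by pt_all.
Qed.

End DecodePolytime.

(** * Assembly of the two reductions *)

Lemma encode_nats_inj : injective encode_nats.
Proof. exact: can_inj decode_encode. Qed.

Lemma multigraph_nats_inj G G' : multigraph_nats G = multigraph_nats G' -> G = G'.
Proof.
case: G G' => n es h [n' es' h']; rewrite /multigraph_nats /= => -[En].
case: n' / En es' h' => es' h' Ees.
suff E : es = es' by case: es' / E h' {Ees} => h'; congr Multigraph; exact: bool_irrelevance.
elim: es es' Ees {h h'} => [|[a b] es IH] [|[a' b'] es'] //= [/val_inj -> /val_inj -> /IH
    ->] //.
Qed.

Lemma encode_instance_inj G k G' k' :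
  encode_instance G k = encode_instance G' k' -> G = G' /\ k = k'.
Proof.
move=> /encode_nats_inj E; split; last exact: (congr1 (head 0) E).
exact/multigraph_nats_inj/(congr1 behead E).
Qed.

(** Descent on the value of [f], with a classical case distinction; it provides the optimal layout
    that the search problem requires to exist. *)
Lemma exists_minimum (T : Type) (P : T -> Prop) (f : T -> nat) :
  (exists x, P x) -> exists x, P x /\ forall y, P y -> f x <= f y.
Proof.
case=> x Px; have [n] := ubnP (f x); elim: n x Px => // n IH x Px lt_n.
have [[y [Py lt_y]]|none] := classic (exists y, P y /\ f y < f x).
  by apply: (IH y) => //; apply: leq_trans lt_y _.
exists x; split=> // y Py; rewrite leqNgt; apply/negP => lt_y.
by apply: none; exists y.
Qed.

Lemma valid_eq t E (col col' : nat -> bool) n : 3 * t <= n ->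
  (forall p : nat * nat, p \in E -> p.1 < p.2 /\ p.2 < n) ->
  (forall i, i < n -> col i = col' i) -> valid t E col = valid t E col'.
Proof.
move=> tn En H; rewrite /valid /bad_triangle /mono /=; congr andb.
  by apply: eq_in_all => c; rewrite mem_iota => Hc; rewrite !H //; lia.
by apply: eq_in_all => -[i j] /En[/= h1 h2]; rewrite !H //; lia.
Qed.

Section Reduction.

Variables (M : machine) (p q : {poly nat}) (V : word -> word).
Hypothesis M_V : computes_within M (fun n => horner p n) V.

(** The part of the verifier's input that is known in advance; the certificate follows it directly
    and is the guessed part of the tableau. *)
Definition prefix_of (x : seq bool) : seq bool :=
  flatten [seq [:: true; b] | b <- x] ++ [:: false].
Definition guess_bound (x : seq bool) : nat := horner q (size x).
Definition time_bound (x : seq bool) : nat :=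
  horner p (size (prefix_of x) + guess_bound x)%N.
Definition origin (x : seq bool) : nat :=
  time_bound x + size (prefix_of x) + guess_bound x + 1.

Definition formula x := tableau M (time_bound x) (origin x) (prefix_of x) (guess_bound x).
Definition triples x := nae_of (formula x).
Definition conflict_edges x := conflicts (flat (triples x)).
Definition tree_height x := height (2 * size (flat (triples x))).
Definition target x := instance (size (triples x)) (conflict_edges x) (tree_height x).
Definition limit x := threshold (size (triples x)) (conflict_edges x) (tree_height x).

Definition has_certificate (x : seq bool) : Prop :=
  exists c, size c <= horner q (size x) /\ V (pair_word x c) = [:: true].

Lemma pair_prefix x c : pair_word x c = prefix_of x ++ c.
Proof. by rewrite /pair_word /prefix_of -catA. Qed.

Lemma accepts_verifier x c : size c <= guess_bound x ->
  accepts (origin x) (iter (time_bound x) (@step M) (init M (prefix_of x ++ c))) =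
  (V (pair_word x c) == [:: true]).
Proof.
move=> Hc; have [fin out] := M_V (pair_word x c).
have le_time : horner p (size (pair_word x c)) <= time_bound x.
  by apply: horner_nat_mono; rewrite pair_prefix size_cat leq_add2l.
have stop : iter (time_bound x) (@step M) (init M (pair_word x c)) =
    iter (horner p (size (pair_word x c))) (@step M) (init M (pair_word x c)).
  by rewrite -(subnK le_time) iterD iter_step_final.
by rewrite accepts_output -pair_prefix stop // out.
Qed.

Lemma certificate_sat x : has_certificate x <-> exists v, sat v (formula x).
Proof.
have T_le : time_bound x < origin x by rewrite /origin; lia.
have ug : size (prefix_of x) + guess_bound x <= (origin x).+1 by rewrite /origin; lia.
split=> [[c [Hc Vc]]|[v Hv]].
  exists (run_values M (origin x) (prefix_of x ++ c)).
  apply: (tableau_complete T_le ug erefl Hc).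
  by rewrite accepts_verifier // Vc.
pose c := guess M (origin x) (prefix_of x) (guess_bound x) v.
have Hc : size c <= guess_bound x by rewrite size_map size_iota; exact: guess_end_le.
exists c; split=> //; apply/eqP; rewrite -accepts_verifier //.
exact: (tableau_sound T_le ug Hv).
Qed.

Lemma certificate_colouring x : has_certificate x <->
  exists col, valid (size (triples x)) (conflict_edges x) col.
Proof. by rewrite certificate_sat; exact: sat_colouring. Qed.

Lemma pt_formula : pt formula.
Proof.
have Hu : pt prefix_of by rewrite /prefix_of; pt_all.
have Hg : pt guess_bound by rewrite /guess_bound; pt_all.
have Ht : pt time_bound by rewrite /time_bound; pt_all.
have Ho : pt origin by rewrite /origin; pt_all.
exact: pt_tableau.
Qed.

Lemma pt_triples : pt triples.
Proof. exact: pt_nae_of pt_formula. Qed.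

Lemma pt_conflict_edges : pt conflict_edges.
Proof. exact/pt_conflicts/pt_flat/pt_triples. Qed.

Lemma pt_double_flat : pt (fun x => 2 * size (flat (triples x))).
Proof. by have Hf := pt_flat pt_triples; pt_all. Qed.

Lemma pt_target : pt (fun x => multigraph_nats (target x)).
Proof.
have Ht := pt_size pt_triples; have HC := pt_conflict_edges.
have HK := pt_height pt_double_flat; have HN := pt_exp_height pt_double_flat.
have HR := pt_constraints Ht HC.
have HW := pt_weight Ht HK HN HC (fun=> erefl).
have HG := pt_graph_edges HN HW HR.
apply: (pt_ext (f := fun x => (2 ^ height (2 * size (flat (triples x)))).+1 ::
  flatten [seq [:: e.1; e.2] | e <-
    graph_edges (weight (size (triples x)) (conflict_edges x) (height (2 * size (flat
        (triples x)))))
      (2 ^ height (2 * size (flat (triples x))))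
      (constraints (size (triples x)) (conflict_edges x))])).
  by move=> x; rewrite graph_of_nats.
by pt_all.
Qed.

Lemma polytime_target : polytime (fun x => encode_multigraph (target x)).
Proof. exact/pt_polytime/pt_encode_nats/pt_target. Qed.

Lemma polytime_instance : polytime (fun x => encode_instance (target x) (limit x)).
Proof.
have Ht := pt_size pt_triples; have HC := pt_conflict_edges.
have HK := pt_height pt_double_flat; have HN := pt_exp_height pt_double_flat.
have Hl : pt limit by exact: pt_threshold Ht HK HN HC (fun=> erefl).
by apply/pt_polytime/pt_encode_nats; have HT := pt_target; pt_all.
Qed.

(** The instance is recomputed from [x]. If a colouring exists, some layout meets the limit, so an
    optimal one does and its own colouring is valid; conversely a valid colouring is itself the
    evidence sought. *)
Definition check_layout (w : seq bool) : seq bool :=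
  let x := unpair_fst w in
  [:: valid (size (triples x)) (conflict_edges x)
        (decoded_colour (decode_nats (unpair_snd w)) (2 * tree_height x).-1)].

Lemma polytime_check : polytime check_layout.
Proof.
have Hx : pt unpair_fst by apply: pt_unpair_fst; exact: pt_id.
have Hy : pt unpair_snd by apply: pt_unpair_snd; exact: pt_id.
apply: pt_polytime; rewrite /check_layout; apply: pt_cons; last exact: pt_const.
apply: pt_valid.
- exact: pt_comp (pt_size pt_triples) Hx.
- exact: pt_comp pt_conflict_edges Hx.
- exact: pt_decode_nats Hy.
- have HK : pt tree_height by exact: pt_height pt_double_flat.
  by pt_all.
Qed.

Section Instance.

Variable x : seq bool.
Let t := size (triples x).
Let C := conflict_edges x.
Let K := tree_height x.
Let N := 2 ^ K.

Lemma tree_height_gt1 : 1 < K. Proof. by []. Qed.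

Lemma room : 2 * (3 * t) <= 2 ^ (K - 2).
Proof. by rewrite -size_flat; exact: height_ge. Qed.

Lemma triangles_room : 3 * t <= 2 ^ (K - 2).
Proof. by apply: leq_trans room; rewrite leq_pmull. Qed.

Lemma conflict_edges_bounds (e : nat * nat) : e \in C ->
  [/\ e.1 < e.2, e.2 < 2 ^ (K - 2) & 3 * t <= e.2].
Proof.
by move=> /conflicts_bounds[h1 h2 h3]; rewrite -size_flat; split=> //;
  apply: leq_trans h2 _; exact: height_ge.
Qed.

Lemma target_layout : exists l : layout N.+1, @tree_layout (target x) l.
Proof.
exists (heap_layout K id); apply: heap_tree_layout.
by rewrite map_id.
Qed.

Lemma colouring_layout col : valid t C col ->
  exists l : layout N.+1, @tree_layout (target x) l /\ @layout_length (target x) l <= limit x.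
Proof.
move=> Hcol; exists (colour_layout t K col); split.
  exact: (colour_layout_tree t C col tree_height_gt1).
exact: (colour_layout_length tree_height_gt1 (conflicts_uniq _) triangles_room
          conflict_edges_bounds Hcol).
Qed.

Lemma short_layout_valid (l : layout N.+1) : @tree_layout (target x) l ->
  @layout_length (target x) l <= limit x -> valid t C (layout_colour l K).
Proof.
exact: (layout_valid tree_height_gt1 (conflicts_uniq _) triangles_room
          conflict_edges_bounds).
Qed.

Lemma check_layoutE (l : layout N.+1) : @tree_layout (target x) l ->
  check_layout (pair_word x (encode_layout l)) = [:: valid t C (layout_colour l K)].
Proof.
case=> tree_l _ _ _; rewrite /check_layout unpair_fstE unpair_sndE; congr cons.
rewrite (decode_encode (layout_nats l)); apply: (@valid_eq _ _ _ _ (2 ^ (K - 2))).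
- exact: triangles_room.
- by move=> e /conflict_edges_bounds[].
move=> i Hi; have iN : i <= N.
  by apply: leq_trans (ltnW Hi) _; rewrite leq_exp2l // leq_subr.
exact: (decoded_layout_colour tree_l (ltnW tree_height_gt1) iN).
Qed.

End Instance.

End Reduction.

Theorem theorem3 :
  NP_hard_search min_tree_length /\ NP_hard min_tree_length_decision.
Proof.
split=> A [V [q [[M [p M_V]] AE]]].
  exists (fun x => encode_multigraph (target M p q x)), (check_layout M p q).
  split; [exact: polytime_target | exact: polytime_check |] => x; split.
    have [l [tree_l min_l]] := exists_minimum
      (fun l => @layout_length (target M p q x) l) (target_layout M p q x).
    by exists (encode_layout l), (target M p q x), l; split.
  (* A solution comes with a graph of its own, which injectivity of the encoding identifies with the
     target. *)
  move=> _ [G [l [/encode_nats_inj/multigraph_nats_inj EG opt ->]]].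
  case: G / EG l opt => l [tree_l min_l]; rewrite check_layoutE //.
  rewrite AE -/(has_certificate q V x) (certificate_colouring q M_V).
  split=> [[col /colouring_layout[l' [tree' short']]]|[Hv]].
    congr [:: _]; apply: short_layout_valid => //.
    by apply: leq_trans short'; exact: min_l.
  by eexists; exact: Hv.
exists (fun x => encode_instance (target M p q x) (limit M p q x)).
split; first exact: polytime_instance.
move=> x; rewrite AE -/(has_certificate q V x) (certificate_colouring q M_V); split.
  case=> col /colouring_layout[l [tree_l short]].
  by exists (target M p q x), (limit M p q x); split=> //; exists l.
case=> G [k [E [l [tree_l short]]]]; have [EG Ek] := encode_instance_inj E.
case: G / EG l tree_l short {E} => l tree_l; rewrite -Ek => short.
by exists (layout_colour l (tree_height M p q x)); exact: short_layout_valid.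
Qed.
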